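(* Let $K\subset\mathbb{R}^n$ be an $o$-symmetric convex body in Behrend position. Then \[ \operatorname{idq}(K)\ \ge\ \frac{1}{n!}. \] Equality holds if and only if $K$ is a regular crosspolytope.
   Context: A convex body in $\mathbb{R}^n$ is a compact convex set with nonempty interior; it is $o$-symmetric if $K=-K$. $\mathrm{D}(K)=\max\{\|x-y\|:x,y\in K\}$ is the Euclidean diameter and $\mathrm{vol}(K)$ is the $n$-dimensional volume. The isodiametric quotient is $\operatorname{idq}(K)=\mathrm{vol}(K)/\mathrm{D}(K)^n$. A convex body $K$ is in Behrend position (isodiametric position) if $\operatorname{idq}(K)=\max_{A\in \mathrm{GL}_n(\mathbb{R})}\operatorname{idq}(AK)$. A regular crosspolytope is a set of the form $\rho\cdot\operatorname{conv}\{\pm u_1,\dots,\pm u_n\}$, where $\{u_1,\dots,u_n\}$ is an orthonormal basis of $\mathbb{R}^n$ and $\rho>0$. *)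

(* Defs.v *)
From HB Require Import structures.
From mathcomp Require Import all_boot all_order all_algebra.
From mathcomp Require Import all_classical all_reals all_analysis.

Set Implicit Arguments.
Unset Strict Implicit.
Unset Printing Implicit Defensive.

Import Order.TTheory GRing.Theory Num.Theory.
Import numFieldNormedType.Exports.

Local Open Scope classical_set_scope.
Local Open Scope ring_scope.

(* Points of R^n are row vectors; linear maps act by right multiplication.
   The topology on 'rV[R]_n is the product topology of the library, but its
   norm is the sup norm, so the Euclidean structure is introduced here. *)

Definition dotp (R : realType) (n : nat) (x y : 'rV[R]_n) : R :=
  \sum_(i < n) x ord0 i * y ord0 i.

Definition enorm (R : realType) (n : nat) (x : 'rV[R]_n) : R :=
  Num.sqrt (dotp x x).

(* n-dimensional Lebesgue measure as the iterated product of the Lebesgue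
   measure on R: the successor case is the formula defining the product measure
   [lebesgue_measure \x volume], read through R^(n+1) = R * R^n.  Only its
   values on Borel sets (here: compact sets) are meaningful. *)
Fixpoint volume (R : realType) (n : nat) : set 'rV[R]_n -> \bar R :=
  match n with
  | 0 => fun A => (\1_A 0)%:E
  | m.+1 => fun A =>
      (\int[lebesgue_measure]_(x in [set: R])
         volume [set v : 'rV[R]_m | A (row_mx x%:M v)])%E
  end.

(* The supremum is a maximum when K is compact and nonempty. *)
Definition diameter (R : realType) (n : nat) (K : set 'rV[R]_n) : R :=
  sup [set enorm (x - y) | x in K & y in K].

Definition idq (R : realType) (n : nat) (K : set 'rV[R]_n) : R :=
  fine (volume K) / diameter K ^+ n.

Definition convex_body (R : realType) (n : nat) (K : set 'rV[R]_n) : Prop :=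
  [/\ compact K, convex_set K
    & K° !=set0].

Definition o_symmetric (R : realType) (n : nat) (K : set 'rV[R]_n) : Prop :=
  K = [set - x | x in K].

Definition linear_image (R : realType) (n : nat) (A : 'M[R]_n)
    (K : set 'rV[R]_n) : set 'rV[R]_n :=
  [set x *m A | x in K].

Definition is_max (R : realType) (S : set R) (m : R) : Prop :=
  S m /\ ubound S m.

Definition behrend_position (R : realType) (n : nat) (K : set 'rV[R]_n) : Prop :=
  is_max [set idq (linear_image A K) | A in [set A : 'M[R]_n | A \in unitmx]]
    (idq K).

Definition conv_hull (R : realType) (n : nat) (S : set 'rV[R]_n) :
    set 'rV[R]_n :=
  smallest (fun C => convex_set C) S.

Definition orthonormal_basis (R : realType) (n : nat) (u : 'I_n -> 'rV[R]_n) :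
    Prop :=
  basis_of {: 'rV[R]_n} [tuple u i | i < n] /\
  forall i j, dotp (u i) (u j) = (i == j)%:R.

Definition regular_crosspolytope (R : realType) (n : nat) (K : set 'rV[R]_n) :
    Prop :=
  exists (rho : R) (u : 'I_n -> 'rV[R]_n),
    [/\ 0 < rho, orthonormal_basis u
      & K = [set rho *: x | x in
               conv_hull (range u `|` range (fun i => - u i))]].

(* Main.v *)
Require Import Defs.
From HB Require Import structures.
From mathcomp Require Import all_boot all_order all_algebra fingroup perm.
From mathcomp Require Import all_classical all_reals all_analysis.
From mathcomp Require Import measurable_realfun ring lra.

Set Implicit Arguments.
Unset Strict Implicit.
Unset Printing Implicit Defensive.

Import Order.TTheory GRing.Theory Num.Theory.
Import numFieldNormedType.Exports.

Local Open Scope classical_set_scope.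
Local Open Scope ring_scope.

(** By compactness there are points u_i of K and weights c_i with sum 1 that
    maximise det M, M = sum c_i u_i^T u_i; stationarity gives x M^-1 x^T <= n on
    K.  Comparing K with its image under the inverse Cholesky factor of M, which
    lies in the ball of radius sqrt n, Behrend position yields
    det M >= (rho^2/n)^n, rho being the circumradius; as tr M <= rho^2, the AM-GM
    inequality forces M = (rho^2/n) I and |u_i| = rho.  So, after scaling by
    1/rho, the body K contains unit vectors u_i with sum c_i u_i^T u_i = I.
    Barthe's transport argument then bounds vol K from below.  Since
    int exp(-||y||_K) dy = n! vol K, let T transport the density
    (2/sqrt pi) exp(-s^2) to exp(-|t|) on the line and put
    Phi(x) = sum c_i T(<x,u_i>) u_i; then ||Phi(x)||_K <= sum c_i |T(<x,u_i>)|,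
    and the change of variables y = Phi(x), together with
    det(sum c_i t_i u_i^T u_i) >= prod t_i^(c_i), gives n! vol K >= 2^n.
    Equality in the determinant inequality makes some of the u_i orthonormal;
    their crosspolytope is then contained in K and has the same volume.
    To need only linear changes of variables, T is replaced by its piecewise
    linear interpolations on finer and finer grids. *)

(** * Borel sets and Lebesgue measure on row vectors *)

(** The diameter of an o-symmetric body is twice its circumradius, so comparing [idq] of K and of AK
    only involves the largest norm on each. Maximising det M is the dual form of the Löwner problem:
    x M^-1 x^T <= n is the ellipsoid of least volume centred at 0 around K, and Behrend position
    forces it to be the ball of radius rho. The bound 2^n is the mass of (2/sqrt pi)^n exp(-|x|^2);
    it cancels against the 2^n in D(K)^n = (2 rho)^n, which leaves exactly 1/n!. The determinant
    inequality is Jensen's inequality for exp, under the probability that Cauchy-Binet puts on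
    n-tuples of frame vectors. Equality cannot be followed through the discretisation, because every
    grid loses a factor. The grids therefore only serve to bound the integral of exp(-sum c_i
    |T(<x,u_i>)|) det DPhi(x) by n! vol K; the determinant inequality is applied afterwards,
    pointwise, to this exact density. There both sides are continuous, so strictness at one point
    separates the integrals. *)

Definition rV_display : measure_display := default_measure_display.

Section rV_measurable.
Context {R : realType} {n : nat}.

Let coord := fun (i : 'I_n) (x : 'rV[R]_n) => (x ord0 i : measurableTypeR R).

Let rV_set0 : g_sigma_preimage coord set0.
Proof. exact: sigma_algebra0. Qed.

Let rV_setC A : g_sigma_preimage coord A -> g_sigma_preimage coord (~` A).
Proof. exact: sigma_algebraC. Qed.

Let rV_bigcup (F : _^nat) : (forall i, g_sigma_preimage coord (F i)) ->
  g_sigma_preimage coord (\bigcup_i (F i)).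
Proof. exact: sigma_algebra_bigcup. Qed.

(** Generated by the coordinates rather than by the open sets: measurability of a map into row
    vectors then reduces to its coordinates, and the open sets are recovered in
    [open_measurable_rV]. *)
HB.instance Definition _ := @isMeasurable.Build rV_display
  'rV[R]_n (g_sigma_preimage coord) rV_set0 rV_setC rV_bigcup.

End rV_measurable.

Lemma measurable_coord {R : realType} n (i : 'I_n) :
  measurable_fun [set: 'rV[R]_n] (fun x : 'rV[R]_n => x ord0 i).
Proof.
move=> _ Y mY; rewrite setTI; apply: sub_sigma_algebra => /=.
rewrite -bigcup_seq/=; exists i => /=; first by rewrite mem_index_enum.
by exists Y => //; rewrite setTI.
Qed.

Lemma measurable_fun_coordP {R : realType} d (T : measurableType d) n (f : T -> 'rV[R]_n) :
  (forall i, measurable_fun [set: T] (fun x => f x ord0 i)) ->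
  measurable_fun [set: T] f.
Proof.
move=> mf.
have mcoord : g_sigma_preimage (fun i => (fun x : 'rV[R]_n => (x ord0 i : measurableTypeR R)) \o f)
    `<=` measurable.
  apply: smallest_sub; first exact: sigma_algebra_measurable.
  case: n => [|n] in f mf *; first by rewrite big_ord0.
  rewrite -bigcup_mkord_ord; apply: bigcup_sub => i Ii.
  by move=> A [B mB <-]; exact: mf.
move: mcoord.
pose T' : pointedType := T.
rewrite (@g_sigma_preimage_comp _ _ _ _ _ _ f).
move=> h _ A mA; apply: h. by exists A.
Qed.

Definition rV_cons {R : realType} {m : nat} (p : measurableTypeR R * 'rV[R]_m) :
  'rV[R]_m.+1 := row_mx (p.1 : R)%:M p.2.

Lemma rV_consE {R : realType} m (p : measurableTypeR R * 'rV[R]_m) i :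
  rV_cons p ord0 i = if unlift ord0 i is Some j then p.2 ord0 j else p.1.
Proof.
rewrite /rV_cons; case: unliftP => [j ->|->].
  have -> : lift ord0 j = rshift 1 j by apply: val_inj.
  by rewrite (@row_mxEr _ 1 1 m).
have -> : (ord0 : 'I_m.+1) = lshift m (ord0 : 'I_1) by apply: val_inj.
by rewrite (@row_mxEl _ 1 1 m) mxE eqxx mulr1n.
Qed.

Lemma measurable_rV_cons {R : realType} m :
  measurable_fun [set: (measurableTypeR R * 'rV[R]_m)%type] (@rV_cons R m).
Proof.
apply: measurable_fun_coordP => i.
under eq_fun do rewrite rV_consE.
case: unliftP => [j _|_]; last exact: measurable_fst.
exact: (measurableT_comp (@measurable_coord R m j) measurable_snd).
Qed.

Definition rV_uncons {R : realType} {m : nat} (x : 'rV[R]_m.+1) :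
  measurableTypeR R * 'rV[R]_m := (x ord0 ord0, \row_j x ord0 (lift ord0 j)).

Lemma rV_unconsK {R : realType} m : cancel (@rV_uncons R m) (@rV_cons R m).
Proof.
move=> x; apply/rowP => i; rewrite rV_consE.
by case: unliftP => [j ->|->] //=; rewrite mxE.
Qed.

Lemma rV_consK {R : realType} m : cancel (@rV_cons R m) (@rV_uncons R m).
Proof.
move=> [x v]; rewrite /rV_uncons rV_consE unlift_none; congr pair.
by apply/rowP => i; rewrite mxE rV_consE liftK.
Qed.

Lemma measurable_rV_uncons {R : realType} m :
  measurable_fun [set: 'rV[R]_m.+1] (@rV_uncons R m).
Proof.
apply: measurable_fun_pair; first exact: measurable_coord.
apply: measurable_fun_coordP => i; under eq_fun do rewrite mxE.
exact: measurable_coord.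
Qed.

Section rV_succ_measure.
Context {R : realType} {m : nat} (mu : {sigma_finite_measure set 'rV[R]_m -> \bar R}).

Definition rV_succ (A : set 'rV[R]_m.+1) : \bar R :=
  (@lebesgue_measure R \x mu)%E (rV_cons @^-1` A).

Let msucc A : measurable A -> measurable (@rV_cons R m @^-1` A).
Proof. by move=> mA; rewrite -[X in measurable X]setTI; exact: measurable_rV_cons. Qed.

Let succ0 : rV_succ set0 = 0%E.
Proof. by rewrite /rV_succ preimage_set0 measure0. Qed.

Let succ_ge0 A : (0 <= rV_succ A)%E.
Proof. exact: measure_ge0. Qed.

Let succ_sigma_additive : semi_sigma_additive rV_succ.
Proof.
move=> F mF tF mUF; rewrite /rV_succ preimage_bigcup.
apply: measure_semi_sigma_additive.
- by move=> n; exact: msucc.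
- apply/trivIsetP => /= i j _ _ ij; rewrite -preimage_setI.
  by move/trivIsetP : tF => /(_ _ _ _ _ ij) ->//; rewrite preimage_set0.
- by rewrite -preimage_bigcup; exact: msucc.
Qed.

HB.instance Definition _ := isMeasure.Build _ _ _
  rV_succ succ0 succ_ge0 succ_sigma_additive.

Let succ_sigma_finite : sigma_finite setT rV_succ.
Proof.
have /sigma_finiteP[F [TF ndF Foo]] := sigma_finiteT (@lebesgue_measure R).
have /sigma_finiteP[G [TG ndG Goo]] := sigma_finiteT mu.
exists (fun k => rV_uncons @^-1` (F k `*` G k)).
  apply/esym; rewrite -subTset => x _.
  have [k _ Fk] : (\bigcup_i F i) (rV_uncons x).1 by rewrite -TF.
  have [l _ Gl] : (\bigcup_i G i) (rV_uncons x).2 by rewrite -TG.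
  exists (maxn k l) => //; split => /=.
    by move: Fk; apply/subsetPset/ndF/leq_maxl.
  by move: Gl; apply/subsetPset/ndG/leq_maxr.
move=> k; have [mF Fk] := Foo k; have [mG Gk] := Goo k; split.
  by rewrite -[X in measurable X]setTI; apply: measurable_rV_uncons => //; exact: measurableX.
rewrite /rV_succ -comp_preimage (_ : _ \o _ = id) ?preimage_id//; last first.
  by apply/funext => x /=; rewrite rV_consK.
by rewrite product_measure1E// lte_mul_pinfty// ge0_fin_numE.
Qed.

HB.instance Definition _ := Measure_isSigmaFinite.Build _ _ _ rV_succ
  succ_sigma_finite.

End rV_succ_measure.

(** [volume] as a bundled measure. Sigma-finiteness is carried along because the next product and
    every use of Tonelli's theorem ask for it. *)
Fixpoint lebn (R : realType) (n : nat) : {sigma_finite_measure set 'rV[R]_n -> \bar R} :=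
  match n with
  | 0 => \d_(0 : 'rV[R]_0)
  | m.+1 => rV_succ (lebn R m)
  end.

Lemma volumeE (R : realType) n (A : set 'rV[R]_n) : volume A = lebn R n A.
Proof.
elim: n A => [|n IH] A //=.
rewrite /rV_succ /product_measure1/=; apply: eq_integral => x _.
by rewrite IH /= xsectionE.
Qed.

Definition image_measure d d' (T : measurableType d) (T' : measurableType d')
    (R : realFieldType) (mu : {measure set T -> \bar R}) (f : T -> T')
    (mf : measurable_fun [set: T] f) : {measure set T' -> \bar R} :=
  measure_function_pushforward__canonical__measure_function_Measure mu mf.

Lemma ge0_integral_image d d' (T : measurableType d) (T' : measurableType d')
    (R : realType) (mu : {measure set T -> \bar R}) (phi : T -> T')
    (mphi : measurable_fun [set: T] phi) (f : T' -> \bar R) :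
  measurable_fun [set: T'] f -> (forall x, 0 <= f x)%E ->
  (\int[image_measure mu mphi]_x f x = \int[mu]_x f (phi x))%E.
Proof. by move=> mf f0; rewrite (ge0_integral_pushforward mphi). Qed.

Lemma ge0_integral_lebnS (R : realType) m (f : 'rV[R]_m.+1 -> \bar R) :
  measurable_fun [set: 'rV[R]_m.+1] f -> (forall x, 0 <= f x)%E ->
  (\int[lebn R m.+1]_x f x =
   \int[@lebesgue_measure R]_x \int[lebn R m]_v f (rV_cons (x, v)))%E.
Proof.
move=> mf f0.
rewrite (eq_measure_integral
  (image_measure (@lebesgue_measure R \x lebn R m)%E (@measurable_rV_cons R m)))//.
rewrite ge0_integral_image//.
rewrite (fubini_tonelli1 (f \o @rV_cons R m))//; last by move=> x; exact: f0.
by apply: measurableT_comp => //; exact: measurable_rV_cons.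
Qed.

Lemma measurable_xsection_lebn (R : realType) m (A : set 'rV[R]_m.+1) (x : R) :
  measurable A -> measurable [set v : 'rV[R]_m | A (rV_cons (x, v))].
Proof.
move=> mA.
have := @measurable_xsection _ _ (measurableTypeR R) 'rV[R]_m (rV_cons @^-1` A) x.
rewrite xsectionE; apply.
by rewrite -[X in measurable X]setTI; exact: measurable_rV_cons.
Qed.

Lemma lebnSE (R : realType) m (A : set 'rV[R]_m.+1) :
  lebn R m.+1 A =
  (\int[@lebesgue_measure R]_x lebn R m [set v : 'rV[R]_m | A (rV_cons (x, v))])%E.
Proof.
rewrite /= /rV_succ /product_measure1/=; apply: eq_integral => x _.
by rewrite xsectionE.
Qed.

(** Tonelli's theorem with the first coordinate integrated innermost, the order suited to maps that
    move only that coordinate. *)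
Lemma lebnSE2 (R : realType) m (A : set 'rV[R]_m.+1) : measurable A ->
  lebn R m.+1 A =
  (\int[lebn R m]_v @lebesgue_measure R [set x : R | A (rV_cons (x, v))])%E.
Proof.
move=> mA.
have mA' : measurable (@rV_cons R m @^-1` A).
  by rewrite -[X in measurable X]setTI; exact: measurable_rV_cons.
have -> : lebn R m.+1 A = (lebesgue_measure \x^ lebn R m)%E (@rV_cons R m @^-1` A).
  rewrite /= /rV_succ; apply: product_measure_unique => //= B C mB mC.
  by rewrite product_measure2E.
rewrite /product_measure2/=; apply: eq_integral => v _.
by rewrite ysectionE.
Qed.

Lemma measurable_fun_section (R : realType) m (A : set 'rV[R]_m.+1) : measurable A ->
  measurable_fun [set: measurableTypeR R] (fun x : measurableTypeR R => lebn R m [set v : 'rV[R]_m | A (rV_cons (x, v))]).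
Proof.
move=> mA.
have mA' : measurable (@rV_cons R m @^-1` A).
  by rewrite -[X in measurable X]setTI; exact: measurable_rV_cons.
have := measurable_fun_xsection (lebn R m) mA'.
congr (measurable_fun _ _); apply/funext => x /=.
by rewrite xsectionE.
Qed.

Lemma measurable_affine1 (R : realType) (a b : R) :
  measurable_fun [set: measurableTypeR R] (fun x : measurableTypeR R => (x * a + b : measurableTypeR R)).
Proof. by apply: measurable_funD => //; exact: measurable_funM. Qed.

(** Lebesgue measure is determined by its values on half-open intervals, so the push-forward times
    [|a|] need only be compared with it there; a negative slope exchanges the endpoints. *)
Lemma lebesgue_affine (R : realType) (a b : R) (A : set (measurableTypeR R)) :
  a != 0 -> measurable A ->
  lebesgue_measure [set x : R | A (x * a + b)] = (`|a|^-1%:E * lebesgue_measure A)%E.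
Proof.
move=> a0 mA.
pose muM := image_measure (@lebesgue_measure R) (measurable_affine1 a b).
suff -> : lebesgue_measure A = (`|a|%:E * muM A)%E.
  by rewrite muleA -EFinM mulVf ?normr_eq0// mul1e.
have a0' : 0 <= `|a| by [].
rewrite -[RHS]/(mscale (NngNum a0') muM A).
apply: lebesgue_measure_unique => // X [[c d] _ <-].
change (lebesgue_measure `]c, d] =
  (`|a|%:E * lebesgue_measure [set x : R | `]c, d]%classic (x * a + b)%R])%E).
have [|dc] := ltP c d; last first.
  rewrite set_itv_ge ?bnd_simp -?leNgt//.
  by rewrite (_ : [set x | _] = set0) ?measure0 ?mule0.
move=> cd.
have [ap|an] : 0 < a \/ a < 0 by move: a0; rewrite neq_lt => /orP[]; auto.
  rewrite (_ : [set x : R | `]c, d]%classic (x * a + b)%R] = `](c - b) / a, (d - b) / a]%classic); last first.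
    apply/seteqP; split => x /=; rewrite !in_itv/=;
    by rewrite ltr_pdivrMr// ler_pdivlMr// ltrBlDr lerBrDr.
  rewrite !lebesgue_measure_itv/= !lte_fin cd ltr_pM2r ?invr_gt0// ltrD2r cd.
  rewrite gtr0_norm// -!EFinB -EFinM; congr EFin.
  by field.
rewrite (_ : [set x : R | `]c, d]%classic (x * a + b)%R] = `[(d - b) / a, (c - b) / a[%classic); last first.
  apply/seteqP; split => x /=; rewrite !in_itv/=;
  by rewrite ltr_ndivlMr// ler_ndivrMr// ltrBlDr lerBrDr andbC.
rewrite !lebesgue_measure_itv/= !lte_fin cd ltr_nM2r ?invr_lt0// ltrD2r cd.
rewrite ltr0_norm// -!EFinB -EFinM; congr EFin.
by field.
Qed.

Lemma ge0_integral_affine (R : realType) (a b : R) (f : measurableTypeR R -> \bar R) :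
  a != 0 -> measurable_fun [set: measurableTypeR R] f -> (forall x, 0 <= f x)%E ->
  (\int[lebesgue_measure]_x f ((x : R) * a + b)%R =
   `|a|^-1%:E * \int[lebesgue_measure]_x f x)%E.
Proof.
move=> a0 mf f0.
have a0' : 0 <= `|a|^-1 by [].
rewrite -[RHS]/((NngNum a0')%:num%:E * \int[lebesgue_measure]_x f x)%E.
rewrite -ge0_integral_mscale//.
rewrite -(ge0_integral_image lebesgue_measure (measurable_affine1 a b))//.
apply: eq_measure_integral => A mA _.
change (lebesgue_measure [set x : R | A (x * a + b)%R] =
  (`|a|^-1%:E * lebesgue_measure A)%E).
by rewrite lebesgue_affine.
Qed.

Lemma measurable_affine (R : realType) m n (B : 'M[R]_(m, n)) (c : 'rV[R]_n) :
  measurable_fun [set: 'rV[R]_m] (fun x : 'rV[R]_m => x *m B + c).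
Proof.
apply: measurable_fun_coordP => i.
under eq_fun do rewrite !mxE.
apply: measurable_funD => //.
apply: measurable_sum => j.
by apply: measurable_funM => //; exact: measurable_coord.
Qed.

Lemma measurable_affine_preimage (R : realType) m n (B : 'M[R]_(m, n)) (c : 'rV[R]_n) A :
  measurable A -> measurable [set x : 'rV[R]_m | A (x *m B + c)].
Proof.
by move=> mA; rewrite -[X in measurable X]setTI; exact: (measurable_affine B c).
Qed.

Lemma rV_consD (R : realType) m (x y : R) (v w : 'rV[R]_m) :
  rV_cons (x, v) + rV_cons (y, w) = rV_cons (x + y, v + w).
Proof. by apply/rowP => i; rewrite mxE !rV_consE; case: unlift => [j|]//=; rewrite mxE. Qed.

Lemma rV_consP (R : realType) m (x : 'rV[R]_m.+1) : exists y v, x = rV_cons (y, v).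
Proof. by exists (x ord0 ord0), (\row_j x ord0 (lift ord0 j)); rewrite -[LHS]rV_unconsK. Qed.

Lemma rV_cons_mul_upper (R : realType) m (x a : R) (v b : 'rV[R]_m) (D : 'M[R]_m) :
  rV_cons (x, v) *m block_mx (a%:M : 'M[R]_1) b 0 D = rV_cons (x * a, v *m D + x *: b) :> 'rV_m.+1.
Proof.
rewrite /rV_cons (@mul_row_block _ 1 1 m 1 m) mulmx0 addr0 /= -scalar_mxM.
by rewrite mul_scalar_mx addrC.
Qed.

Lemma rV_cons_mul_lower (R : realType) m (x : R) (v : 'rV[R]_m) (w : 'cV[R]_m) :
  rV_cons (x, v) *m block_mx (1%:M : 'M[R]_1) 0 w (1%:M : 'M[R]_m)
  = rV_cons (x + (v *m w) ord0 ord0, v) :> 'rV_m.+1.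
Proof.
rewrite /rV_cons (@mul_row_block _ 1 1 m 1 m) mulmx0 add0r /= !mulmx1.
by rewrite raddfD /= -mx11_scalar.
Qed.

(** * Affine changes of variables *)

Section lebn_affine.
Context {R : realType}.

(** Translations are included because a slice of a block-triangular map is affine, with a shift that
    depends on the first coordinate. *)
Definition lebn_scales n (B : 'M[R]_n) := forall c (A : set 'rV[R]_n), measurable A ->
  lebn R n [set x | A (x *m B + c)] = (`|\det B|^-1%:E * lebn R n A)%E.

Lemma lebn_scalesM n (B C : 'M[R]_n) :
  lebn_scales B -> lebn_scales C -> lebn_scales (B *m C).
Proof.
move=> hB hC c A mA.
have -> : [set x | A (x *m (B *m C) + c)] = [set x | [set y | A (y *m C + c)] (x *m B + 0)].
  by apply/seteqP; split => x /=; rewrite addr0 mulmxA.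
rewrite hB; last exact: measurable_affine_preimage.
by rewrite hC// muleA -EFinM det_mulmx normrM invfM.
Qed.

Lemma lebn_scales_upper m (a : R) (b : 'rV[R]_m) (D : 'M[R]_m) : a != 0 ->
  lebn_scales D -> @lebn_scales m.+1 (block_mx (a%:M : 'M[R]_1) b 0 D).
Proof.
move=> a0 hD c A mA.
have [c0 [c1 ->]] := rV_consP c.
have mf := measurable_fun_section mA.
rewrite lebnSE.
under eq_integral => x _.
  rewrite (_ : [set v | _] = [set v | [set w | A (rV_cons (x * a + c0, w))] (v *m D + (x *: b + c1))]); last first.
    by apply/seteqP; split => v /=; rewrite rV_cons_mul_upper rV_consD addrA.
  rewrite hD; last exact: measurable_xsection_lebn.
  over.
rewrite ge0_integralZl//; last first.
  exact: (measurableT_comp mf (measurable_affine1 a c0)).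
rewrite (ge0_integral_affine _ a0 mf)// muleA -EFinM -lebnSE.
by rewrite (@det_ublock _ 1 m) det_scalar1 normrM invfM mulrC.
Qed.

(** In slices along the first coordinate the shear is a translation by an amount fixed by the other
    coordinates. The hypothesis, about the identity matrix, supplies the translation by [c]. *)
Lemma lebn_scales_shear m (w : 'cV[R]_m) :
  @lebn_scales m.+1 (block_mx (1%:M : 'M[R]_1) 0 0 1%:M) ->
  @lebn_scales m.+1 (block_mx (1%:M : 'M[R]_1) 0 w 1%:M).
Proof.
move=> h1.
suff h A : measurable A -> lebn R m.+1 [set x | A (x *m block_mx (1%:M : 'M[R]_1) 0 w 1%:M)] = lebn R m.+1 A.
  move=> c A mA.
  pose A' := [set x : 'rV[R]_m.+1 | A (x + c)].
  have mA' : measurable A'.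
    have := @measurable_affine_preimage _ _ _ (1%:M : 'M[R]_m.+1) c _ mA.
    by congr (measurable _); apply/seteqP; split => x /=; rewrite mulmx1.
  rewrite (h A' mA').
  have := h1 c A mA.
  rewrite (_ : [set x | _] = A'); last first.
    apply/seteqP; split => x /=;
    by rewrite -(@scalar_mx_block _ 1 m) mulmx1.
  by move=> ->; rewrite -(@scalar_mx_block _ 1 m) det1 (@det_lblock _ 1 m) !det1 mulr1.
move=> mA.
rewrite lebnSE2; last first.
  have := @measurable_affine_preimage _ _ _ (block_mx (1%:M : 'M[R]_1) 0 w 1%:M : 'M[R]_m.+1) 0 _ mA.
  by congr (measurable _); apply/seteqP; split => x /=; rewrite addr0.
rewrite lebnSE2//; apply: eq_integral => v _.
rewrite (_ : [set x | _] = [set x : R | [set y : R | A (rV_cons (y, v))] (x * 1 + (v *m w) ord0 ord0)]); last first.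
  by apply/seteqP; split => x /=; rewrite rV_cons_mul_lower mulr1.
rewrite lebesgue_affine ?oner_eq0//; first by rewrite normr1 invr1 mul1e.
have := @measurable_ysection _ _ (measurableTypeR R) 'rV[R]_m (rV_cons @^-1` A) v.
rewrite ysectionE; apply.
by rewrite -[X in measurable X]setTI; exact: measurable_rV_cons.
Qed.

(** Block Gaussian elimination: with a nonzero pivot the matrix is a lower shear times a
    block-upper-triangular matrix whose lower block, the Schur complement, is smaller. *)
Lemma lebn_affine n (B : 'M[R]_n) : B \in unitmx -> lebn_scales B.
Proof.
elim: n B => [|m IH] B uB.
  move=> c A mA; rewrite det_mx00 normr1 invr1 mul1e.
  by congr (lebn _ _ _); apply/seteqP; split => x /=; rewrite (thinmx0 (x *m B + c)) (thinmx0 x).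
have IH1 : lebn_scales (1%:M : 'M[R]_m) by apply: IH; rewrite unitmx1.
have step (C : 'M[R]_(1 + m)) : C \in unitmx -> C ord0 ord0 != 0 -> @lebn_scales m.+1 C.
  move=> uC C0.
  pose a := C ord0 ord0; pose b := ursubmx C; pose c := dlsubmx C.
  have ulC : ulsubmx C = a%:M.
    by rewrite [LHS]mx11_scalar !mxE; congr (C _ _)%:M; apply: val_inj.
  have CE : C = block_mx (1%:M : 'M[R]_1) 0 (a^-1 *: c) (1%:M : 'M[R]_m) *m
               block_mx a%:M b 0 (drsubmx C - (a^-1 *: c) *m b).
    rewrite mulmx_block !mul1mx !mul0mx !addr0.
    rewrite mul_mx_scalar scalerA mulfV// scale1r addrC subrK -ulC.
    by rewrite submxK.
  move: (uC); rewrite unitmxE CE det_mulmx det_lblock det_ublock !det1 !mul1r.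
  rewrite det_scalar1 unitrM => /andP[ua uD].
  apply: lebn_scalesM; first apply: lebn_scales_shear.
    apply: lebn_scales_upper => //; exact: oner_neq0.
  by apply: lebn_scales_upper => //; apply: IH.
have [B0|B0] := eqVneq (B ord0 ord0) 0; last exact: step.
have [i Bi] : exists i, B i ord0 != 0.
  apply: contrapT => /forallNP h.
  have : col ord0 B = 0.
    by apply/colP => i; rewrite !mxE; apply/eqP; apply: contrapT => /negP; exact: h.
  move=> col0; move: uB; rewrite -unitmx_tr unitmxE (expand_det_row _ ord0) big1 ?unitr0// => j _.
  by move/colP: col0 => /(_ j); rewrite !mxE => ->; rewrite mul0r.
have [j ij] : exists j : 'I_m, i = lift ord0 j.
  by case: (unliftP ord0 i) => [j ->|i0]; [exists j|rewrite i0 B0 eqxx in Bi].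
(* With a zero pivot, [E 1] adds row [i] of [B] to the first row, which makes the pivot nonzero, and
   [E (-1)] undoes this. *)
pose E (s : R) : 'M[R]_(1 + m) := block_mx 1%:M (s *: delta_mx ord0 j) 0 1%:M.
have hE s : @lebn_scales m.+1 (E s) by apply: lebn_scales_upper => //; exact: oner_neq0.
have EE : E (-1) *m E 1 = 1%:M.
  rewrite /E mulmx_block !mul1mx !mul0mx !mulmx0 !addr0 add0r mulmx1 scale1r scaleN1r subrr.
  by rewrite -scalar_mx_block.
have E0j s k : E s ord0 (lift ord0 k) = s * (k == j)%:R.
  have -> : lift ord0 k = rshift 1 k by apply: val_inj.
  have -> : ord0 = lshift m (ord0 : 'I_1) by apply: val_inj.
  by rewrite /E block_mxEur !mxE eqxx.
have -> : B = E (-1) *m (E 1 *m B) by rewrite mulmxA EE mul1mx.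
apply: lebn_scalesM => //; apply: step.
  rewrite unitmx_mul uB andbT unitmxE /E det_ublock !det1 mulr1 unitr1 //.
rewrite mxE big_ord_recl.
rewrite (bigD1 j)//= big1 ?addr0; last first.
  by move=> k kj; rewrite E0j (negbTE kj) mulr0 mul0r.
by rewrite B0 mulr0 add0r E0j eqxx mulr1 mul1r -ij.
Qed.

End lebn_affine.

(** * Boxes, open sets and compact sets *)

Lemma ball_rVP (R : realType) n (x y : 'rV[R]_n) e : 0 < e ->
  (forall i, `|x ord0 i - y ord0 i| < e) -> ball x e y.
Proof.
move=> e0 h.
by split => // i j; rewrite ord1; exact: h.
Qed.

Lemma measurable_rV_box (R : realType) n (c : 'I_n -> R) (r : R) :
  measurable [set x : 'rV[R]_n | forall i, `|x ord0 i - c i| < r].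
Proof.
rewrite (_ : [set x | _] = \bigcap_(i in [set: 'I_n]) [set x : 'rV[R]_n | ball (c i) r (x ord0 i)]); last first.
  by apply/seteqP; split => x /= h i; [move=> _ /=; rewrite /ball/= distrC; exact: h|rewrite distrC; exact: (h i)].
apply: fin_bigcap_measurable; first exact: finite_finset.
move=> i _; rewrite -[X in measurable X]setTI.
by apply: (@measurable_coord R n i) => //; exact: measurable_ball.
Qed.

(** Every open set is the union of the boxes it contains with rational centre and half-width
    1/(k+1), of which there are countably many. *)
Lemma open_measurable_rV (R : realType) n (A : set 'rV[R]_n) : open A -> measurable A.
Proof.
move=> oA.
pose box (qk : {ffun 'I_n -> rat} * nat) :=
  [set x : 'rV[R]_n | forall i, `|x ord0 i - ratr (qk.1 i)| < qk.2.+1%:R^-1].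
have -> : A = \bigcup_(qk in [set: {ffun 'I_n -> rat} * nat])
    [set x | box qk x /\ box qk `<=` A].
  apply/seteqP; split; last by move=> x [qk _] [? h]; exact: h.
  move=> x Ax; have /nbhs_ballP[e/= e0 xeA] : nbhs x A by apply: open_nbhs_nbhs.
  have e20 : 0 < e / 2 by rewrite divr_gt0.
  have [k] := ltr_add_invr e20; rewrite add0r => ke.
  have /choice[q qx] : forall i : 'I_n, exists q : rat, ratr q \in `]x ord0 i, x ord0 i + k.+1%:R^-1[.
    by move=> i; apply: rat_in_itvoo; rewrite ltrDl invr_gt0.
  exists ([ffun i => q i], k) => //; split.
    move=> i /=; rewrite ffunE; move: (qx i); rewrite in_itv/= => /andP[h1 h2].
    by rewrite ltr0_norm ?subr_lt0// opprB ltrBlDr addrC.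
  move=> y /= hy; apply: xeA; apply: ball_rVP => // i.
  move: (qx i) (hy i); rewrite in_itv/= ffunE => /andP[h1 h2] h3.
  rewrite -(subrK (ratr (q i)) (x ord0 i)) -addrA (le_lt_trans (ler_normD _ _))//.
  rewrite [ltRHS](splitr e) ltrD//.
    by rewrite ltr0_norm ?subr_lt0// opprB ltrBlDr addrC (lt_trans h2)// ltrD2l.
  by rewrite distrC (lt_trans h3).
apply: countable_bigcupT_measurable; first exact: countableP.
move=> qk; have [h|h] := pselect (box qk `<=` A).
  rewrite (_ : [set x | _] = box qk); first exact: measurable_rV_box.
  by apply/seteqP; split => x // [].
by rewrite (_ : [set x | _] = set0)//; apply/seteqP; split => x // [].
Qed.

Lemma closed_measurable_rV (R : realType) n (A : set 'rV[R]_n) : closed A -> measurable A.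
Proof. by move=> cA; rewrite -[A]setCK; apply: measurableC; apply: open_measurable_rV; exact: closed_openC. Qed.

Lemma compact_measurable_rV (R : realType) n (A : set 'rV[R]_n) : compact A -> measurable A.
Proof. by move=> cA; apply: closed_measurable_rV; apply: compact_closed => //; exact: norm_hausdorff. Qed.

Lemma lebn_translate (R : realType) n (c : 'rV[R]_n) A : measurable A ->
  lebn R n [set x | A (x + c)] = lebn R n A.
Proof.
move=> mA; have := lebn_affine (unitmx1 R n) c mA.
rewrite det1 normr1 invr1 mul1e => <-; congr (lebn _ _ _).
by apply/seteqP; split => x /=; rewrite mulmx1.
Qed.

Lemma lebn_box (R : realType) n (r : R) : 0 <= r ->
  lebn R n [set x : 'rV[R]_n | forall i, `|x ord0 i| < r] = ((r *+ 2) ^+ n)%:E.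
Proof.
move=> r0; elim: n => [|n IH].
  rewrite /= expr0 diracE mem_set//= => -[] //.
have mb : measurable [set x : 'rV[R]_n | forall i, `|x ord0 i| < r].
  have := @measurable_rV_box R n (fun=> 0) r.
  by congr (measurable _); apply/seteqP; split => x /= h i; have := h i; rewrite subr0.
transitivity ((@lebesgue_measure R \x lebn R n)%E (ball 0 r `*` [set x : 'rV[R]_n | forall i, `|x ord0 i| < r])).
  rewrite /= /rV_succ; congr (_ _); apply/seteqP; split => -[x v] /=.
    move=> h; split; first by have := h ord0; rewrite rV_consE unlift_none /ball/= sub0r normrN.
    by move=> i; have := h (lift ord0 i); rewrite rV_consE liftK.
  by move=> [hx hv] i; rewrite rV_consE; case: unliftP => [j _|_] //=; move: hx; rewrite /ball/= sub0r normrN.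
rewrite product_measure1E//; last exact: measurable_ball.
by rewrite IH [X in (X * _)%E](lebesgue_measure_ball 0 r0) -EFinM exprS.
Qed.

Lemma lebn_compact_lty (R : realType) n (A : set 'rV[R]_n) : compact A -> (lebn R n A < +oo)%E.
Proof.
move=> cA; have [M [_ hM]] := compact_bounded cA.
have M1 : M < `|M| + 1 by rewrite (le_lt_trans (ler_norm M))// ltrDl.
apply: (@le_lt_trans _ _ (lebn R n [set x : 'rV[R]_n | forall i, `|x ord0 i| < `|M| + 2])); last first.
  by rewrite lebn_box ?ltry// addr_ge0.
apply: le_measure; rewrite ?inE.
- exact: compact_measurable_rV.
- have := @measurable_rV_box R n (fun=> 0) (`|M| + 2).
  by congr (measurable _); apply/seteqP; split => x /= h i; have := h i; rewrite subr0.
- move=> x Ax i /=; have := hM _ M1 x Ax => /= h.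
  apply: (@le_lt_trans _ _ (`|M| + 1)); last by rewrite ltrD2l ltr1n.
  apply: le_trans h.
  rewrite /Num.norm/= mx_normrE.
  exact: (le_bigmax _ (fun ij => `|x ij.1 ij.2|) (ord0, i)).
Qed.

Lemma lebn_open_gt0 (R : realType) n (A : set 'rV[R]_n) : open A -> A !=set0 -> (0 < lebn R n A)%E.
Proof.
move=> oA [x Ax]; have /nbhs_ballP[e/= e0 xeA] : nbhs x A by apply: open_nbhs_nbhs.
have mb : measurable [set x : 'rV[R]_n | forall i, `|x ord0 i| < e].
  have := @measurable_rV_box R n (fun=> 0) e.
  by congr (measurable _); apply/seteqP; split => y /= h i; have := h i; rewrite subr0.
apply: (@lt_le_trans _ _ (lebn R n [set x : 'rV[R]_n | forall i, `|x ord0 i| < e])).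
  by rewrite lebn_box ?(ltW e0)// lte_fin exprn_gt0// mulrn_wgt0.
rewrite -(lebn_translate (- x) mb); apply: le_measure; rewrite ?inE.
- have := @measurable_rV_box R n (fun i => x ord0 i) e.
  by congr (measurable _); apply/seteqP; split => y /= h i; have := h i; rewrite !mxE.
- exact: open_measurable_rV.
- by move=> y /= h; apply: xeA; apply: ball_rVP => // i; have := h i; rewrite !mxE distrC.
Qed.

(** * Integrals of x^n exp(-x), by primitives vanishing at infinity *)

Fixpoint gamma_primitive (R : realType) n (x : R) : R :=
  if n is m.+1 then m.+1%:R * gamma_primitive m x - x ^+ m.+1 * expR (- x)
  else - expR (- x).

Lemma is_derive_expRN (R : realType) (x : R) :
  is_derive x 1 (fun y : R => expR (- y)) (- expR (- x)).
Proof.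
by apply: is_derive_eq; rewrite mulrN1.
Qed.

Lemma is_derive_gamma_primitive (R : realType) n (x : R) :
  is_derive x 1 (gamma_primitive n : R -> R) (x ^+ n * expR (- x)).
Proof.
elim: n => [|n IH] /=.
  have h := is_derive_expRN x.
  by apply: is_derive_eq; rewrite expr0 mul1r opprK.
have h := is_derive_expRN x.
have h1 : is_derive x 1 (fun y : R => n.+1%:R * gamma_primitive n y) (n.+1%:R * (x ^+ n * expR (- x))).
  exact: is_deriveZ.
have h2 : is_derive x 1 (fun y : R => y ^+ n.+1) (n.+1%:R * x ^+ n).
  have := is_deriveX n.+1 (is_derive_id x (1 : R)).
  by rewrite exprfctE /GRing.scale/= mulr1.
apply: is_derive_eq.
rewrite /GRing.scale/= exprS. set e := expR _. set y := x ^+ n.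
ring.
Qed.

(** The exponential dominates x^(n+1) / (n+1)!, which leaves the bound (n+1)! / x. *)
Lemma cvg_exp_expRN (R : realType) n : x ^+ n * expR (- x) @[x --> +oo%R] --> (0 : R).
Proof.
apply: (@squeeze_cvgr _ _ _ _ (cst 0) (fun x : R => n.+1`!%:R / x)).
- near=> x.
  have x0 : 0 < x by near: x; exact: nbhs_pinfty_gt.
  rewrite mulr_ge0 ?exprn_ge0 ?expR_ge0 ?(ltW x0)//=.
  rewrite expRN ler_pdivrMr ?expR_gt0// mulrAC ler_pdivlMr// -exprSr.
  rewrite mulrC -ler_pdivrMr ?ltr0n ?fact_gt0//.
  apply: le_trans (expR_ge1Dxn n (ltW x0)).
  by rewrite lerDr.
- exact: cvg_cst.
- rewrite -[X in _ --> X](mulr0 (n.+1`!%:R : R)).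
  apply: cvgM; first exact: cvg_cst.
  apply/(@gtr0_cvgV0 R R _ _ idfun); last exact: cvg_id.
  by near=> x; near: x; exact: nbhs_pinfty_gt.
Unshelve. all: by end_near. Qed.

Lemma gamma_primitive_cvg (R : realType) n : gamma_primitive n x @[x --> +oo%R] --> (0 : R).
Proof.
elim: n => [|n IH] /=.
  rewrite -[X in _ --> X]oppr0; apply: cvgN.
  have := @cvg_exp_expRN R 0; apply: cvg_trans; apply: near_eq_cvg.
  by near=> x; rewrite expr0 mul1r.
rewrite -[X in _ --> X](subrr (0 : R)); apply: cvgB; last exact: cvg_exp_expRN.
by rewrite -[X in _ --> X](mulr0 (n.+1%:R : R)); apply: cvgM => //; exact: cvg_cst.
Unshelve. all: by end_near. Qed.

Lemma gamma_primitive0 (R : realType) n : gamma_primitive n (0 : R) = - n`!%:R.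
Proof.
elim: n => [|n IH] /=; first by rewrite oppr0 expR0.
by rewrite IH expr0n mul0r subr0 mulrN -natrM factS.
Qed.

Lemma continuous_exp_expRN (R : realType) n : continuous (fun x : R => x ^+ n * expR (- x)).
Proof.
move=> x; apply: cvgM; first exact: exprn_continuous.
apply: (@continuous_comp _ _ _ (fun x : R => - x) expR); first by apply: cvgN; exact: cvg_id.
exact: continuous_expR.
Qed.

Lemma integral_exp_expRN (R : realType) n (a : R) : 0 <= a ->
  (\int[lebesgue_measure]_(x in `[a, +oo[) (x ^+ n * expR (- x))%:E = (- gamma_primitive n a)%:E)%E.
Proof.
move=> a0.
rewrite (@ge0_continuous_FTC2y R _ (gamma_primitive n) a 0).
- by rewrite -EFinB sub0r.
- by move=> x ax; rewrite mulr_ge0 ?expR_ge0 ?exprn_ge0 ?(le_trans a0).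
- by apply: continuous_subspaceT; exact: continuous_exp_expRN.
- exact: gamma_primitive_cvg.
- by move=> x _; have [] := is_derive_gamma_primitive n x.
- apply: cvg_at_right_filter; apply: differentiable_continuous.
  by apply/derivable1_diffP; have [] := is_derive_gamma_primitive n a.
- by move=> x _; rewrite derive1E; have [_ ->] := is_derive_gamma_primitive n x.
Qed.

Lemma integral_gamma (R : realType) n :
  (\int[lebesgue_measure]_(x in `[0%R : R, +oo[) (x ^+ n * expR (- x))%:E = n`!%:R%:E)%E.
Proof. by rewrite integral_exp_expRN// gamma_primitive0 opprK. Qed.

Lemma integral_expRN_tail (R : realType) (a : R) : 0 <= a ->
  (\int[lebesgue_measure]_(x in `[a, +oo[) (expR (- x))%:E = (expR (- a))%:E)%E.
Proof.
move=> a0; have := @integral_exp_expRN R 0 a a0; rewrite /= opprK => <-.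
by apply: eq_integral => x _; rewrite expr0 mul1r.
Qed.

Lemma integral_prod_coord (R : realType) n (g : R -> R) (r : R) :
  measurable_fun [set: measurableTypeR R] (g : measurableTypeR R -> measurableTypeR R) -> (forall x, 0 <= g x) ->
  (\int[lebesgue_measure]_x (g x)%:E = r%:E)%E ->
  (\int[lebn R n]_x (\prod_i g (x ord0 i))%:E = (r ^+ n)%:E)%E.
Proof.
move=> mg g0 gr.
have mP m : measurable_fun [set: 'rV[R]_m] (fun x : 'rV[R]_m => (\prod_i g (x ord0 i))%:E).
  apply/measurable_EFinP; apply: measurable_prod => i _.
  exact: (measurableT_comp mg (@measurable_coord R m i)).
have P0 m (x : 'rV[R]_m) : (0 <= (\prod_i g (x ord0 i))%:E)%E.
  by rewrite lee_fin prodr_ge0.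
elim: n => [|n IH].
  by rewrite /= (integral_dirac _ _ (mP 0%N))// /dirac indicE in_setT mul1e big_ord0 expr0.
rewrite ge0_integral_lebnS//.
have inner x : (\int[lebn R n]_v (\prod_i g (rV_cons (x, v) ord0 i))%:E = (g x)%:E * (r ^+ n)%:E)%E.
  rewrite -IH -ge0_integralZl//; do ?[exact: mP|by move=> v _; exact: P0|by rewrite lee_fin].
  apply: eq_integral => v _; rewrite big_ord_recl rV_consE unlift_none EFinM.
  by congr (_ * _%:E)%E; apply: eq_bigr => i _; rewrite rV_consE liftK.
under eq_integral do rewrite inner.
rewrite ge0_integralZr//.
- by rewrite gr -EFinM exprS.
- exact/measurable_EFinP.
- by move=> x _; rewrite lee_fin.
- by rewrite -IH; apply: integral_ge0 => x _; exact: P0.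
Qed.

(** * The integral of exp(-||y||_K) *)

Section layer.
Context {R : realType} {n : nat}.

(* [layer K y] is exp(-||y||_K), as the integral of exp(-r) over the r > 0 with
   y in r K. *)
Definition layer_fun (K : set 'rV[R]_n) (p : measurableTypeR R * 'rV[R]_n) : R :=
  \1_`]0, +oo[ (p.1 : R) * expR (- (p.1 : R)) * \1_K ((p.1 : R) `^ (-1) *: p.2).

Definition layer (K : set 'rV[R]_n) (y : 'rV[R]_n) : \bar R :=
  (\int[lebesgue_measure]_r (layer_fun K (r, y))%:E)%E.

Lemma layer_fun_ge0 K p : 0 <= layer_fun K p.
Proof. by rewrite /layer_fun !mulr_ge0 ?expR_ge0 ?indicE. Qed.

Lemma measurable_layer_fun K : measurable K -> measurable_fun setT (layer_fun K).
Proof.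
move=> mK.
have mE : measurable_fun [set: measurableTypeR R] (fun r : measurableTypeR R => \1_`]0, +oo[ (r : R) * expR (- (r : R)) : measurableTypeR R).
  apply: measurable_funM; first by apply: measurable_indic; exact: measurable_itv.
  by apply: measurableT_comp => //; exact: measurable_expR.
apply: measurable_funM.
  exact: (measurableT_comp mE measurable_fst).
have mI : measurable_fun [set: 'rV[R]_n] (\1_K : 'rV[R]_n -> R) by exact: measurable_indic.
apply: (measurableT_comp mI); apply: measurable_fun_coordP => i.
under eq_fun do rewrite mxE.
apply: measurable_funM.
  have mp : measurable_fun [set: measurableTypeR R] (fun r : measurableTypeR R => (r : R) `^ (-1)) by exact: measurable_powR.
  exact: (measurableT_comp mp measurable_fst).
exact: (measurableT_comp (@measurable_coord R n i) measurable_snd).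
Qed.

Lemma layer_ge0 K y : (0 <= layer K y)%E.
Proof. by apply: integral_ge0 => r _; rewrite lee_fin layer_fun_ge0. Qed.

Lemma measurable_layer K : measurable K -> measurable_fun setT (layer K).
Proof.
move=> mK.
have h : measurable_fun setT (fun p => (layer_fun K p)%:E).
  by apply/measurable_EFinP; exact: measurable_layer_fun.
apply: (measurable_fun_fubini_tonelli_G (m1 := lebesgue_measure) (fun p => (layer_fun K p)%:E)) => //.
by move=> p; rewrite lee_fin layer_fun_ge0.
Qed.

Lemma integral_indic_mul (D : set R) (f : R -> R) :
  (\int[lebesgue_measure]_x (\1_D x * f x)%:E = \int[lebesgue_measure]_(x in D) (f x)%:E)%E.
Proof.
rewrite [RHS]integral_mkcond; apply: eq_integral => x _.
by rewrite patchE indicE; case: ifP => _; rewrite ?mul1r ?mul0r.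
Qed.

(** For fixed r the integral over y is the volume of r K, that is r^n vol K; the remaining integral
    of r^n exp(-r) is n!. *)
Lemma integral_layer K : measurable K ->
  (\int[lebn R n]_y layer K y = n`!%:R%:E * lebn R n K)%E.
Proof.
move=> mK.
have h : measurable_fun setT (fun p => (layer_fun K p)%:E).
  by apply/measurable_EFinP; exact: measurable_layer_fun.
have h0 p : (0 <= (layer_fun K p)%:E)%E by rewrite lee_fin layer_fun_ge0.
rewrite -(fubini_tonelli (m1 := lebesgue_measure) (m2 := lebn R n) _ h h0).
under eq_integral => r _.
  rewrite (_ : (\int[lebn R n]_y (layer_fun K (r, y))%:E)%E =
     ((\1_`]0%R : R, +oo[ (r : R) * ((r : R) ^+ n * expR (- (r : R))))%:E * lebn R n K)%E); last first.
    rewrite /layer_fun/= indicE.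
    case: (boolP ((r : R) \in `]0%R, +oo[%classic)) => [/set_mem/=|_]; last first.
      rewrite /= mulr0n !mul0r mul0e; under eq_integral do rewrite ?mul0r.
      by rewrite integral0.
    rewrite in_itv/= andbT => r0.
    have mK' : measurable [set y : 'rV[R]_n | K (y *m ((r `^ (-1))%:M) + 0)].
      exact: measurable_affine_preimage.
    under eq_integral => y _.
      rewrite (_ : \1_K _ = \1_[set y : 'rV[R]_n | K (y *m ((r `^ (-1))%:M) + 0)] y :> R); last first.
        by rewrite !indicE; congr (nat_of_bool _)%:R; apply/idP/idP => /set_mem/= hK; apply/mem_set => /=;
          move: hK; rewrite /= mul_mx_scalar addr0.
      rewrite EFinM; over.
    rewrite ge0_integralZl//; do ?[by rewrite lee_fin mulr_ge0 ?expR_ge0|by apply/measurable_EFinP; exact: measurable_indic|by move=> y _; rewrite lee_fin].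
    have hu : (r `^ (-1))%:M \in @unitmx R n.
      by rewrite unitmxE det_scalar unitfE expf_neq0// gt_eqF// powR_gt0.
    rewrite integral_indic// setIT [X in (_ * X = _)%E](lebn_affine hu 0 mK).
    rewrite muleA -EFinM; congr (_%:E * _)%E.
    rewrite det_scalar normrX powR_inv1 ?(ltW r0)// ger0_norm ?invr_ge0 ?(ltW r0)// exprVn invrK.
    by rewrite !mul1r mulrC.
  over.
have mg : measurable_fun [set: measurableTypeR R] (fun r : measurableTypeR R => (\1_`]0, +oo[ (r : R) * ((r : R) ^+ n * expR (- (r : R))))%:E).
  apply/measurable_EFinP; apply: measurable_funM; first by apply: measurable_indic; exact: measurable_itv.
  apply: measurable_funM; first exact: exprn_measurable.
  by apply: measurableT_comp => //; exact: measurable_expR.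
rewrite ge0_integralZr//; last first.
  move=> r _; rewrite lee_fin indicE; case: (boolP ((r : R) \in `]0%R, +oo[%classic)) => [/set_mem/=|_]; last by rewrite mul0r.
  by rewrite in_itv/= andbT => r0; rewrite mul1r mulr_ge0 ?expR_ge0// exprn_ge0// ltW.
congr (_ * _)%E.
rewrite integral_indic_mul -integral_gamma.
rewrite integral_itv_obnd_cbnd//.
apply: measurable_funTS; apply/measurable_EFinP.
apply: measurable_funM; first exact: exprn_measurable.
by apply: measurableT_comp => //; exact: measurable_expR.
Qed.

Lemma integral_expRN_tail_open (a : R) : 0 <= a ->
  (\int[lebesgue_measure]_x (\1_`]a, +oo[ x * expR (- x))%:E = (expR (- a))%:E)%E.
Proof.
move=> a0; rewrite -integral_expRN_tail// integral_indic_mul integral_itv_obnd_cbnd//.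
apply: measurable_funTS; apply/measurable_EFinP.
by apply: measurableT_comp => //; exact: measurable_expR.
Qed.

(** As K is star-shaped about 0, the point r0 k lies in r K for every r > r0, and exp(-r) integrates
    over these r to exp(-r0). *)
Lemma layer_lower (K : set 'rV[R]_n) (r0 : R) k : measurable K ->
  (forall x (t : R), K x -> 0 <= t <= 1 -> K (t *: x)) -> 0 <= r0 -> K k ->
  ((expR (- r0))%:E <= layer K (r0 *: k))%E.
Proof.
move=> mK starK r00 Kk; rewrite -integral_expRN_tail_open//.
have mE a : measurable_fun [set: measurableTypeR R] (fun r : measurableTypeR R => (\1_`]a, +oo[ (r : R) * expR (- (r : R)))%:E).
  apply/measurable_EFinP; apply: measurable_funM; first by apply: measurable_indic; exact: measurable_itv.
  by apply: measurableT_comp => //; exact: measurable_expR.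
apply: ge0_le_integral => //.
- have h : measurable_fun setT (layer_fun K) by exact: measurable_layer_fun.
  apply/measurable_EFinP.
  apply: (measurableT_comp h); exact: measurable_fun_pair.
- move=> r _; rewrite lee_fin /layer_fun/= !indicE.
  case: (boolP (r \in `]r0, +oo[%classic)) => [/set_mem/=|_]; last by rewrite mul0r !mulr_ge0 ?expR_ge0.
  rewrite in_itv/= andbT => r0r; have r_gt0 := le_lt_trans r00 r0r.
  rewrite (mem_set (_ : `]0%R, +oo[%classic r)) /= ?in_itv/= ?andbT// mul1r mem_set ?mulr1//.
  rewrite scalerA powR_inv1 ?(ltW r_gt0)//; apply: starK => //.
  by rewrite mulr_ge0 ?invr_ge0 ?(ltW r_gt0)//= mulrC ler_pdivrMr// mul1r ltW.
Qed.

Lemma layer_upper (K : set 'rV[R]_n) (r0 : R) y : measurable K -> 0 <= r0 ->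
  (forall r, 0 < r -> K (r^-1 *: y) -> r0 <= r) ->
  (layer K y <= (expR (- r0))%:E)%E.
Proof.
move=> mK r00 hK.
rewrite -integral_expRN_tail// -integral_indic_mul.
have mE : measurable_fun [set: measurableTypeR R] (fun r : measurableTypeR R => (\1_`[r0, +oo[ (r : R) * expR (- (r : R)))%:E).
  apply/measurable_EFinP; apply: measurable_funM; first by apply: measurable_indic; exact: measurable_itv.
  by apply: measurableT_comp => //; exact: measurable_expR.
apply: ge0_le_integral => //.
- by move=> r _; rewrite lee_fin layer_fun_ge0.
- have h : measurable_fun setT (layer_fun K) by exact: measurable_layer_fun.
  apply/measurable_EFinP.
  apply: (measurableT_comp h); exact: measurable_fun_pair.
- move=> r _; rewrite lee_fin /layer_fun/= !indicE.
  case: (boolP (r \in `]0%R, +oo[%classic)) => [/set_mem/=|_]; last by rewrite !mul0r mulr_ge0 ?expR_ge0.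
  rewrite in_itv/= andbT => r_gt0; rewrite mul1r powR_inv1 ?(ltW r_gt0)//.
  case: (boolP (_ \in K)) => [/set_mem Kr|_]; last by rewrite mulr0 mulr_ge0 ?expR_ge0.
  by rewrite (mem_set (_ : `[r0, +oo[%classic r)) /= ?in_itv/= ?andbT ?hK// mulr1 mul1r.
Qed.

End layer.

(** * Volume of the unit ball of the l1 norm *)

Definition l1_ball (R : realType) n : set 'rV[R]_n := [set x | \sum_i `|x ord0 i| <= 1].

Lemma measurable_l1_ball (R : realType) n : measurable (@l1_ball R n).
Proof.
have mf : measurable_fun [set: 'rV[R]_n] (fun x : 'rV[R]_n => \sum_i `|x ord0 i|).
  apply: measurable_sum => i.
  by apply: measurableT_comp => //; exact: measurable_coord.
have : measurable ((fun x : 'rV[R]_n => \sum_i `|x ord0 i|) @^-1` `]-oo, 1]).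
  by rewrite -[X in measurable X]setTI; apply: mf => //; exact: measurable_itv.
by congr (measurable _); apply/seteqP; split => x /=; rewrite in_itv.
Qed.

Lemma integral_expRN_abs (R : realType) :
  (\int[lebesgue_measure]_x (expR (- `|x|))%:E = (2 : R)%:E)%E.
Proof.
rewrite ge0_symfun_integralT//.
- rewrite (_ : [set x | _] = `[0%R, +oo[%classic); last first.
    by apply/seteqP; split => x /=; rewrite in_itv/= andbT.
  rewrite (eq_integral (fun x : measurableTypeR R => (expR (- (x : R)))%:E)); last first.
    by move=> x /set_mem/=; rewrite in_itv/= andbT => x0; rewrite ger0_norm.
  by rewrite integral_expRN_tail// oppr0 expR0 mule1.
- move=> x; apply: (@continuous_comp _ _ _ (fun x : R => - `|x|) expR).
    by apply: cvgN; exact: norm_continuous.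
  exact: continuous_expR.
- by move=> x /=; rewrite normrN.
Qed.

(** [integral_layer] read backwards: exp(-||y||_1) is a product over the coordinates, each
    contributing the integral 2 of exp(-|x|), so n! times the volume is 2^n. *)
Lemma lebn_l1_ball (R : realType) n : lebn R n (@l1_ball R n) = (2 ^+ n / n`!%:R)%:E.
Proof.
have mC := @measurable_l1_ball R n.
have starC (x : 'rV[R]_n) (t : R) : l1_ball x -> 0 <= t <= 1 -> l1_ball (t *: x).
  move=> hx /andP[t0 t1]; rewrite /l1_ball/=.
  under eq_bigr do rewrite mxE normrM (ger0_norm t0).
  by rewrite -mulr_sumr mulr_ile1// sumr_ge0.
have E y : layer (@l1_ball R n) y = (\prod_i expR (- `|y ord0 i|))%:E.
  pose a := \sum_i `|y ord0 i|.
  have a0 : 0 <= a by rewrite sumr_ge0.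
  have -> : \prod_i expR (- `|y ord0 i|) = expR (- a).
    by rewrite -expR_sum sumrN.
  apply/eqP; rewrite eq_le; apply/andP; split.
    apply: layer_upper => // r r0; rewrite /l1_ball/=.
    under eq_bigr do rewrite mxE normrM gtr0_norm ?invr_gt0//.
    by rewrite -mulr_sumr mulrC ler_pdivrMr// mul1r.
  have [a00|a_neq0] := eqVneq a 0.
    have y0 : y = 0.
      apply/rowP => i; rewrite mxE; apply/eqP; rewrite -normr_eq0.
      by have /eqP := a00; rewrite psumr_eq0// => /allP/(_ i); rewrite mem_index_enum => /(_ isT).
    rewrite y0 -(scale0r (0 : 'rV[R]_n)) a00; apply: layer_lower => //.
    by rewrite /l1_ball/= big1 ?ler01// => i _; rewrite mxE normr0.
  rewrite -[X in layer _ X](scale1r y) -(divff a_neq0) -scalerA.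
  apply: layer_lower => //; rewrite /l1_ball/=.
  under eq_bigr do rewrite mxE normrM ger0_norm ?invr_ge0//.
  by rewrite -mulr_sumr mulVf.
have := integral_layer mC.
rewrite (eq_integral (fun y : 'rV[R]_n => (\prod_i expR (- `|y ord0 i|))%:E)); last by move=> y _; rewrite E.
rewrite (@integral_prod_coord R n (fun x => expR (- `|x|)) 2).
- move=> h; have f0 : (n`!%:R : R) != 0 by rewrite pnatr_eq0 -lt0n fact_gt0.
  by rewrite mulrC EFinM h muleA -EFinM mulVf// mul1e.
- by apply: measurableT_comp => //; exact: measurableT_comp.
- by move=> x; exact: expR_ge0.
- exact: integral_expRN_abs.
Qed.

(** * Determinants of weighted frames *)

Lemma dotpE (R : realType) n (x y : 'rV[R]_n) : dotp x y = (x *m y^T) ord0 ord0.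
Proof. by rewrite mxE; apply: eq_bigr => i _; rewrite mxE. Qed.

Lemma dotpC (R : realType) n (x y : 'rV[R]_n) : dotp x y = dotp y x.
Proof. by apply: eq_bigr => i _; rewrite mulrC. Qed.

Lemma dotpZl (R : realType) n a (x y : 'rV[R]_n) : dotp (a *: x) y = a * dotp x y.
Proof. by rewrite /dotp mulr_sumr; apply: eq_bigr => i _; rewrite mxE mulrA. Qed.

Lemma dotpZr (R : realType) n a (x y : 'rV[R]_n) : dotp x (a *: y) = a * dotp x y.
Proof. by rewrite dotpC dotpZl dotpC. Qed.

Lemma dotpDl (R : realType) n (x y z : 'rV[R]_n) : dotp (x + y) z = dotp x z + dotp y z.
Proof. by rewrite /dotp -big_split/=; apply: eq_bigr => i _; rewrite mxE mulrDl. Qed.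

Lemma dotpNl (R : realType) n (x y : 'rV[R]_n) : dotp (- x) y = - dotp x y.
Proof. by rewrite -scaleN1r dotpZl mulN1r. Qed.

Lemma dotpNr (R : realType) n (x y : 'rV[R]_n) : dotp x (- y) = - dotp x y.
Proof. by rewrite dotpC dotpNl dotpC. Qed.

Lemma dotp_suml (R : realType) n I (r : seq I) (P : pred I) (F : I -> 'rV[R]_n) y :
  dotp (\sum_(i <- r | P i) F i) y = \sum_(i <- r | P i) dotp (F i) y.
Proof.
elim/big_rec2: _ => [|i s v _ <-]; last by rewrite dotpDl.
by rewrite /dotp big1// => i _; rewrite mxE mul0r.
Qed.

Lemma dotp_ge0 (R : realType) n (x : 'rV[R]_n) : 0 <= dotp x x.
Proof. by apply: sumr_ge0 => i _; rewrite -expr2 sqr_ge0. Qed.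

Lemma dotp_eq0 (R : realType) n (x : 'rV[R]_n) : (dotp x x == 0) = (x == 0).
Proof.
apply/idP/eqP => [|->]; last by rewrite /dotp big1// => i _; rewrite mxE mul0r.
rewrite /dotp psumr_eq0 => [/allP h|i _]; last by rewrite -expr2 sqr_ge0.
apply/rowP => i; rewrite mxE; have := h i; rewrite mem_index_enum => /(_ isT).
by rewrite mulf_eq0 orbb => /eqP.
Qed.

(** Cauchy-Binet before symmetrisation: the product is expanded row by row, so the sum runs over all
    maps, the non-injective ones contributing 0 through repeated rows. *)
Lemma det_mulmx_ffun (R : comNzRingType) m n (A : 'M[R]_(n, m)) (B : 'M[R]_(m, n)) :
  \det (A *m B) =
  \sum_(f : {ffun 'I_n -> 'I_m}) (\prod_i A i (f i)) * \det (rowsub f B).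
Proof.
rewrite /determinant.
under eq_bigr => s _.
  under eq_bigr => i _ do rewrite mxE.
  rewrite bigA_distr_bigA /= mulr_sumr.
  over.
rewrite exchange_big /=; apply: eq_bigr => f _.
rewrite mulr_sumr; apply: eq_bigr => s _.
rewrite mulrCA; congr (_ * _); rewrite -big_split /=.
by apply: eq_bigr => i _; rewrite mxE.
Qed.

Definition frame_mx (R : realType) m n (u : 'I_m -> 'rV[R]_n) (d : 'I_m -> R) : 'M[R]_n :=
  \sum_i d i *: ((u i)^T *m u i).

Definition frame_minor (R : realType) m n (u : 'I_m -> 'rV[R]_n) (f : 'I_n -> 'I_m) : R :=
  \det (\matrix_(j < n) u (f j)).

Lemma mul_frame_mx (R : realType) m n (u : 'I_m -> 'rV[R]_n) (d : 'I_m -> R) (x : 'rV[R]_n) :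
  x *m frame_mx u d = \sum_i (d i * dotp x (u i)) *: u i.
Proof.
rewrite /frame_mx mulmx_sumr; apply: eq_bigr => i _.
rewrite -scalemxAr mulmxA [x *m _]mx11_scalar mul_scalar_mx scalerA.
by rewrite -dotpE.
Qed.

(** Each set of n indices is counted in all its n! orders, hence the factor 1/n!. *)
Lemma det_frame_mx (R : realType) m n (u : 'I_m -> 'rV[R]_n) (d : 'I_m -> R) :
  \det (frame_mx u d) =
  n`!%:R^-1 * \sum_(f : {ffun 'I_n -> 'I_m}) (\prod_j d (f j)) * frame_minor u f ^+ 2.
Proof.
pose U : 'M[R]_(m, n) := \matrix_i u i.
pose A : 'M[R]_(n, m) := \matrix_(i, j) (d j * U j i).
have -> : frame_mx u d = A *m U.
  apply/matrixP => i j; rewrite /frame_mx summxE mxE; apply: eq_bigr => k _.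
  by rewrite !mxE big_ord1 !mxE mulrA.
have minorE (f : {ffun 'I_n -> 'I_m}) : frame_minor u f = \det (rowsub f U).
  by congr (\det _); apply/matrixP => i j; rewrite !mxE.
have f0 : (n`!%:R : R) != 0 by rewrite pnatr_eq0 -lt0n fact_gt0.
apply: (mulfI f0); rewrite mulrA mulfV// mul1r.
rewrite det_mulmx_ffun.
have -> : n`!%:R * (\sum_(f : {ffun 'I_n -> 'I_m}) (\prod_i A i (f i)) * \det (rowsub f U)) =
   \sum_(s : 'S_n) \sum_(f : {ffun 'I_n -> 'I_m}) (\prod_i A i (f i)) * \det (rowsub f U).
  by rewrite sumr_const card_Sn mulr_natl.
(* Each of the n! copies of the sum is reindexed by its own permutation; summing over [s] then turns
   the product of entries into a second minor. *)
have hs (s : 'S_n) : \sum_(f : {ffun 'I_n -> 'I_m}) (\prod_i A i (f i)) * \det (rowsub f U) =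
  \sum_(f : {ffun 'I_n -> 'I_m}) (\prod_j d (f j)) * frame_minor u f * ((-1) ^+ s * \prod_i (rowsub f U)^T i (s i)).
  pose h (f : {ffun 'I_n -> 'I_m}) : {ffun 'I_n -> 'I_m} := [ffun i => f (s i)].
  have hbij : bijective h.
    exists (fun f : {ffun 'I_n -> 'I_m} => [ffun i => f ((s^-1)%g i)]) => f; apply/ffunP => i; rewrite !ffunE.
      by rewrite permKV.
    by rewrite permK.
  rewrite (reindex h) /=; last exact: onW_bij.
  apply: eq_bigr => f _.
  have -> : \prod_i A i (h f i) = (\prod_j d (f j)) * \prod_i (rowsub f U)^T i (s i).
    rewrite [X in _ = X * _](reindex_inj (@perm_inj _ s)) /= -big_split /=; apply: eq_bigr => i _.
    by rewrite !mxE ffunE.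
  have -> : \det (rowsub (h f) U) = (-1) ^+ s * frame_minor u f.
    rewrite minorE -det_perm -det_mulmx -row_permE; congr (\det _).
    by apply/matrixP => i j; rewrite !mxE ffunE.
  by rewrite mulrACA [X in _ * X]mulrC mulrACA !mulrA.
rewrite (eq_bigr _ (fun s _ => hs s)) exchange_big /=; apply: eq_bigr => f _.
rewrite -mulr_sumr -mulrA expr2; congr (_ * (_ * _)).
by rewrite minorE -[RHS]det_tr.
Qed.

(** One bordered matrix has two triangular factorisations, according to the block that is
    eliminated; their determinants agree. *)
Lemma det_add_rank1 (R : comNzRingType) n (b : 'cV[R]_n) (a : 'rV[R]_n) :
  \det (1%:M + b *m a) = 1 + (a *m b) ord0 ord0.
Proof.
have e1 : block_mx (1%:M : 'M[R]_1) (- a) b 1%:M =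
    block_mx 1%:M 0 b 1%:M *m block_mx 1%:M (- a) 0 (1%:M + b *m a).
  by rewrite mulmx_block !mul1mx !mul0mx !mulmx1 !addr0 mulmxN addrC addrK.
have e2 : block_mx (1%:M : 'M[R]_1) (- a) b 1%:M =
    block_mx (1%:M + a *m b) (- a) 0 1%:M *m block_mx 1%:M 0 b 1%:M.
  by rewrite mulmx_block !mulmx1 !mulmx0 ?mul0mx ?mul1mx ?addr0 ?add0r mulNmx addrK.
have := congr1 determinant e1; rewrite {1}e2 !det_mulmx !det_lblock !det_ublock !det1 !mul1r !mulr1.
by move=> <-; rewrite [X in \det X]mx11_scalar det_scalar1 !mxE eqxx.
Qed.

Lemma expR_tangent (R : realType) (a b : R) : expR a * (1 + (b - a)) <= expR b.
Proof.
rewrite (_ : expR b = expR a * expR (b - a)) ?ler_wpM2l ?expR_ge0 ?expR_ge1Dx//.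
by rewrite -expRD addrC subrK.
Qed.

Lemma expR_tangent_lt (R : realType) (a b : R) : b != a -> expR a * (1 + (b - a)) < expR b.
Proof.
move=> ba; rewrite (_ : expR b = expR a * expR (b - a)).
  by rewrite ltr_pM2l ?expR_gt0// expR_gt1Dx// subr_eq0.
by rewrite -expRD addrC subrK.
Qed.

Section frame.
Context {R : realType} {m n : nat} (u : 'I_m -> 'rV[R]_n) (c : 'I_m -> R).

(* By Cauchy-Binet these are the coefficients of [frame_det] as a polynomial in [t];
   for a frame with [frame_mx u c = 1%:M] they form a probability on the maps [f]
   whose expected number of [j] with [f j = i] is [c i]. *)
Definition frame_weight (f : {ffun 'I_n -> 'I_m}) : R :=
  n`!%:R^-1 * ((\prod_j c (f j)) * frame_minor u f ^+ 2).

Definition frame_det (t : 'I_m -> R) : R := \det (frame_mx u (fun i => c i * t i)).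

Lemma frame_detE t : frame_det t = \sum_f frame_weight f * \prod_j t (f j).
Proof.
rewrite /frame_det det_frame_mx mulr_sumr; apply: eq_bigr => f _.
by rewrite big_split/= /frame_weight; ring.
Qed.

Hypothesis c_ge0 : forall i, 0 <= c i.

Lemma frame_weight_ge0 f : 0 <= frame_weight f.
Proof.
by rewrite /frame_weight mulr_ge0 ?invr_ge0 ?ler0n// mulr_ge0 ?sqr_ge0// prodr_ge0.
Qed.

Lemma frame_det_ge0 t : (forall i, 0 <= t i) -> 0 <= frame_det t.
Proof.
by move=> t0; rewrite frame_detE sumr_ge0// => f _; rewrite mulr_ge0 ?frame_weight_ge0// prodr_ge0.
Qed.

(** [frame_det] is homogeneous of degree n with nonnegative coefficients, hence monotone on
    nonnegative arguments. *)
Lemma le_frame_det t t' a : 0 <= a -> (forall i, 0 <= t i) -> (forall i, a * t i <= t' i) ->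
  a ^+ n * frame_det t <= frame_det t'.
Proof.
move=> a0 t0 tt'; rewrite !frame_detE mulr_sumr; apply: ler_sum => f _.
rewrite mulrCA ler_wpM2l ?frame_weight_ge0//.
rewrite -[X in a ^+ X]card_ord -prodr_const -big_split/=.
by apply: ler_prod => j _; rewrite mulr_ge0//=; exact: tt'.
Qed.

Hypothesis u_unit : forall i, dotp (u i) (u i) = 1.
Hypothesis frame1 : frame_mx u c = 1%:M.

Lemma sum_frame_weight : \sum_f frame_weight f = 1.
Proof.
have := frame_detE (fun=> 1); rewrite /frame_det.
rewrite [in X in _ = X -> _](eq_bigr frame_weight) => [<-|f _]; last by rewrite big1// mulr1.
rewrite -[RHS](det1 R n) -frame1; congr (\det (frame_mx _ _)).
by apply/funext => i; rewrite mulr1.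
Qed.

Lemma frame_weight_inj f : frame_weight f != 0 -> injective f.
Proof.
move=> pf i j fij; apply: contrapT => /eqP ij; move: pf.
rewrite /frame_weight /frame_minor (determinant_alternate ij) ?expr0n ?mulr0 ?eqxx//.
by move=> k; rewrite !mxE fij.
Qed.

(** Raise one argument of [frame_det] from 1 to 2. The matrix becomes a rank-one update of the
    identity, with determinant 1 + c_i; an injective [f] takes the value [i] at most once, so its
    product becomes 1 plus the number of such [j]. *)
Lemma frame_weight_marginal i :
  \sum_f frame_weight f * #|[pred j | f j == i]|%:R = c i.
Proof.
have detE : frame_det (fun k => 1 + (k == i)%:R) = 1 + c i.
  rewrite /frame_det.
  have -> : frame_mx u (fun k => c k * (1 + (k == i)%:R)) = 1%:M + (c i *: (u i)^T) *m u i.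
    rewrite -frame1 /frame_mx.
    under eq_bigr do rewrite mulrDr mulr1 scalerDl.
    rewrite big_split/=; congr (_ + _).
    rewrite (bigD1 i)//= big1 ?addr0 ?eqxx ?mulr1 -?scalemxAl// => k /negPf ->.
    by rewrite mulr0 scale0r.
  by rewrite det_add_rank1 -scalemxAr mxE -dotpE u_unit mulr1.
have := detE; rewrite frame_detE -[X in _ = X + _]sum_frame_weight => h.
apply: (@addrI _ (\sum_f frame_weight f)); rewrite -h -big_split/=.
apply: eq_bigr => f _; rewrite -[X in X + _]mulr1 -mulrDr.
have [->|pf] := eqVneq (frame_weight f) 0; first by rewrite !mul0r.
have finj := frame_weight_inj pf; congr (_ * _).
have [[j fj]|nf] := pselect (exists j, f j = i).
  rewrite (bigD1 j)//= fj eqxx big1 ?mulr1; last first.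
    by move=> k kj; rewrite -fj (inj_eq finj) (negbTE kj) addr0.
  rewrite (_ : #|_| = 1%N)//; rewrite -(card1 j); apply: eq_card => k.
  by rewrite !inE -fj (inj_eq finj).
rewrite big1; last first.
  by move=> j _; case: eqP => [fj|_]; [case: nf; exists j|rewrite addr0].
rewrite (_ : #|_| = 0%N) ?addr0//; apply: eq_card0 => k; rewrite !inE.
by apply/eqP => fk; apply: nf; exists k.
Qed.

Lemma sum_frame_weight_log (z : 'I_m -> R) :
  \sum_f frame_weight f * (\sum_j z (f j)) = \sum_i c i * z i.
Proof.
have E (f : {ffun 'I_n -> 'I_m}) : \sum_j z (f j) = \sum_i #|[pred j | f j == i]|%:R * z i.
  rewrite (partition_big f predT)//=; apply: eq_bigr => i _.
  by rewrite (eq_bigr (fun=> z i)) ?sumr_const ?mulr_natl// => j /eqP ->.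
under eq_bigr do rewrite E mulr_sumr.
rewrite exchange_big/=; apply: eq_bigr => i _.
by rewrite -frame_weight_marginal mulr_suml; apply: eq_bigr => f _; rewrite mulrA.
Qed.

(** Jensen's inequality for exp under the probability [frame_weight]: the tangent at the mean
    [\sum_i c i * z i] of the sums [\sum_j z (f j)] is averaged. *)
Lemma frame_det_ge_geom (z : 'I_m -> R) :
  expR (\sum_i c i * z i) <= frame_det (fun i => expR (z i)).
Proof.
set zb := \sum_i _.
have -> : expR zb = \sum_f expR zb * (frame_weight f * (1 + (\sum_j z (f j) - zb))).
  rewrite -mulr_sumr; under [X in _ = _ * X]eq_bigr do rewrite mulrDr mulr1 mulrBr.
  rewrite big_split/= sum_frame_weight sumrB sum_frame_weight_log -mulr_suml.
  by rewrite sum_frame_weight mul1r subrr addr0 mulr1.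
rewrite frame_detE; apply: ler_sum => f _.
by rewrite mulrCA ler_wpM2l ?frame_weight_ge0// -expR_sum expR_tangent.
Qed.

(** Jensen's inequality is strict as soon as one map of positive weight has its sum off the mean. *)
Lemma frame_det_gt_geom (z : 'I_m -> R) f : frame_weight f != 0 ->
  \sum_j z (f j) != \sum_i c i * z i ->
  expR (\sum_i c i * z i) < frame_det (fun i => expR (z i)).
Proof.
set zb := \sum_i c i * z i => pf zf.
have -> : expR zb = \sum_f expR zb * (frame_weight f * (1 + (\sum_j z (f j) - zb))).
  rewrite -mulr_sumr; under [X in _ = _ * X]eq_bigr do rewrite mulrDr mulr1 mulrBr.
  rewrite big_split/= sum_frame_weight sumrB sum_frame_weight_log -mulr_suml.
  by rewrite sum_frame_weight mul1r subrr addr0 mulr1.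
rewrite frame_detE (bigD1 f)//= [ltRHS](bigD1 f)//=; apply: ltr_leD.
  have wf : 0 < frame_weight f by rewrite lt_neqAle eq_sym pf frame_weight_ge0.
  by rewrite mulrCA ltr_pM2l// -expR_sum expR_tangent_lt.
apply: ler_sum => g _.
by rewrite mulrCA ler_wpM2l ?frame_weight_ge0// -expR_sum expR_tangent.
Qed.

(** The last hypothesis is the equality case of Jensen. A map [f] of nonzero weight selects a basis;
    exchanging one basis vector shows that each [u i] with [c i] nonzero is a multiple of a single
    basis vector, and the frame identity then makes the basis equal to its dual. *)
Lemma frame_orthonormal (l : R -> R) (delta : R) : 0 < delta ->
  (forall s, 0 < `|s| < delta -> l s != l 0) ->
  (forall f x, frame_weight f != 0 ->
    \sum_j l (dotp x (u (f j))) = \sum_i c i * l (dotp x (u i))) ->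
  exists f : {ffun 'I_n -> 'I_m}, forall j k, dotp (u (f j)) (u (f k)) = (j == k)%:R.
Proof.
move=> d0 l_neq hl.
have [f pf] : exists f, frame_weight f != 0.
  apply: contrapT => /forallNP h; have := sum_frame_weight.
  rewrite big1 => [/esym/eqP|f _]; first by rewrite oner_eq0.
  by apply/eqP; apply: contrapT => /negP; exact: h.
have hB : \matrix_(j < n) u (f j) \in unitmx.
  rewrite unitmxE unitfE; move: pf; rewrite /frame_weight !mulf_eq0 => /norP[_ /norP[_]].
  by rewrite orbb.
set B := \matrix_(j < n) u (f j) in hB.
pose X k : 'rV[R]_n := row k (invmx B)^T.
have dotX k v : dotp (X k) v = (v *m invmx B) ord0 k.
  by rewrite dotpC dotpE /X !mxE; apply: eq_bigr => i _; rewrite !mxE.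
have Xu k j : dotp (X k) (u (f j)) = (k == j)%:R.
  rewrite dotX (_ : u (f j) = row j B); last by rewrite rowK.
  by rewrite -row_mul mulmxV// !mxE eq_sym.
have uX v : v = \sum_k dotp (X k) v *: u (f k).
  rewrite -[LHS](mulmxKV hB); apply/rowP => i; rewrite !mxE summxE.
  by apply: eq_bigr => k _; rewrite dotX !mxE.
have cf j : c (f j) != 0.
  move: pf; rewrite /frame_weight !mulf_eq0 => /norP[_ /norP[+ _]].
  by rewrite prodf_seq_neq0 => /allP/(_ j); rewrite mem_index_enum => /(_ isT).
(* Replacing [u (f k)] by [u i] keeps the weight nonzero; comparing both sides at a
   small multiple of the dual vector [X k'], only the [k]-th terms can differ. *)
have excl i k k' : c i != 0 -> k != k' -> dotp (X k) (u i) != 0 -> dotp (X k') (u i) = 0.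
  move=> ci kk' ak; apply: contrapT => /eqP ak'.
  pose g : {ffun 'I_n -> 'I_m} := [ffun j => if j == k then i else f j].
  have pg : frame_weight g != 0.
    suff hm : frame_minor u g != 0.
      rewrite /frame_weight mulf_neq0 ?invr_eq0 ?pnatr_eq0 -?lt0n ?fact_gt0//.
      rewrite mulf_neq0 ?expf_neq0//; apply/prodf_neq0 => j _.
      by rewrite ffunE; case: ifP.
    rewrite /frame_minor.
    (* Replacing row [k] is a rank-one change of the basis matrix; it multiplies the minor by the
       coordinate <X k, u i>. *)
    have -> : \matrix_(j < n) u (g j) = (1%:M + delta_mx k ord0 *m (u i *m invmx B - delta_mx ord0 k)) *m B.
      rewrite mulmxDl mul1mx -mulmxA mulmxBl mulmxKV// -rowE rowK.
      apply/row_matrixP => j; rewrite rowK ffunE linearD/= rowK row_mul.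
      rewrite (_ : row j (delta_mx k ord0) = (j == k)%:R%:M :> 'M[R]_1); last first.
        by apply/rowP => a; rewrite !mxE !ord1 !eqxx andbT mulr1n.
      by rewrite mul_scalar_mx; case: eqP => [->|_]; rewrite ?scale1r ?scale0r ?addr0// addrC subrK.
    rewrite det_mulmx det_add_rank1 mulf_neq0//; last by rewrite -unitfE -unitmxE.
    rewrite mulmxBl mxE -colE mxE -dotX.
    rewrite mul_delta_mx !mxE !eqxx /=.
    by rewrite [X in X != 0](_ : _ = dotp (X k) (u i)) //; ring.
  (* This scale keeps r |<X k', u i>| strictly between 0 and [delta]. *)
  pose r := delta / 2 / (1 + `|dotp (X k') (u i)|).
  have den0 : 0 < 1 + `|dotp (X k') (u i)| by rewrite ltr_pwDl.
  have r0 : 0 < r by rewrite !divr_gt0.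
  have := hl g (r *: X k') pg; rewrite -(hl f (r *: X k') pf).
  rewrite (bigD1 k)//= [RHS](bigD1 k)//= !ffunE eqxx => /eqP.
  rewrite (eq_bigr (fun j => l (dotp (r *: X k') (u (f j))))); last first.
    by move=> j /negPf jk; rewrite ffunE jk.
  rewrite (inj_eq (addIr _)) !dotpZl Xu eq_sym [k' == k]eq_sym (negbTE kk') mulr0 eq_sym.
  apply/negP; apply: l_neq; rewrite normrM (gtr0_norm r0) mulr_gt0 ?normr_gt0//=.
  rewrite /r mulrAC ltr_pdivrMr//; apply: ltr_pM; rewrite ?divr_ge0 ?(ltW d0)//.
    by rewrite ltr_pdivrMr// ltr_pMr// ltr1n.
  by rewrite ltrDr.
(* In the frame expansion of the dual vector [X k] only multiples of [u (f k)] survive, by [excl];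
   pairing with [u (f k)] fixes the factor as 1. *)
have XE k : X k = u (f k).
  have -> : X k = \sum_i (c i * dotp (X k) (u i)) *: u i.
    by rewrite -mul_frame_mx frame1 mulmx1.
  have h i : exists s, (c i * dotp (X k) (u i)) *: u i = s *: u (f k).
    have [->|ci] := eqVneq (c i) 0; first by exists 0; rewrite mul0r !scale0r.
    have [->|a0] := eqVneq (dotp (X k) (u i)) 0; first by exists 0; rewrite mulr0 !scale0r.
    exists (c i * dotp (X k) (u i) * dotp (X k) (u i)).
    rewrite -[RHS]scalerA; congr (_ *: _); rewrite [LHS]uX (bigD1 k)//= big1 ?addr0// => k' kk'.
    by rewrite (excl i k k')// ?scale0r// eq_sym.
  have [s hs] := choice h.
  rewrite (eq_bigr _ (fun i _ => hs i)) -scaler_suml.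
  suff -> : \sum_i s i = 1 by rewrite scale1r.
  have : dotp (X k) (u (f k)) = 1 by rewrite Xu eqxx.
  rewrite -{1}[X k]mulmx1 -frame1 mul_frame_mx (eq_bigr _ (fun i _ => hs i)) -scaler_suml.
  by rewrite dotpZl u_unit mulr1.
by exists f => j k; rewrite -XE Xu.
Qed.

End frame.

(** * The transport from a Gaussian to a two-sided exponential *)

Section transport1.
Context {R : realType}.
Implicit Types a b s x : R.

Definition gauss_cdf s : R :=
  (\int[lebesgue_measure]_(t in [set` `]-oo, s]]) gauss_fun t)%R.

(** The integral of exp(-s^2) over s >= 0 is sqrt pi / 2, so this constant gives it there the mass 1
    of exp(-t). *)
Definition kappa : R := 2 / Num.sqrt pi.

Lemma kappa_gt0 : 0 < kappa.
Proof. by rewrite divr_gt0// sqrtr_gt0 pi_gt0. Qed.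

Lemma integrable_gauss_itv (D : set R) : measurable D ->
  lebesgue_measure.-integrable D (EFin \o gauss_fun).
Proof. by move=> mD; apply: integrableS (@integrableT_gauss R). Qed.

Lemma is_derive_gauss_cdf x : is_derive x 1 gauss_cdf (gauss_fun x).
Proof.
have xx1 : x < x + 1 by rewrite ltrDl.
have [] := @continuous_FTC1 R gauss_fun -oo%O x (x + 1) xx1.
- by apply: integrable_gauss_itv; exact: measurable_itv.
- by rewrite ltNyr.
- exact: continuous_gauss_fun.
by move=> h1 h2; apply: DeriveDef; [exact: h1|rewrite -derive1E; exact: h2].
Qed.

Lemma EFin_gauss_cdf s :
  (gauss_cdf s)%:E = (\int[lebesgue_measure]_(t in `]-oo, s]) (gauss_fun t)%:E)%E.
Proof.
rewrite /gauss_cdf /Rintegral fineK//; apply: integrable_fin_num => //.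
by apply: integrable_gauss_itv; exact: measurable_itv.
Qed.

Lemma gauss_cdf_le s : gauss_cdf s <= Num.sqrt pi.
Proof.
rewrite -lee_fin EFin_gauss_cdf -integralT_gauss; apply: ge0_subset_integral => //=.
- by apply/measurable_EFinP; exact: measurable_gauss_fun.
- by move=> x _; rewrite lee_fin gauss_fun_ge0.
Qed.

Lemma gauss_cdf0 : gauss_cdf 0 = Num.sqrt pi / 2.
Proof.
have mg (D : set R) : measurable_fun D (EFin \o (gauss_fun : R -> R)).
  by apply: measurable_funTS; apply/measurable_EFinP; exact: measurable_gauss_fun.
have : (Num.sqrt pi : R)%:E = (gauss_cdf 0 + Num.sqrt pi / 2)%:E.
  rewrite -integralT_gauss EFinD EFin_gauss_cdf.
  have -> : [set: R] = `]-oo, 0] `|` `]0, +oo[.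
    by rewrite -itv_bndbnd_setU// set_itvE.
  rewrite ge0_integral_setU//=.
  - by congr (_ + _)%E; rewrite -integral0y_gauss integral_itv_obnd_cbnd.
  - exact: mg.
  - by move=> x _; rewrite lee_fin gauss_fun_ge0.
  - by rewrite disj_set2E; apply/eqP/seteqP; split => x//= []; rewrite !in_itv/= andbT => /le_lt_trans h /h; rewrite ltxx.
move=> [h]; apply: (@addIr _ (Num.sqrt pi / 2)); rewrite -h.
by rewrite -splitr.
Qed.

Definition gauss_erf s := kappa * (gauss_cdf s - gauss_cdf 0).

Lemma is_derive_gauss_erf x : is_derive x 1 gauss_erf (kappa * expR (- x ^+ 2)).
Proof.
have h := is_derive_gauss_cdf x.
have h1 : is_derive x 1 (fun s => gauss_cdf s - gauss_cdf 0) (gauss_fun x).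
  by apply: is_derive_eq; rewrite subr0.
exact: is_deriveZ.
Qed.

Lemma gauss_erf0 : gauss_erf 0 = 0.
Proof. by rewrite /gauss_erf subrr mulr0. Qed.

Lemma is_derive_continuous (f : R -> R) df x : is_derive x 1 f df -> {for x, continuous f}.
Proof. by move=> [h _]; apply: differentiable_continuous; apply/derivable1_diffP. Qed.

Lemma is_derive_gt0_lt (f df : R -> R) a b : a < b ->
  (forall x, is_derive x 1 f (df x)) -> (forall x, x \in `]a, b[ -> 0 < df x) -> f a < f b.
Proof.
move=> ab hd df0.
have hc : {within `[a, b], continuous f}.
  by apply: continuous_subspaceT => x; exact: is_derive_continuous (hd x).
have [c cab h] := MVT ab (fun x _ => hd x) hc.
by rewrite -subr_gt0 h mulr_gt0 ?df0// subr_gt0.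
Qed.

(** The function increases strictly and the total Gaussian mass bounds it by 1; strictness keeps the
    argument of the logarithm in [transport_pos] positive. *)
Lemma gauss_erf_lt1 s : gauss_erf s < 1.
Proof.
apply: (@lt_le_trans _ _ (gauss_erf (s + 1))).
  apply: (is_derive_gt0_lt _ is_derive_gauss_erf); first by rewrite ltrDl.
  by move=> x _; rewrite mulr_gt0 ?kappa_gt0 ?expR_gt0.
have pi0 : 0 < Num.sqrt pi :> R by rewrite sqrtr_gt0 pi_gt0.
rewrite /gauss_erf gauss_cdf0 (@le_trans _ _ (kappa * (Num.sqrt pi - Num.sqrt pi / 2)))//.
  by rewrite ler_wpM2l ?(ltW kappa_gt0)// lerD2r gauss_cdf_le.
rewrite /kappa le_eqVlt; apply/orP; left; apply/eqP; field.
by rewrite gt_eqF.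
Qed.

(* The map [T] with 1 - gauss_erf s = exp (- T s): for s >= 0 it sends the density
   kappa exp(-s^2) to exp(-t). *)
Definition transport_pos s := - ln (1 - gauss_erf s).

Lemma transport_pos0 : transport_pos 0 = 0.
Proof. by rewrite /transport_pos gauss_erf0 subr0 ln1 oppr0. Qed.

(** Differentiating 1 - gauss_erf = exp(-T) gives the transport equation T' exp(-T) = kappa
    exp(-s^2). *)
Lemma is_derive_transport_pos x :
  is_derive x 1 transport_pos (kappa * expR (- x ^+ 2 + transport_pos x)).
Proof.
have E1 : 0 < 1 - gauss_erf x by rewrite subr_gt0 gauss_erf_lt1.
have h := is_derive_gauss_erf x.
have h1 : is_derive x 1 (fun s => 1 - gauss_erf s) (- (kappa * expR (- x ^+ 2))).
  by have := is_deriveB (is_derive_cst (1 : R) x (1 : R)) h; rewrite sub0r.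
have h2 := @is_derive1_comp R (@ln R) (fun s => 1 - gauss_erf s) x _ _ (is_derive1_ln E1) h1.
have h3 : is_derive x 1 (fun s => - ln (1 - gauss_erf s)) (- ((1 - gauss_erf x)^-1 * - (kappa * expR (- x ^+ 2)))).
  exact: is_deriveN.
apply: is_derive_eq.
by rewrite expRD /transport_pos (expRN (ln _)) lnK ?posrE// mulrN opprK mulrC mulrA.
Qed.

Lemma transport_pos_lt a b : a < b -> transport_pos a < transport_pos b.
Proof.
move=> ab; apply: (is_derive_gt0_lt ab is_derive_transport_pos) => x _.
by rewrite mulr_gt0 ?kappa_gt0 ?expR_gt0.
Qed.

Lemma transport_pos_le a b : a <= b -> transport_pos a <= transport_pos b.
Proof. by rewrite le_eqVlt => /predU1P[->//|/transport_pos_lt/ltW]. Qed.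

Lemma transport_pos_ge0 s : 0 <= s -> 0 <= transport_pos s.
Proof. by move=> s0; rewrite -[leLHS]transport_pos0; exact: transport_pos_le. Qed.

Lemma continuous_transport_pos : continuous transport_pos.
Proof. by move=> x; exact: is_derive_continuous (is_derive_transport_pos x). Qed.

Lemma transport_pos_MVT a b : a < b -> exists2 c, c \in `]a, b[ &
  transport_pos b - transport_pos a = kappa * expR (- c ^+ 2 + transport_pos c) * (b - a).
Proof.
move=> ab; apply: (@MVT R transport_pos _ a b ab).
- by move=> x _; exact: is_derive_transport_pos.
- by apply: continuous_subspaceT; exact: continuous_transport_pos.
Qed.

(** Bounds the derivative kappa exp(-c^2 + T c) for c <= N: the Gaussian factor is at most 1 and T
    increases. *)
Definition transport_lip (N : R) := kappa * expR (transport_pos N).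

Lemma transport_lip_ge0 N : 0 <= transport_lip N.
Proof. by rewrite mulr_ge0 ?expR_ge0 ?(ltW kappa_gt0). Qed.

Lemma transport_pos_lip N a b : a <= b -> b <= N ->
  transport_pos b - transport_pos a <= transport_lip N * (b - a).
Proof.
rewrite le_eqVlt => /predU1P[->|ab bN]; first by rewrite !subrr mulr0.
have [c cab ->] := transport_pos_MVT ab.
rewrite ler_wpM2r ?subr_ge0 ?(ltW ab)// ler_wpM2l ?(ltW kappa_gt0)// ler_expR.
rewrite -[leRHS]add0r lerD// ?oppr_le0 ?sqr_ge0// transport_pos_le//.
by move: cab; rewrite in_itv/= => /andP[_ /ltW /le_trans]; apply.
Qed.

(* The logarithm of the derivative of [transport]. *)
Definition log_density s := ln kappa - s ^+ 2 + transport_pos `|s|.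

(** The chord slope is the derivative at some c of the interval. Passing from c to s lowers its
    logarithm by at most 2 N (b - a) through the square and [transport_lip N] times b - a through
    T. *)
Lemma transport_pos_slope N a b s : 0 <= a -> a < b -> b <= N -> a <= s <= b ->
  expR (log_density s) * expR (- ((2 * N + transport_lip N) * (b - a))) * (b - a)
    <= transport_pos b - transport_pos a.
Proof.
move=> a0 ab bN /andP[sa sb]; have [c] := transport_pos_MVT ab.
rewrite in_itv/= => /andP[ca cb] ->.
rewrite ler_wpM2r ?subr_ge0 ?(ltW ab)// -expRD -[X in _ <= X * _](lnK (x := kappa)) ?posrE ?kappa_gt0//.
rewrite -expRD ler_expR /log_density ger0_norm ?(le_trans a0)//.
have h1 : transport_pos s - transport_pos c <= transport_lip N * (b - a).
  apply: (@le_trans _ _ (transport_pos b - transport_pos a)); last exact: transport_pos_lip (ltW ab) bN.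
  by rewrite lerB// transport_pos_le// ltW.
have h2 : c ^+ 2 - s ^+ 2 <= 2 * N * (b - a).
  have c0 : 0 <= c by rewrite ltW// (le_lt_trans a0).
  have [sc|/ltW cs] := leP s c.
    rewrite subr_sqr mulrC; apply: ler_pM.
    - by rewrite addr_ge0// (le_trans a0).
    - by rewrite subr_ge0.
    - by rewrite mulr_natl mulr2n lerD// ?(le_trans sb)// ltW// (lt_le_trans cb).
    - by rewrite lerB// ltW.
  apply: (@le_trans _ _ 0); first by rewrite subr_le0 lerXn2r// nnegrE// (le_trans c0).
  by rewrite !mulr_ge0// ?subr_ge0 ?(ltW ab)// (le_trans a0)// (le_trans (ltW ab)).
lra.
Qed.
Definition transport s := if 0 <= s then transport_pos s else - transport_pos (- s).

Lemma transport_norm s : `|transport s| = transport_pos `|s|.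
Proof.
rewrite /transport; case: ifPn => [s0|]; first by rewrite !ger0_norm// transport_pos_ge0.
rewrite -ltNge => s0; rewrite normrN (ltr0_norm s0) ger0_norm// transport_pos_ge0//.
by rewrite oppr_ge0 ltW.
Qed.

Lemma transport_lt a b : a < b -> transport a < transport b.
Proof.
rewrite /transport => ab; case: ifPn => a0; case: ifPn => b0.
- exact: transport_pos_lt.
- by case/negP: b0; rewrite (le_trans a0)// ltW.
- rewrite (lt_le_trans _ (transport_pos_ge0 b0))// oppr_lt0.
  by rewrite -[ltLHS]transport_pos0 transport_pos_lt// oppr_gt0 ltNge.
- by rewrite ltrN2 transport_pos_lt// ltrN2.
Qed.

Lemma transport_ge0 s : 0 <= s -> transport s = transport_pos s.
Proof. by rewrite /transport => ->. Qed.

Lemma transport_le0 s : s <= 0 -> transport s = - transport_pos (- s).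
Proof.
rewrite /transport le_eqVlt => /predU1P[->|s0]; first by rewrite lexx oppr0 transport_pos0 oppr0.
by rewrite leNgt s0.
Qed.

Lemma log_densityN s : log_density (- s) = log_density s.
Proof. by rewrite /log_density sqrrN normrN. Qed.

(** As T is glued from two branches at 0, the interval is kept on one side of 0; oddness brings the
    negative side back to the positive one. *)
Lemma transport_slope N a b s : 0 <= a \/ b <= 0 -> a < b -> `|a| <= N -> `|b| <= N ->
  a <= s <= b ->
  expR (log_density s) * expR (- ((2 * N + transport_lip N) * (b - a)))
    <= (transport b - transport a) / (b - a).
Proof.
move=> hab ab aN bN sab; rewrite ler_pdivlMr ?subr_gt0//.
case: hab => [a0|b0].
  have b0 : 0 <= b by rewrite (le_trans a0)// ltW.
  by rewrite !transport_ge0//; apply: transport_pos_slope => //; rewrite -(ger0_norm b0).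
have a0 : a <= 0 by rewrite (le_trans _ b0)// ltW.
rewrite (transport_le0 b0) (transport_le0 a0) -log_densityN.
have -> : - transport_pos (- b) - - transport_pos (- a) = transport_pos (- a) - transport_pos (- b).
  by move: (transport_pos (- a)) (transport_pos (- b)) => p q; rewrite opprK addrC.
have -> : b - a = - a - - b by rewrite opprK addrC.
apply: transport_pos_slope.
- by rewrite oppr_ge0.
- by rewrite ltrN2.
- by rewrite -(ler0_norm a0).
- by rewrite !lerN2 andbC.
Qed.

Lemma transport_norm_le N a b s : 0 <= a \/ b <= 0 -> a <= b -> `|a| <= N -> `|b| <= N ->
  a <= s <= b ->
  Num.max `|transport a| `|transport b| <= transport_pos `|s| + transport_lip N * (b - a).
Proof.
move=> hab ab aN bN /andP[sa sb]; rewrite !transport_norm.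
have L0 := transport_lip_ge0 N.
case: hab => [a0|b0].
  have s0 := le_trans a0 sa; have b0 := le_trans s0 sb.
  rewrite !ger0_norm// in aN bN *.
  have h := transport_pos_lip sb bN.
  rewrite ge_max (le_trans (transport_pos_le sa)) ?lerDl ?mulr_ge0 ?subr_ge0//=.
  by rewrite -lerBlDl (le_trans h)// ler_wpM2l// lerB.
have s0 := le_trans sb b0; have a0 := le_trans sa s0.
rewrite !ler0_norm// in aN bN *.
have h : transport_pos (- a) - transport_pos (- s) <= transport_lip N * (- a - - s).
  by apply: transport_pos_lip; rewrite ?lerN2.
rewrite ge_max andbC (le_trans (transport_pos_le (_ : - b <= - s))) ?lerN2 ?lerDl ?mulr_ge0 ?subr_ge0//=.
by rewrite -lerBlDl (le_trans h)// ler_wpM2l// opprK addrC lerB.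
Qed.

(* exp(-s^2) + gauss_erf s is increasing on [0, kappa / 2]. *)
Lemma log_density_neq0 s : 0 < `|s| < kappa / 2 -> log_density s != log_density 0.
Proof.
move=> /andP[s0 sk].
have hE : expR (- `|s| ^+ 2) + gauss_erf `|s| > 1.
  pose f x := expR (- x ^+ 2) + gauss_erf x.
  have f0 : f 0 = 1 by rewrite /f expr0n oppr0 expR0 gauss_erf0 addr0.
  suff : f 0 < f `|s| by rewrite f0.
  apply: (@is_derive_gt0_lt f (fun x => (kappa - 2 * x) * expR (- x ^+ 2)) _ _ s0).
    move=> x; have h := is_derive_gauss_erf x.
    have h2 : is_derive x 1 (fun s => - s ^+ 2) (- (2 * x)).
      have := is_deriveN (is_deriveX 2 (is_derive_id x (1 : R))).
      by rewrite exprfctE /GRing.scale/= mulr1 expr1.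
    have h3 := @is_derive1_comp R (@expR R) (fun s => - s ^+ 2) x _ _ (is_derive_expR (- x ^+ 2)) h2.
    have := is_deriveD h3 h.
    rewrite (_ : _ + _ = (kappa - 2 * x) * expR (- x ^+ 2))//.
    by ring.
  move=> x; rewrite in_itv/= => /andP[x0 xs]; rewrite mulr_gt0 ?expR_gt0// subr_gt0.
  by rewrite -ltr_pdivlMl// mulrC (lt_trans xs).
rewrite /log_density normr0 transport_pos0 expr0n subr0 addr0.
rewrite -addrA -subr_eq0 addrAC subrr add0r addrC subr_eq0 gt_eqF//.
rewrite -(real_normK (num_real s)) /transport_pos.
rewrite -[ltLHS]opprK ltrN2 -[ltRHS]expRK ltr_ln ?posrE ?expR_gt0 ?subr_gt0 ?gauss_erf_lt1//.
by rewrite ltrBlDr.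
Qed.

Lemma log_densityB s : log_density s - transport_pos `|s| = ln kappa - s ^+ 2.
Proof. by rewrite /log_density addrK. Qed.

Lemma kappaM_sqrt_pi : kappa * Num.sqrt pi = 2.
Proof. by rewrite /kappa divfK// gt_eqF// sqrtr_gt0 pi_gt0. Qed.

Lemma continuous_transport_abs : continuous (fun s => transport_pos `|s|).
Proof.
move=> x; apply: (@continuous_comp _ _ _ (fun s : R => `|s|) transport_pos).
  exact: norm_continuous.
exact: continuous_transport_pos.
Qed.

Lemma continuous_log_density : continuous log_density.
Proof.
move=> x; apply: cvgD; last exact: continuous_transport_abs.
apply: cvgB; first exact: cvg_cst.
exact: exprn_continuous.
Qed.

End transport1.

Opaque transport transport_pos log_density transport_lip kappa.

(** * The discretised transport map *)

Section cells.
Context {R : realType} (P : nat) (h : R) (h_gt0 : 0 < h).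
Implicit Types (j : nat) (s : R).

(** The shift by [P] centres the grid and makes 0 the knot of index [P], so that no cell has 0 in
    its interior. *)
Definition knot j : R := (j%:R - P%:R) * h.

Definition in_cell j s := knot j <= s < knot j.+1.

Definition cell_slope j : R := (transport (knot j.+1) - transport (knot j)) / h.

Definition cell_map j s : R := transport (knot j) + cell_slope j * (s - knot j).

Lemma knotS j : knot j.+1 = knot j + h.
Proof. by rewrite /knot -natr1; ring. Qed.

Lemma knot_lt j : knot j < knot j.+1.
Proof. by rewrite knotS ltrDl. Qed.

Lemma knot_le i j : (i <= j)%N -> knot i <= knot j.
Proof. by move=> ij; rewrite /knot ler_wpM2r ?(ltW h_gt0)// lerD2r ler_nat. Qed.

Lemma cell_slope_gt0 j : 0 < cell_slope j.
Proof. by rewrite divr_gt0// subr_gt0 transport_lt// knot_lt. Qed.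

Lemma cell_map_bounds j s : in_cell j s ->
  transport (knot j) <= cell_map j s < transport (knot j.+1).
Proof.
move=> /andP[js sj]; rewrite /cell_map lerDl mulr_ge0 ?(ltW (cell_slope_gt0 j)) ?subr_ge0//=.
rewrite -ltrBrDl -[ltRHS](divfK (lt0r_neq0 h_gt0)).
rewrite ltr_pM2l ?cell_slope_gt0// ltrBlDl. by rewrite -knotS.
Qed.

Lemma cell_map_lt i j s s' : in_cell i s -> in_cell j s' -> s < s' -> cell_map i s < cell_map j s'.
Proof.
move=> his hjs ss'; have [<-|ij] := eqVneq i j.
  by rewrite /cell_map ltrD2l ltr_pM2l ?cell_slope_gt0// ltrD2r.
have [_ h1] := andP (cell_map_bounds his); have [h2 _] := andP (cell_map_bounds hjs).
apply: (lt_le_trans h1); apply: le_trans h2.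
have ltij : (i < j)%N.
  rewrite ltn_neqAle ij leqNgt; apply/negP => ji.
  move: his hjs => /andP[a _] /andP[_ b].
  have := lt_le_trans b (knot_le ji) => c; have := lt_le_trans c a.
  by rewrite ltNge (ltW ss').
have := knot_le ltij; rewrite le_eqVlt => /predU1P[->//|/transport_lt/ltW//].
Qed.

Lemma cell_map_mono i j s s' : in_cell i s -> in_cell j s' ->
  0 <= (cell_map i s - cell_map j s') * (s - s') ?= iff (s == s').
Proof.
move=> his hjs; apply/leifP; have [<-|ss'] := eqVneq s s'; first by rewrite subrr mulr0.
move: ss'; rewrite neq_lt => /orP[ss'|ss'].
  by rewrite nmulr_rgt0 ?subr_lt0// (cell_map_lt his hjs).
by rewrite mulr_gt0 ?subr_gt0// (cell_map_lt hjs his).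
Qed.

Lemma in_cell_uniq i j s : in_cell i s -> in_cell j s -> i = j.
Proof.
rewrite /in_cell => /andP[a b] /andP[c d]; apply/eqP; rewrite eqn_leq.
by apply/andP; split; rewrite leqNgt; apply/negP => ij; have := knot_le ij;
  [move=> /(lt_le_trans d)/(le_lt_trans a)|move=> /(lt_le_trans b)/(le_lt_trans c)]; rewrite ltxx.
Qed.

Lemma in_cell_cover s : - (P%:R * h) <= s < P%:R * h -> exists j : 'I_(P + P), in_cell j s.
Proof.
move=> /andP[s1 s2].
have x0 : 0 <= (s + P%:R * h) / h by rewrite divr_ge0 ?(ltW h_gt0)// -lerBlDr sub0r.
have /andP[t1 t2] := truncn_itv x0; set t := Num.truncn _ in t1 t2.
have tP : (t < P + P)%N.
  rewrite -(ltr_nat R); apply: (le_lt_trans t1); rewrite ltr_pdivrMr// natrD mulrDl.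
  by rewrite ltrD2r.
exists (Ordinal tP); rewrite /in_cell /knot/=.
move: t1 t2; rewrite ler_pdivlMr// ltr_pdivrMr// => t1 t2.
by rewrite !mulrBl lerBlDr t1 ltrBrDr t2.
Qed.

Lemma knot_sign j : 0 <= knot j \/ knot j.+1 <= 0.
Proof.
rewrite /knot; have [Pj|jP] := leqP P j.
  by left; rewrite mulr_ge0 ?(ltW h_gt0)// subr_ge0 ler_nat.
by right; rewrite mulr_le0_ge0 ?(ltW h_gt0)// subr_le0 ler_nat.
Qed.

Lemma knot_norm j : (j <= P + P)%N -> `|knot j| <= P%:R * h.
Proof.
move=> jP; rewrite /knot normrM (gtr0_norm h_gt0) ler_wpM2r ?(ltW h_gt0)// ler_norml.
rewrite lerBrDr addNr ler0n /= lerBlDr -natrD ler_nat//.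
Qed.

End cells.

Opaque knot cell_slope.

Section discrete_transport.
Context {R : realType} {m n : nat} (u : 'I_m -> 'rV[R]_n) (c : 'I_m -> R).
Hypothesis c_ge0 : forall i, 0 <= c i.
Hypothesis u_unit : forall i, dotp (u i) (u i) = 1.
Hypothesis frame1 : frame_mx u c = 1%:M.
Context (K : set 'rV[R]_n).
Hypothesis mK : measurable K.
Hypothesis starK : forall x (t : R), K x -> 0 <= t <= 1 -> K (t *: x).
Hypothesis hullK : forall a : 'I_m -> R, \sum_i `|a i| <= 1 -> K (\sum_i a i *: u i).

Lemma frame_parseval x : \sum_i c i * dotp x (u i) ^+ 2 = dotp x x.
Proof.
have -> : dotp x x = dotp (x *m frame_mx u c) x by rewrite frame1 mulmx1.
rewrite mul_frame_mx dotp_suml; apply: eq_bigr => i _.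
by rewrite dotpZl [dotp (u i) x]dotpC expr2 mulrA.
Qed.

Lemma sum_frame_coef : \sum_i c i = n%:R.
Proof.
rewrite -(mxtrace1 R n) -frame1 /frame_mx raddf_sum; apply: eq_bigr => i _.
by rewrite /= mxtraceZ mxtrace_mulC /mxtrace big_ord1 -dotpE u_unit mulr1.
Qed.

Context (P : nat) (h : R) (h_gt0 : 0 < h).
Local Notation cellT := {ffun 'I_m -> 'I_(P + P)}.
Implicit Types al : cellT.

Definition cell al : set 'rV[R]_n := [set x | forall i, in_cell P h (al i) (dotp x (u i))].

(** On [cell al] the discretised map Phi is affine; this is its linear part and [cell_shift] its
    constant term. *)
Definition cell_mx al : 'M[R]_n := frame_mx u (fun i => c i * cell_slope P h (al i)).

Definition cell_shift al : 'rV[R]_n :=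
  \sum_i (c i * (transport (knot P h (al i)) - cell_slope P h (al i) * knot P h (al i))) *: u i.

(* The image of [cell al] lies in [cell_radius al *: K]. *)
Definition cell_radius al : R :=
  \sum_i c i * Num.max `|transport (knot P h (al i))| `|transport (knot P h (al i).+1)|.

Lemma cell_imageE al x :
  x *m cell_mx al + cell_shift al = \sum_i (c i * cell_map P h (al i) (dotp x (u i))) *: u i.
Proof.
rewrite mul_frame_mx -big_split/=; apply: eq_bigr => i _.
by rewrite -scalerDl; congr (_ *: _); rewrite /cell_map; ring.
Qed.

Lemma det_cell_mx_gt0 al : 0 < \det (cell_mx al).
Proof.
have := frame_det_ge_geom c_ge0 u_unit frame1 (fun i => ln (cell_slope P h (al i))).
rewrite /frame_det (_ : (fun i => _) = (fun i => c i * cell_slope P h (al i))); last first.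
  by apply/funext => i; rewrite lnK// posrE cell_slope_gt0.
by apply: lt_le_trans; exact: expR_gt0.
Qed.

Lemma cell_mx_unit al : cell_mx al \in unitmx.
Proof. by rewrite unitmxE unitfE gt_eqF// det_cell_mx_gt0. Qed.

(* [Phi] is strictly monotone: <Phi x - Phi y, x - y> is a nonnegative combination
   of one-dimensional increments. *)
Lemma cell_image_inj al be x y : cell al x -> cell be y ->
  x *m cell_mx al + cell_shift al = y *m cell_mx be + cell_shift be -> al = be.
Proof.
move=> hx hy E0; have E := etrans (esym (cell_imageE al x)) (etrans E0 (cell_imageE be y)).
suff xy : x = y.
  by apply/ffunP => i; apply/val_inj; apply: (in_cell_uniq h_gt0 (hx i)); rewrite xy; exact: hy.
have : \sum_i c i * ((cell_map P h (al i) (dotp x (u i)) - cell_map P h (be i) (dotp y (u i))) * (dotp x (u i) - dotp y (u i))) = 0.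
  have := congr1 (fun z => dotp z (x - y)) E; rewrite !dotp_suml => /eqP.
  rewrite -subr_eq0 -sumrB => /eqP E1; rewrite -[RHS]E1; apply: eq_bigr => i _.
  rewrite !dotpZl (dotpC (u i)) dotpDl dotpNl; ring.
have ge0 i : 0 <= c i * ((cell_map P h (al i) (dotp x (u i)) - cell_map P h (be i) (dotp y (u i))) * (dotp x (u i) - dotp y (u i))).
  by rewrite mulr_ge0//; have [] := cell_map_mono h_gt0 (hx i) (hy i).
move=> /eqP; rewrite psumr_eq0// => /allP h0.
apply/eqP; rewrite -subr_eq0 -dotp_eq0 -frame_parseval big1// => i _.
have := h0 i; rewrite mem_index_enum => /(_ isT) /=; rewrite mulf_eq0 => /orP[/eqP->|]; first by rewrite mul0r.
have [_] := cell_map_mono h_gt0 (hx i) (hy i); rewrite eq_sym => -> /eqP e.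
by rewrite dotpDl dotpNl e subrr expr0n mulr0.
Qed.

Lemma cell_image_radius al x : cell al x ->
  exists2 k, K k & x *m cell_mx al + cell_shift al = cell_radius al *: k.
Proof.
move=> hx; rewrite cell_imageE.
pose a i := c i * cell_map P h (al i) (dotp x (u i)).
have ha i : `|a i| <= c i * Num.max `|transport (knot P h (al i))| `|transport (knot P h (al i).+1)|.
  rewrite normrM (ger0_norm (c_ge0 i)) ler_wpM2l//.
  have /andP[h1 /ltW h2] := cell_map_bounds h_gt0 (hx i).
  rewrite ler_norml; apply/andP; split; last first.
    by apply: (le_trans h2); rewrite le_max; apply/orP; right; exact: ler_norm.
  rewrite lerNl le_max; apply/orP; left.
  apply: (@le_trans _ _ (- transport (knot P h (al i)))); first by rewrite lerN2.
  by rewrite -normrN ler_norm.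
have sa : \sum_i `|a i| <= cell_radius al by apply: ler_sum => i _; exact: ha.
have r0 : 0 <= cell_radius al by apply: le_trans sa; rewrite sumr_ge0.
(* With radius 0 there is nothing to normalise by; all coefficients vanish then, and [k] is taken to
   be 0. *)
have [r00|r_neq0] := eqVneq (cell_radius al) 0.
  exists (\sum_i 0 *: u i); first by apply: (hullK (a := fun=> 0)); rewrite big1 ?ler01// => i _; rewrite normr0.
  rewrite r00 scale0r big1// => i _; suff ai : a i = 0 by rewrite -/(a i) ai scale0r.
  move: sa; rewrite r00 => sa0; have /eqP : \sum_i `|a i| = 0 by apply/eqP; rewrite eq_le sa0 sumr_ge0.
  by rewrite psumr_eq0// => /allP/(_ i); rewrite mem_index_enum => /(_ isT)/=; rewrite normr_eq0 => /eqP.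
exists (\sum_i (a i / cell_radius al) *: u i).
  apply: hullK; under eq_bigr do rewrite normrM normfV (ger0_norm r0).
  by rewrite -mulr_suml ler_pdivrMr ?mul1r// lt_neqAle eq_sym r_neq0.
rewrite scaler_sumr; apply: eq_bigr => i _; rewrite scalerA mulrCA mulfV// mulr1//.
Qed.

Lemma measurable_dotp v : measurable_fun [set: 'rV[R]_n] (fun x : 'rV[R]_n => dotp x v).
Proof.
apply: measurable_sum => i; apply: measurable_funM => //; exact: measurable_coord.
Qed.

Lemma measurable_cell al : measurable (cell al).
Proof.
have -> : cell al = \bigcap_(i in [set: 'I_m])
    ((fun x : 'rV[R]_n => dotp x (u i)) @^-1` `[knot P h (al i), knot P h (al i).+1[).
  by apply/seteqP; split => x /= hx i; [move=> _; rewrite /= in_itv/=; exact: hx|have := hx i I; rewrite /= in_itv].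
apply: fin_bigcap_measurable; first exact: finite_finset.
move=> i _; rewrite -[X in measurable X]setTI.
by apply: measurable_dotp => //; exact: measurable_itv.
Qed.

(** The image under the affine map, written as a preimage under its inverse, the form in which
    [measurable_affine_preimage] and [lebn_affine] apply. *)
Definition cell_image al : set 'rV[R]_n :=
  [set y | cell al (y *m invmx (cell_mx al) + - (cell_shift al *m invmx (cell_mx al)))].

Lemma cell_imageP al y : cell_image al y ->
  exists2 x, cell al x & y = x *m cell_mx al + cell_shift al.
Proof.
move=> hy; exists (y *m invmx (cell_mx al) + - (cell_shift al *m invmx (cell_mx al))) => //.
by rewrite mulmxDl mulNmx !mulmxKV ?cell_mx_unit// subrK.
Qed.

Lemma measurable_cell_image al : measurable (cell_image al).
Proof. by apply: measurable_affine_preimage; exact: measurable_cell. Qed.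

Lemma lebn_cell_image al :
  lebn R n (cell_image al) = ((\det (cell_mx al))%:E * lebn R n (cell al))%E.
Proof.
have hu : invmx (cell_mx al) \in unitmx by rewrite unitmx_inv cell_mx_unit.
rewrite (lebn_affine hu _ (measurable_cell al)) det_inv normfV invrK gtr0_norm//.
exact: det_cell_mx_gt0.
Qed.

(** The cell images are pairwise disjoint, and on the image of [cell al] the layer of K is at least
    exp(- cell_radius al). The left side is the integral of this step function. *)
Lemma discrete_transport :
  (\sum_al (expR (- cell_radius al) * \det (cell_mx al))%:E * lebn R n (cell al)
    <= n`!%:R%:E * lebn R n K)%E.
Proof.
rewrite -integral_layer//.
have mI al : measurable_fun [set: 'rV[R]_n] (fun y => (\1_(cell_image al) y)%:E : \bar R).
  by apply/measurable_EFinP; apply: measurable_indic; exact: measurable_cell_image.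
have E al : ((expR (- cell_radius al) * \det (cell_mx al))%:E * lebn R n (cell al) =
    \int[lebn R n]_y ((expR (- cell_radius al))%:E * (\1_(cell_image al) y)%:E))%E.
  rewrite ge0_integralZl//; do ?[by move=> y _; rewrite lee_fin|by rewrite lee_fin expR_ge0].
  rewrite integral_indic//; last exact: measurable_cell_image.
  by rewrite setIT EFinM -muleA; congr (_ * _)%E; exact/esym/lebn_cell_image.
rewrite (eq_bigr _ (fun al _ => E al)).
rewrite -ge0_integral_sum//; last by move=> al; apply: measurable_funeM.
apply: ge0_le_integral => //.
- by move=> y _; apply: sume_ge0 => al _; rewrite mule_ge0// lee_fin ?expR_ge0// indicE.
- by apply: emeasurable_sum => al; apply: measurable_funeM.
- exact: measurable_layer.
move=> y _; have [[al hal]|nal] := pselect (exists al, cell_image al y).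
  rewrite (bigD1 al)//= big1 ?adde0; last first.
    move=> be beal; rewrite indicE memNset ?mule0// => hbe.
    have [x hx xE] := cell_imageP hal; have [x' hx' x'E] := cell_imageP hbe.
    by move/eqP: beal; apply; exact: (cell_image_inj hx' hx (etrans (esym x'E) xE)).
  rewrite indicE mem_set// mule1.
  have [x hx ->] := cell_imageP hal; have [k Kk ->] := cell_image_radius hx.
  apply: layer_lower => //.
  by apply: sumr_ge0 => i _; rewrite mulr_ge0// le_max normr_ge0.
rewrite big1 ?layer_ge0// => al _; rewrite indicE memNset ?mule0// => hal.
by apply: nal; exists al.
Qed.

End discrete_transport.

Lemma lee_sum_term (R : realType) (I : finType) (F : I -> \bar R) a :
  (forall i, 0 <= F i)%E -> (F a <= \sum_i F i)%E.
Proof. by move=> F0; rewrite (bigD1 a)//= leeDl// sume_ge0. Qed.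

Section transport_bound.
Context {R : realType} {m n : nat} (u : 'I_m -> 'rV[R]_n) (c : 'I_m -> R).
Hypothesis c_ge0 : forall i, 0 <= c i.
Hypothesis u_unit : forall i, dotp (u i) (u i) = 1.
Hypothesis frame1 : frame_mx u c = 1%:M.
Context (K : set 'rV[R]_n).
Hypothesis mK : measurable K.
Hypothesis starK : forall x (t : R), K x -> 0 <= t <= 1 -> K (t *: x).
Hypothesis hullK : forall a : 'I_m -> R, \sum_i `|a i| <= 1 -> K (\sum_i a i *: u i).

(** The factor exp(-sum c_i |T(<x,u_i>)|) times the Jacobian determinant of Phi at x, as exp of
    [log_density] is T'. *)
Definition density (x : 'rV[R]_n) : R :=
  expR (- \sum_i c i * transport_pos `|dotp x (u i)|) *
  frame_det u c (fun i => expR (log_density (dotp x (u i)))).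

Lemma density_ge0 x : 0 <= density x.
Proof. by rewrite mulr_ge0 ?expR_ge0// frame_det_ge0// => i; rewrite expR_ge0. Qed.

Lemma measurable_comp_dotp (f : R -> R) v : continuous f ->
  measurable_fun [set: 'rV[R]_n] (fun x : 'rV[R]_n => f (dotp x v)).
Proof.
move=> cf; have mf : measurable_fun [set: R] f by exact: continuous_measurable_fun.
exact: (measurableT_comp mf (@measurable_dotp R n v)).
Qed.

Lemma measurable_density : measurable_fun [set: 'rV[R]_n] density.
Proof.
apply: measurable_funM.
  apply: measurableT_comp => //; apply: measurableT_comp => //.
  apply: measurable_sum => i; apply: measurable_funM => //.
  exact: (measurable_comp_dotp _ continuous_transport_abs).
under eq_fun do rewrite frame_detE.
apply: measurable_sum => f; apply: measurable_funM => //.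
apply: measurable_prod => j _.
by apply: measurableT_comp => //; exact: (measurable_comp_dotp _ continuous_log_density).
Qed.

(** The determinant, of degree n in the slopes, loses up to exp((2 N + L) h) per degree, with L =
    [transport_lip N]; the radius is too large by at most n L h, since the weights [c] sum to n. *)
Definition distortion (N h : R) : R := expR (n%:R * ((2 * N + transport_lip N *+ 2) * h)).

Lemma le_density_cell (P : nat) (h : R) (h_gt0 : 0 < h) (al : {ffun 'I_m -> 'I_(P + P)}) x :
  cell u h al x ->
  density x <= distortion (P%:R * h) h * (expR (- cell_radius c h al) * \det (cell_mx u c h al)).
Proof.
set N := P%:R * h; set L := transport_lip N => hx.
have hb i : knot P h (al i) <= dotp x (u i) <= knot P h (al i).+1.
  by have /andP[-> /ltW ->] := hx i.
have kN i : `|knot P h (al i)| <= N by apply: (knot_norm h_gt0); rewrite ltnW.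
have kN' i : `|knot P h (al i).+1| <= N by exact: (knot_norm h_gt0).
have kh i : knot P h (al i).+1 - knot P h (al i) = h by rewrite (knotS P h) addrC addrA addNr add0r.
have r_le : cell_radius c h al <= \sum_i c i * transport_pos `|dotp x (u i)| + n%:R * (L * h).
  rewrite -(sum_frame_coef u_unit frame1) mulr_suml -big_split/=; apply: ler_sum => i _.
  rewrite -mulrDr ler_wpM2l// -[X in _ * X](kh i).
  exact: (transport_norm_le (knot_sign P h_gt0 (al i)) (ltW (knot_lt P h_gt0 (al i))) (kN i) (kN' i) (hb i)).
have d_le : expR (- ((2 * N + L) * h)) ^+ n * frame_det u c (fun i => expR (log_density (dotp x (u i)))) <= \det (cell_mx u c h al).
  apply: le_frame_det => //; do ?[exact: expR_ge0|by move=> i; exact: expR_ge0].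
  move=> i; rewrite mulrC -(kh i) /L [X in _ <= X](_ : _ = (transport (knot P h (al i).+1) - transport (knot P h (al i))) / (knot P h (al i).+1 - knot P h (al i))); last first.
    by rewrite (kh i).
  exact: (transport_slope (knot_sign P h_gt0 (al i)) (knot_lt P h_gt0 (al i)) (kN i) (kN' i) (hb i)).
rewrite -expRM_natl mulr_natl in d_le.
have -> : density x = expR (n%:R * ((2 * N + L) * h)) * expR (- \sum_i c i * transport_pos `|dotp x (u i)|) *
    (expR (- ((2 * N + L) * h) *+ n) * frame_det u c (fun i => expR (log_density (dotp x (u i))))).
  rewrite mulrACA -expRD (_ : _ + _ = 0) ?expR0 ?mul1r//.
  by rewrite -mulr_natl; ring.
apply: le_trans (ler_wpM2l _ d_le) _; first by rewrite mulr_ge0 ?expR_ge0.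
rewrite [leRHS]mulrA ler_wpM2r ?(ltW (det_cell_mx_gt0 c_ge0 u_unit frame1 h_gt0 al))//.
rewrite /distortion -!expRD ler_expR -/L.
move: r_le; set S := \sum_i _; move: (cell_radius _ _ _) => r r_le.
have -> : n%:R * ((2 * N + L *+ 2) * h) = n%:R * ((2 * N + L) * h) + n%:R * (L * h) :> R.
  by rewrite -mulr_natr; ring.
by rewrite -addrA lerD2l lerBrDr addrC lerBlDl.
Qed.

Definition slab (N : R) : set 'rV[R]_n := [set x | forall i, - N <= dotp x (u i) < N].

Lemma measurable_slab N : measurable (slab N).
Proof.
have -> : slab N = \bigcap_(i in [set: 'I_m])
    ((fun x : 'rV[R]_n => dotp x (u i)) @^-1` `[- N, N[).
  by apply/seteqP; split => x /= hx i; [move=> _; rewrite /= in_itv/=; exact: hx|have := hx i I; rewrite /= in_itv].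
apply: fin_bigcap_measurable; first exact: finite_finset.
move=> i _; rewrite -[X in measurable X]setTI.
by apply: measurable_dotp => //; exact: measurable_itv.
Qed.

(** The cells cover the slab, and on each of them [density] is at most the distortion times the term
    of [discrete_transport]. *)
Lemma integral_density_slab_distort (P : nat) (h : R) : 0 < h ->
  (\int[lebn R n]_(x in slab (P%:R * h)) (density x)%:E
   <= (distortion (P%:R * h) h)%:E * (n`!%:R%:E * lebn R n K))%E.
Proof.
move=> h_gt0; set C := distortion _ _.
have C0 : 0 <= C by exact: expR_ge0.
have [v [v0 hv hsum]] : exists v : {ffun 'I_m -> 'I_(P + P)} -> R, [/\ forall al, 0 <= v al,
    forall al x, cell u h al x -> density x <= C * v al
    & (\sum_al (v al)%:E * lebn R n (cell u h al) <= n`!%:R%:E * lebn R n K)%E].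
  exists (fun al => expR (- cell_radius c h al) * \det (cell_mx u c h al)); split.
  - by move=> al; rewrite mulr_ge0 ?expR_ge0// ltW// det_cell_mx_gt0.
  - by move=> al x hx; exact: le_density_cell.
  - exact: discrete_transport.
apply: (@le_trans _ _ (C%:E * (\sum_al (v al)%:E * lebn R n (@cell R m n u P h al)))%E); last first.
  by apply: lee_wpmul2l; rewrite ?lee_fin.
have mI al : measurable_fun [set: 'rV[R]_n] (fun y => (\1_(@cell R m n u P h al) y)%:E : \bar R).
  by apply/measurable_EFinP; apply: measurable_indic; exact: measurable_cell.
have E al : ((v al)%:E * lebn R n (@cell R m n u P h al) =
    \int[lebn R n]_y ((v al)%:E * (\1_(@cell R m n u P h al) y)%:E))%E.
  rewrite ge0_integralZl//; do ?[by move=> y _; rewrite lee_fin|by rewrite lee_fin].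
  rewrite integral_indic//; last exact: measurable_cell.
  by rewrite setIT.
rewrite (eq_bigr _ (fun al _ => E al)).
rewrite -ge0_integral_sum//; do ?[by move=> al; apply: measurable_funeM|by move=> al y _; rewrite mule_ge0// lee_fin].
have S0 y : (0 <= \sum_al (v al)%:E * (\1_(@cell R m n u P h al) y)%:E)%E.
  by apply: sume_ge0 => al _; rewrite mule_ge0// lee_fin.
have mS : measurable_fun [set: 'rV[R]_n] (fun y => (\sum_al (v al)%:E * (\1_(@cell R m n u P h al) y)%:E)%E).
  by apply: emeasurable_sum => al; apply: measurable_funeM.
rewrite -ge0_integralZl//.
rewrite [X in (X <= _)%E]integral_mkcond; apply: ge0_le_integral => //.
- by move=> x _; rewrite patchE; case: ifP => _ //; rewrite lee_fin density_ge0.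
- apply/(measurable_restrict _ (measurable_slab _)) => //.
  by apply: measurable_funTS; apply/measurable_EFinP; exact: measurable_density.
- exact: measurable_funeM.
move=> x _; rewrite patchE; case: ifPn => [/set_mem hx|_]; last first.
  by rewrite mule_ge0// lee_fin.
have [al hal] : exists al : {ffun 'I_m -> 'I_(P + P)}, cell u h al x.
  have [al hal] := choice (fun i => in_cell_cover h_gt0 (hx i)).
  by exists [ffun i => al i] => i; rewrite ffunE.
apply: (@le_trans _ _ (C%:E * (v al)%:E)%E).
  by rewrite -EFinM lee_fin hv.
apply: lee_wpmul2l; first by rewrite lee_fin.
have vE : ((v al)%:E = (v al)%:E * (\1_(cell u h al) x)%:E)%E.
  by rewrite indicE (mem_set hal) mule1.
rewrite vE; apply: (lee_sum_term (F := fun k => ((v k)%:E * (\1_(cell u h k) x)%:E)%E)) => k.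
by rewrite mule_ge0// lee_fin.
Qed.

Hypothesis Kfin : (lebn R n K < +oo)%E.

(** With k+1 cells on each side of 0 and step N/(k+1) the grid fills the slab exactly. The
    distortion is exp(a/(k+1)), with [a] depending only on n and N, and tends to 1. *)
Lemma integral_density_slab (N : R) : 0 < N ->
  (\int[lebn R n]_(x in slab N) (density x)%:E <= n`!%:R%:E * lebn R n K)%E.
Proof.
move=> N0.
have Kf : lebn R n K \is a fin_num by rewrite ge0_fin_numE.
pose y := n`!%:R * fine (lebn R n K).
have yE : (n`!%:R%:E * lebn R n K = y%:E)%E by rewrite EFinM fineK.
have y0 : 0 <= y by rewrite mulr_ge0// fine_ge0.
rewrite yE.
pose a := n%:R * ((2 * N + transport_lip N *+ 2) * N).
have bound k : (\int[lebn R n]_(x in slab N) (density x)%:E <= (expR (a * harmonic k) * y)%:E)%E.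
  have h0 : 0 < N / k.+1%:R by rewrite divr_gt0.
  have := @integral_density_slab_distort k.+1 _ h0.
  have -> : k.+1%:R * (N / k.+1%:R) = N by rewrite mulrC divfK// pnatr_eq0.
  rewrite yE -EFinM (_ : distortion N (N / k.+1%:R) = expR (a * harmonic k))//.
  by rewrite /distortion /a /harmonic /=; congr expR; rewrite !mulrA.
have cv : (fun k => expR (a * harmonic k) * y) @ \oo --> y.
  rewrite -[X in _ --> X]mul1r; apply: cvgM; last exact: cvg_cst.
  rewrite -[X in _ --> X](expR0 R).
  have ha : (fun k => a * harmonic k) @ \oo --> (0 : R).
    rewrite -[X in _ --> X](mulr0 a); apply: cvgM; first exact: cvg_cst.
    exact: cvg_harmonic.
  exact: (cvg_comp _ _ ha (@continuous_expR R 0)).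
case: (\int[lebn R n]_(x in slab N) (density x)%:E)%E (bound) => [r| |].
- move=> hr; rewrite lee_fin -(cvg_lim (@Rhausdorff R) cv).
  apply: limr_ge; first by apply/cvg_ex; exists y.
  by near=> k; rewrite -lee_fin; exact: hr.
- by move=> /(_ 0%N).
- by rewrite leNye.
Unshelve. all: by end_near. Qed.

(** The distortion is controlled for fixed N only, so the slabs are exhausted afterwards, by
    monotone convergence. *)
Lemma integral_density :
  (\int[lebn R n]_x (density x)%:E <= n`!%:R%:E * lebn R n K)%E.
Proof.
pose f (k : nat) := ((EFin \o density) \_ (slab k%:R)).
have md : measurable_fun [set: 'rV[R]_n] (EFin \o density).
  by apply/measurable_EFinP; exact: measurable_density.
have mf k : measurable_fun [set: 'rV[R]_n] (f k).
  apply/(measurable_restrict _ (measurable_slab _)) => //; exact: measurable_funTS.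
have f0 k x : [set: 'rV[R]_n] x -> (0 <= f k x)%E.
  by move=> _; rewrite /f patchE; case: ifP => // _; rewrite lee_fin density_ge0.
have ndf x : [set: 'rV[R]_n] x -> nondecreasing_seq (f ^~ x).
  move=> _ i j ij; rewrite /f !patchE; case: ifPn => [/set_mem hx|_]; last first.
    by case: ifP => _ //; rewrite lee_fin density_ge0.
  rewrite mem_set// => k; have /andP[h1 h2] := hx k.
  have ijR : (i%:R <= j%:R :> R) by rewrite ler_nat.
  by rewrite (le_trans _ h1) ?lerN2//= (lt_le_trans h2).
have cvf x : f ^~ x @ \oo --> (density x)%:E.
  apply: cvg_near_cst.
  have [k hk] : exists k : nat, forall i, `|dotp x (u i)| < k%:R.
    exists (Num.truncn (\sum_i `|dotp x (u i)|)).+1 => i.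
    apply: le_lt_trans (truncnS_gt _).
    by rewrite (bigD1 i)//= lerDl sumr_ge0.
  exists k => // j /= kj; rewrite /f patchE mem_set//= => i.
  have := hk i; rewrite ltr_norml => /andP[h1 h2].
  have kjR : (k%:R <= j%:R :> R) by rewrite ler_nat.
  by rewrite (le_trans _ (ltW h1)) ?lerN2//= (lt_le_trans h2).
rewrite (eq_integral (fun x => limn (f ^~ x))); last first.
  by move=> x _; apply/esym/cvg_lim.
rewrite monotone_convergence//.
apply: lime_le.
  apply: ereal_nondecreasing_is_cvgn => i j ij; apply: ge0_le_integral => //.
  - by move=> x _; exact: f0.
  - by move=> x _; exact: ndf.
near=> k.
rewrite /f -integral_mkcond; apply: integral_density_slab.
by rewrite ltr0n; near: k; exists 1%N.
Unshelve. all: by end_near. Qed.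

End transport_bound.

(** * Continuity and strict comparison of integrals *)

Section continuous_ops.
Context {R : realType} {T : topologicalType}.
Implicit Types f g : T -> R.

Lemma continuous_add f g : continuous f -> continuous g -> continuous (fun x => f x + g x).
Proof. by move=> cf cg x; apply: cvgD; [exact: cf|exact: cg]. Qed.

Lemma continuous_mul f g : continuous f -> continuous g -> continuous (fun x => f x * g x).
Proof. by move=> cf cg x; apply: cvgM; [exact: cf|exact: cg]. Qed.

Lemma continuous_opp f : continuous f -> continuous (fun x => - f x).
Proof. by move=> cf x; apply: cvgN; exact: cf. Qed.

Lemma continuous_const (k : R) : continuous (fun _ : T => k).
Proof. by move=> x; exact: cvg_cst. Qed.

Lemma continuous_after (h : R -> R) f : continuous h -> continuous f -> continuous (fun x => h (f x)).
Proof. by move=> ch cf x; apply: (@continuous_comp _ _ _ f h); [exact: cf|exact: ch]. Qed.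

Lemma continuous_bigsum I (r : seq I) (F : I -> T -> R) :
  (forall i, continuous (F i)) -> continuous (fun x => \sum_(i <- r) F i x).
Proof.
move=> cF; elim: r => [|i r IH].
  under eq_fun do rewrite big_nil; exact: continuous_const.
under eq_fun do rewrite big_cons; exact: continuous_add.
Qed.

Lemma continuous_bigprod I (r : seq I) (F : I -> T -> R) :
  (forall i, continuous (F i)) -> continuous (fun x => \prod_(i <- r) F i x).
Proof.
move=> cF; elim: r => [|i r IH].
  under eq_fun do rewrite big_nil; exact: continuous_const.
under eq_fun do rewrite big_cons; exact: continuous_mul.
Qed.

End continuous_ops.

(** Where g - f exceeds half of its value at x0, g is larger by a fixed margin. This set is open and
    nonempty, hence of positive measure, and the finite integral of f keeps the inequality
    strict. *)
Lemma lt_integral_continuous {R : realType} {n : nat} (f g : 'rV[R]_n -> R) :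
  (forall x, 0 <= f x) -> (forall x, f x <= g x) -> continuous f -> continuous g ->
  measurable_fun [set: 'rV[R]_n] f -> measurable_fun [set: 'rV[R]_n] g ->
  (\int[lebn R n]_x (f x)%:E \is a fin_num)%E -> forall x0, f x0 < g x0 ->
  (\int[lebn R n]_x (f x)%:E < \int[lebn R n]_x (g x)%:E)%E.
Proof.
move=> f0 fg cf cg mf mg ffin x0 hx0; pose eta := (g x0 - f x0) / 2.
have eta0 : 0 < eta by rewrite divr_gt0// subr_gt0.
pose U := [set x | eta < g x - f x].
have oU : open U.
  have cd : continuous (fun x => g x - f x).
    by apply: continuous_add => //; exact: continuous_opp.
  exact: (open_comp (fun x _ => cd x) (@open_gt R eta)).
have U0 : U !=set0.
  by exists x0; rewrite /U/= /eta ltr_pdivrMr// ltr_pMr ?subr_gt0// ltr1n.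
have mU : measurable U := open_measurable_rV oU.
have lU : (0 < lebn R n U)%E by exact: lebn_open_gt0.
have mfE : measurable_fun [set: 'rV[R]_n] (fun x => (f x)%:E : \bar R) by apply/measurable_EFinP.
have mgE : measurable_fun [set: 'rV[R]_n] (fun x => (g x)%:E : \bar R) by apply/measurable_EFinP.
have mUE : measurable_fun [set: 'rV[R]_n] (fun x => (\1_U x)%:E : \bar R).
  by apply/measurable_EFinP; exact: measurable_indic.
apply: (@lt_le_trans _ _ (\int[lebn R n]_x ((f x)%:E + eta%:E * (\1_U x)%:E))%E); last first.
  apply: ge0_le_integral => //.
  - by move=> x _; rewrite adde_ge0 ?mule_ge0 ?lee_fin ?f0 ?(ltW eta0).
  - by apply: emeasurable_funD => //; exact: measurable_funeM.
  - move=> x _; rewrite -EFinM -EFinD lee_fin indicE; case: (boolP (x \in U)) => [/set_mem hx|_].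
      by rewrite mulr1 -lerBrDl ltW.
    by rewrite mulr0 addr0 fg.
rewrite ge0_integralD//.
- rewrite ge0_integralZl//; last by rewrite lee_fin ltW.
    rewrite integral_indic// setIT -[ltLHS]adde0 lteD2lE//.
    by rewrite mule_gt0// lte_fin.
- by move=> x _; rewrite lee_fin f0.
- by move=> x _; rewrite mule_ge0 ?lee_fin ?(ltW eta0).
- exact: measurable_funeM.
Qed.

(** * The Gaussian lower bound *)

Section gaussian_lower_bound.
Context {R : realType} {m n : nat} (u : 'I_m -> 'rV[R]_n) (c : 'I_m -> R).
Hypothesis c_ge0 : forall i, 0 <= c i.
Hypothesis u_unit : forall i, dotp (u i) (u i) = 1.
Hypothesis frame1 : frame_mx u c = 1%:M.

Definition gauss_density (x : 'rV[R]_n) : R := \prod_i (kappa * gauss_fun (x ord0 i)).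

Lemma integral_gauss_density : (\int[lebn R n]_x (gauss_density x)%:E = ((2 : R) ^+ n)%:E)%E.
Proof.
rewrite /gauss_density (@integral_prod_coord R n (fun x => kappa * gauss_fun x) 2)//.
- by apply: measurable_funM => //; exact: measurable_gauss_fun.
- by move=> x; rewrite mulr_ge0 ?gauss_fun_ge0// ltW// kappa_gt0.
under eq_integral do rewrite EFinM.
rewrite ge0_integralZl//.
- by rewrite integralT_gauss -EFinM kappaM_sqrt_pi.
- by apply/measurable_EFinP; exact: measurable_gauss_fun.
- by move=> x _; rewrite lee_fin gauss_fun_ge0.
- by rewrite lee_fin ltW// kappa_gt0.
Qed.

(** The logarithms of T' and of exp(-|T|) add up to ln kappa - s^2; summed with weights [c] this is
    n ln kappa - |x|^2, by the trace and Parseval identities. The Gaussian is thus the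
    geometric-mean minorant of [density]. *)
Lemma gauss_densityE x :
  gauss_density x = expR (- \sum_i c i * transport_pos `|dotp x (u i)|) *
    expR (\sum_i c i * log_density (dotp x (u i))).
Proof.
rewrite -expRD addrC -sumrB.
under eq_bigr do rewrite -mulrBr log_densityB mulrBr.
rewrite sumrB -mulr_suml (sum_frame_coef u_unit frame1) (frame_parseval frame1).
rewrite /gauss_density big_split/= prodr_const card_ord /gauss_fun -expR_sum sumrN.
rewrite expRD expRM_natl lnK ?posrE ?kappa_gt0//; congr (_ * expR (- _)).
Qed.

Lemma gauss_density_le x : gauss_density x <= density u c x.
Proof. by rewrite gauss_densityE /density ler_wpM2l ?expR_ge0// frame_det_ge_geom. Qed.

Lemma gauss_density_lt f x : frame_weight u c f != 0 ->
  \sum_j log_density (dotp x (u (f j))) != \sum_i c i * log_density (dotp x (u i)) ->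
  gauss_density x < density u c x.
Proof.
move=> wf hf; rewrite gauss_densityE /density ltr_pM2l ?expR_gt0//.
exact: (frame_det_gt_geom c_ge0 u_unit frame1 wf).
Qed.

Lemma continuous_dotp v : continuous (fun x : 'rV[R]_n => dotp x v).
Proof.
apply: continuous_bigsum => i; apply: continuous_mul; last exact: continuous_const.
exact: coord_continuous.
Qed.

Lemma continuous_density : continuous (density u c).
Proof.
apply: continuous_mul.
  apply: continuous_after; first exact: continuous_expR.
  apply: continuous_opp; apply: continuous_bigsum => i.
  apply: continuous_mul; first exact: continuous_const.
  exact: (continuous_after (@continuous_transport_abs R) (@continuous_dotp (u i))).
rewrite (_ : (fun x => _) = (fun x => \sum_f frame_weight u c f * \prod_j expR (log_density (dotp x (u (f j)))))); last first.
  by apply/funext => y; rewrite frame_detE.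
apply: continuous_bigsum => f; apply: continuous_mul; first exact: continuous_const.
apply: continuous_bigprod => j; apply: continuous_after; first exact: continuous_expR.
exact: (continuous_after continuous_log_density (@continuous_dotp (u (f j)))).
Qed.

Lemma continuous_gauss_density : continuous gauss_density.
Proof.
apply: continuous_bigprod => j; apply: continuous_mul; first exact: continuous_const.
apply: continuous_after; first exact: continuous_gauss_fun.
exact: coord_continuous.
Qed.

Lemma measurable_gauss_density : measurable_fun [set: 'rV[R]_n] gauss_density.
Proof.
apply: measurable_prod => i _; apply: measurable_funM => //.
apply: measurableT_comp; [exact: measurable_gauss_fun|exact: measurable_coord].
Qed.

Lemma gauss_density_ge0 x : 0 <= gauss_density x.
Proof. by apply: prodr_ge0 => i _; rewrite mulr_ge0 ?gauss_fun_ge0// ltW// kappa_gt0. Qed.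

Lemma integral_density_ge : (((2 : R) ^+ n)%:E <= \int[lebn R n]_x (density u c x)%:E)%E.
Proof.
rewrite -integral_gauss_density; apply: ge0_le_integral => //.
- by move=> x _; rewrite lee_fin gauss_density_ge0.
- by apply/measurable_EFinP; exact: measurable_gauss_density.
- by apply/measurable_EFinP; exact: measurable_density.
- by move=> x _; rewrite lee_fin gauss_density_le.
Qed.

Lemma integral_density_gt x0 : gauss_density x0 < density u c x0 ->
  (((2 : R) ^+ n)%:E < \int[lebn R n]_x (density u c x)%:E)%E.
Proof.
move=> hx0; rewrite -integral_gauss_density.
apply: (@lt_integral_continuous _ _ _ _ gauss_density_ge0 gauss_density_le continuous_gauss_density continuous_density measurable_gauss_density (measurable_density u c) _ x0 hx0).
by rewrite integral_gauss_density.
Qed.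

Context (K : set 'rV[R]_n).
Hypothesis mK : measurable K.
Hypothesis starK : forall x (t : R), K x -> 0 <= t <= 1 -> K (t *: x).
Hypothesis hullK : forall a : 'I_m -> R, \sum_i `|a i| <= 1 -> K (\sum_i a i *: u i).
Hypothesis Kfin : (lebn R n K < +oo)%E.

Lemma lebn_frame_ge : (((2 : R) ^+ n)%:E <= n`!%:R%:E * lebn R n K)%E.
Proof.
apply: le_trans integral_density_ge _.
exact: integral_density.
Qed.

(** If the sum for some [f] of nonzero weight were off the mean at some x, [density] would exceed
    the Gaussian there and its integral would exceed 2^n, against [integral_density]. *)
Lemma lebn_frame_eq : (n`!%:R%:E * lebn R n K = ((2 : R) ^+ n)%:E)%E ->
  exists f : {ffun 'I_n -> 'I_m}, forall j k, dotp (u (f j)) (u (f k)) = (j == k)%:R.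
Proof.
move=> hK; apply: (frame_orthonormal u_unit frame1 (l := log_density) (delta := kappa / 2)).
- by rewrite divr_gt0// kappa_gt0.
- exact: log_density_neq0.
move=> f x wf; apply: contrapT => /eqP hf.
have := integral_density_gt (gauss_density_lt wf hf); rewrite -hK ltNge => /negP; apply.
exact: integral_density.
Qed.

End gaussian_lower_bound.

(** * Extremal decompositions of the identity *)

Lemma row_dependence (F : fieldType) N p (V : 'M[F]_(N, p)) : (p < N)%N ->
  exists2 a : 'rV[F]_N, a != 0 & a *m V = 0.
Proof.
move=> pN; have : kermx V != 0.
  rewrite kermx_eq0; apply: contraL pN => /eqP h; rewrite -leqNgt -h.
  exact: rank_leq_col.
by case/rowV0Pn => a /sub_kermxP ha a0; exists a.
Qed.

(* A relation [sum a i v i = 0] with [sum a i = 0] is subtracted from [c] until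
   the first coefficient vanishes. *)
Lemma caratheodory_step (R : realType) N m n (v : 'I_N -> 'M[R]_(m, n)) (c : 'I_N -> R) :
  ((m * n).+1 < N)%N -> (forall i, 0 <= c i) ->
  exists c', [/\ forall i, 0 <= c' i, \sum_i c' i = \sum_i c i,
    \sum_i c' i *: v i = \sum_i c i *: v i & exists j, c' j = 0].
Proof.
move=> pN c0.
(* The additional column of ones forces the coefficients of the relation to sum to 0, hence the
   requirement of more than m n + 1 terms. *)
pose W : 'M[R]_(N, m * n + 1) := \matrix_i row_mx (mxvec (v i)) 1%:M.
have [|a a0 aW] := @row_dependence _ _ _ W; first by rewrite addn1.
have aWE : \sum_i a ord0 i *: row i W = 0 by rewrite -mulmx_sum_row.
have av : \sum_i a ord0 i *: v i = 0.
  apply: (can_inj mxvecK); rewrite linear0 linear_sum; apply/rowP => k; rewrite summxE mxE.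
  have /rowP/(_ (lshift 1 k)) := aWE; rewrite summxE mxE => E; rewrite -[RHS]E.
  by apply: eq_bigr => i _; rewrite linearZ mxE [RHS]mxE rowK row_mxEl.
have asum : \sum_i a ord0 i = 0.
  have /rowP/(_ (rshift (m * n) ord0)) := aWE; rewrite summxE mxE => E; rewrite -[RHS]E.
  by apply: eq_bigr => i _; rewrite [RHS]mxE rowK row_mxEr mxE/= mulr1.
have [k ak] : exists k, 0 < a ord0 k.
  apply: contrapT => /forallNP ha.
  have ha' i : a ord0 i <= 0 by rewrite leNgt; apply/negP; exact: ha.
  have /eqP : - \sum_i a ord0 i = 0 by rewrite asum oppr0.
  rewrite -sumrN psumr_eq0; last by move=> i _; rewrite oppr_ge0.
  move=> /allP hz; move/eqP: a0; apply; apply/rowP => i.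
  by have := hz i (mem_index_enum i); rewrite oppr_eq0 mxE => /eqP.
pose j := [arg min_(j < k | 0 < a ord0 j) c j / a ord0 j]%O.
have [aj jmin] : 0 < a ord0 j /\ forall i, 0 < a ord0 i -> c j / a ord0 j <= c i / a ord0 i.
  by rewrite /j; case: arg_minP.
pose t := c j / a ord0 j.
exists (fun i => c i - t * a ord0 i); split.
- move=> i; rewrite subr_ge0; case: (ltP 0 (a ord0 i)) => hi.
    by rewrite -ler_pdivlMr// jmin.
  by apply: le_trans (c0 i); rewrite mulr_ge0_le0// divr_ge0// ltW.
- by rewrite sumrB -mulr_sumr asum mulr0 subr0.
- under eq_bigr do rewrite scalerBl -scalerA.
  by rewrite sumrB -scaler_sumr av scaler0 subr0.
- by exists j; rewrite /t divfK ?subrr// gt_eqF.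
Qed.

(** * Cholesky factors and the inequality between determinant and trace *)

Definition posdef (R : realType) n (M : 'M[R]_n) :=
  M^T = M /\ forall x : 'rV[R]_n, x != 0 -> 0 < (x *m M *m x^T) ord0 ord0.

(** The triangular shape lets AM-GM compare det M and tr M without eigenvalues: det L is the product
    of the diagonal, while tr (L L^T) is the sum of the squares of all entries. The induction is on
    the Schur complement. *)
Lemma cholesky (R : realType) n (M : 'M[R]_n) : posdef M ->
  exists2 L : 'M[R]_n, is_trig_mx L & M = L *m L^T.
Proof.
elim: n M => [|n IH] M [Ms Mp].
  by exists 0; [exact: mx0_is_trig|apply/matrixP; case].
move: M Ms Mp; rewrite -[n.+1]/(1 + n)%N => M.
rewrite -[M]submxK; set b := ursubmx M; set D := drsubmx M.
rewrite [ulsubmx M]mx11_scalar; set a := ulsubmx M _ _.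
set b' := dlsubmx M.
rewrite tr_block_mx tr_scalar_mx => /eq_block_mx[_ hb' hb hD] Mp.
have quad (s : 'rV[R]_1) (y : 'rV[R]_n) :
    row_mx s y *m block_mx a%:M b b' D *m (row_mx s y)^T =
    (a * s ord0 ord0 ^+ 2 + s ord0 ord0 * (y *m b^T) ord0 ord0 *+ 2)%:M + y *m D *m y^T.
  rewrite tr_row_mx mul_row_block mul_row_col !mulmxDl.
  rewrite [s]mx11_scalar; set r := s _ _; rewrite tr_scalar_mx.
  rewrite !mul_scalar_mx !mul_mx_scalar -!scalemxAl.
  have -> : b *m y^T = ((y *m b^T) ord0 ord0)%:M.
    by rewrite -[b *m y^T]trmxK trmx_mul trmxK [y *m b^T]mx11_scalar tr_scalar_mx !mxE/= mulr1n.
  rewrite -hb {1}(mx11_scalar (y *m b^T)); set q := (y *m b^T) _ _.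
  rewrite !addrA; congr (_ + _).
  by apply/matrixP => i k; rewrite !ord1 !mxE/= mulr1n; ring.
have a_gt0 : 0 < a.
  have := Mp (row_mx 1 0); rewrite quad.
  rewrite !mul0mx addr0 !mxE/= !mulr1n mulr0 mul0rn addr0 expr1n mulr1; apply.
  by apply/eqP => /matrixP/(_ ord0 (lshift n ord0)); rewrite row_mxEl !mxE => /eqP; rewrite oner_eq0.
have [|L Ltrig hL] := IH (D - a^-1 *: (b^T *m b)).
  split; first by rewrite linearB/= linearZ/= trmx_mul trmxK hD.
  move=> y y0.
  pose q := (y *m b^T) ord0 ord0.
  (* This first coordinate minimises the quadratic form for given [y]; the minimum is the form of
     the Schur complement. *)
  have := Mp (row_mx (- (a^-1 * q))%:M y); rewrite quad -/q.
  have -> : y *m (D - a^-1 *: (b^T *m b)) *m y^T = y *m D *m y^T - (a^-1 * q ^+ 2)%:M.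
    rewrite mulmxBr mulmxBl -scalemxAr -scalemxAl; congr (_ - _).
    rewrite mulmxA -(mulmxA (y *m b^T)) -[b *m y^T]trmxK trmx_mul trmxK.
    by rewrite [y *m b^T]mx11_scalar -/q tr_scalar_mx -scalar_mxM scale_scalar_mx.
  move: (y *m D *m y^T) => w; rewrite !mxE/= !mulr1n => hq.
  rewrite (_ : _ - _ = a * (- (a^-1 * q)) ^+ 2 + - (a^-1 * q) * q *+ 2 + w ord0 ord0).
    apply: hq; apply: contraNneq y0 => /(congr1 rsubmx).
    by rewrite row_mxKr linear0 => ->.
  rewrite addrC; congr (_ + _).
  by field; rewrite gt_eqF.
have sa0 : Num.sqrt a != 0 by rewrite gt_eqF// sqrtr_gt0.
exists (block_mx (Num.sqrt a)%:M 0 ((Num.sqrt a)^-1 *: b^T) L).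
  by rewrite is_trig_block_mx// eqxx Ltrig scalar_mx_is_trig.
rewrite tr_block_mx mulmx_block tr_scalar_mx trmx0 !mulmx0 !mul0mx !addr0.
rewrite -scalar_mxM -expr2 sqr_sqrtr ?(ltW a_gt0)// mul_mx_scalar mul_scalar_mx.
rewrite [(_ *: b^T)^T]linearZ/= trmxK !scalerA divff// !scale1r hb -hL.
rewrite -scalemxAl -scalemxAr scalerA -invfM -expr2 sqr_sqrtr ?(ltW a_gt0)//.
by rewrite hb addrC subrK.
Qed.

Lemma mxtrace_mul_tr (R : realType) n (L : 'M[R]_n) :
  \tr (L *m L^T) = \sum_i \sum_j L i j ^+ 2.
Proof.
apply: eq_bigr => i _; rewrite mxE; apply: eq_bigr => j _.
by rewrite mxE expr2.
Qed.

Lemma det_le_mxtrace (R : realType) n (L : 'M[R]_n) : is_trig_mx L ->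
  \det L ^+ 2 <= (\tr (L *m L^T) / n%:R) ^+ n.
Proof.
move=> tL; rewrite det_trig// -prodrXl mxtrace_mul_tr.
have [|+ _] := @leif_AGM R 'I_n predT (fun i => L i i ^+ 2).
  by move=> i _; exact: sqr_ge0.
rewrite card_ord => /le_trans; apply.
apply: lerXn2r; rewrite ?nnegrE ?divr_ge0 ?sumr_ge0//; do ?[by move=> i _; exact: sqr_ge0].
  by move=> i _; apply: sumr_ge0 => j _; exact: sqr_ge0.
rewrite ler_wpM2r ?invr_ge0// ler_sum// => i _.
by rewrite (bigD1 i)//= lerDl sumr_ge0// => j _; exact: sqr_ge0.
Qed.

(** Two inequalities are chained: the diagonal squares sum to at most the trace, and AM-GM. Equality
    in the first kills the off-diagonal entries, in the second it makes the diagonal squares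
    equal. *)
Lemma det_eq_mxtrace (R : realType) n (L : 'M[R]_n) : is_trig_mx L -> (0 < n)%N ->
  \det L ^+ 2 = (\tr (L *m L^T) / n%:R) ^+ n ->
  L *m L^T = (\tr (L *m L^T) / n%:R)%:M.
Proof.
move=> tL n0; rewrite det_trig// -prodrXl mxtrace_mul_tr => hE.
set T := \sum_i \sum_j L i j ^+ 2.
have diag_le : \sum_i L i i ^+ 2 <= T.
  apply: ler_sum => i _.
  by rewrite (bigD1 i)//= lerDl sumr_ge0// => j _; exact: sqr_ge0.
have n0R : 0 < n%:R :> R by rewrite ltr0n.
have D0 : 0 <= \sum_i L i i ^+ 2 by apply: sumr_ge0 => i _; exact: sqr_ge0.
have [|AG AGE] := @leif_AGM R 'I_n predT (fun i => L i i ^+ 2).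
  by move=> i _; exact: sqr_ge0.
rewrite card_ord in AG AGE.
have DT : \sum_i L i i ^+ 2 = T.
  apply/eqP; rewrite eq_le diag_le/= -(@ler_pM2r _ n%:R^-1) ?invr_gt0//.
  rewrite -(@ler_pXn2r _ n)// ?nnegrE ?divr_ge0//; last exact: le_trans diag_le.
  by rewrite -hE.
have /forallP hall : [forall i in predT, forall j in predT, L i i ^+ 2 == L j j ^+ 2].
  by rewrite -AGE; apply/eqP; rewrite [LHS]hE -/T -DT.
have Leq i j : L i i ^+ 2 = L j j ^+ 2.
  by have /implyP/(_ isT)/forallP/(_ j)/implyP/(_ isT)/eqP := hall i.
have off i j : i != j -> L i j = 0.
  move=> ij.
  have : \sum_k (\sum_l L k l ^+ 2 - L k k ^+ 2) == 0 by rewrite sumrB DT subrr.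
  rewrite psumr_eq0; last first.
    by move=> k _; rewrite (bigD1 k)//= addrAC subrr add0r sumr_ge0// => l _; exact: sqr_ge0.
  move=> /allP/(_ i (mem_index_enum i))/=.
  rewrite (bigD1 i)//= addrAC subrr add0r psumr_eq0; last by move=> l _; exact: sqr_ge0.
  move=> /allP/(_ j (mem_index_enum j)); rewrite eq_sym ij/= sqrf_eq0 => /eqP//.
apply/matrixP => i j; rewrite mxE [RHS]mxE (bigD1 i)//= big1 ?addr0; last first.
  by move=> k ki; rewrite off ?mul0r// eq_sym.
rewrite mxE; case: (eqVneq i j) => [->|ij]; last by rewrite (off j i) ?mulr0 ?mulr0n// eq_sym.
rewrite mulr1n -DT -expr2 (eq_bigr (fun=> L j j ^+ 2)); last by move=> k _; exact: Leq.
by rewrite sumr_const card_ord -[_ *+ n]mulr_natr mulfK// gt_eqF.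
Qed.

(** * Maximal determinants over a compact set *)

Lemma continuous_mx_coord (T : topologicalType) m n (i : 'I_m) (j : 'I_n) :
  continuous (fun M : 'M[T]_(m, n) => M i j).
Proof.
move=> M s Ms; exists (fun i' j' => if (i' == i) && (j' == j) then s else setT).
  move=> i' j'; case: ifP => [/andP[/eqP-> /eqP->]//|_]; exact: filterT.
by move=> N /(_ i j); rewrite !eqxx.
Qed.

Lemma continuous_det (R : realType) (T : topologicalType) n (M : T -> 'M[R]_n) :
  (forall i j, continuous (fun x => M x i j)) -> continuous (fun x => \det (M x)).
Proof.
move=> cM; apply: continuous_bigsum => s; apply: continuous_mul; first exact: continuous_const.
by apply: continuous_bigprod => i; exact: cM.
Qed.

Lemma compact_simplex (R : realType) N :
  compact [set c : 'rV[R]_N | (forall i, 0 <= c ord0 i) /\ \sum_i c ord0 i = 1].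
Proof.
have cS : continuous (fun c : 'rV[R]_N => \sum_i c ord0 i).
  by apply: continuous_bigsum => i; exact: coord_continuous.
have -> : [set c : 'rV[R]_N | (forall i, 0 <= c ord0 i) /\ \sum_i c ord0 i = 1] =
    [set c : 'rV[R]_N | forall i, `[0, 1]%classic (c ord0 i)] `&`
    ((fun c : 'rV[R]_N => \sum_i c ord0 i) @^-1` [set x | x = 1]).
  apply/seteqP; split => c /= [c0 c1]; split => // i.
    rewrite in_itv/= c0/= -c1 (bigD1 i)//= lerDl sumr_ge0// => j _; exact: c0.
  by have := c0 i; rewrite in_itv/= => /andP[].
apply: compact_closedI.
  have h : forall i : 'I_N, compact `[0 : R, 1]%classic by move=> _; exact: segment_compact.
  exact: (rV_compact h).
by apply: preimage_closed; [move=> x _; exact: cS|exact: closed_eq].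
Qed.

Lemma det_rank1_update (R : realType) n (M : 'M[R]_n) (x : 'rV[R]_n) (a b : R) :
  M \in unitmx -> a != 0 ->
  \det (a *: M + b *: (x^T *m x)) =
  a ^+ n * \det M * (1 + b / a * (x *m invmx M *m x^T) ord0 ord0).
Proof.
move=> Mu a0.
have -> : a *: M + b *: (x^T *m x) = (a *: M) *m (1%:M + (b / a *: (invmx M *m x^T)) *m x).
  rewrite mulmxDr mulmx1 -!scalemxAl -!scalemxAr; congr (_ + _).
  by rewrite scalerA mulrCA divff// mulr1 !mulmxA mulmxV// mul1mx.
by rewrite det_mulmx detZ det_add_rank1 -scalemxAr mxE !mulmxA.
Qed.

Lemma bernoulli_ge (R : realType) n (t : R) : 0 <= t <= 1 -> 1 - n%:R * t <= (1 - t) ^+ n.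
Proof.
move=> /andP[t0 t1]; elim: n => [|n IH]; first by rewrite mul0r subr0.
rewrite exprS; apply: le_trans (ler_wpM2l _ IH); last by rewrite subr_ge0.
rewrite -natr1; have : 0 <= n%:R :> R by []; nra.
Qed.

(* (1 + t)^-n >= (1 - t)^n >= 1 - n t, then let t tend to 0. *)
Lemma slope_le_of_pow (R : realType) n (q : R) :
  (forall t, 0 <= t -> 1 + t * q <= (1 + t) ^+ n) -> q <= n%:R.
Proof.
move=> hq; rewrite leNgt; apply/negP => nq.
have n0 : 0 <= n%:R :> R by [].
have q0 : 0 < q by exact: le_lt_trans nq.
pose t := (q - n%:R) / (n.+1%:R * q).
have d0 : 0 < n.+1%:R * q by rewrite mulr_gt0.
have t0 : 0 < t by rewrite divr_gt0// subr_gt0.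
have tE : t * (n.+1%:R * q) = q - n%:R by rewrite divfK// gt_eqF.
rewrite -natr1 in tE.
have t1 : t <= 1 by rewrite ler_pdivrMr// mul1r -natr1; nra.
have nt1 : n%:R * t < 1.
  by rewrite -(@ltr_pM2r _ q)// mul1r; nra.
have := @bernoulli_ge R n t; rewrite (ltW t0) t1 => /(_ isT) hb.
have hm : ((1 + t) * (1 - t)) ^+ n <= 1.
  apply: exprn_ile1; first by rewrite mulr_ge0 ?subr_ge0// addr_ge0// ltW.
  by have := sqr_ge0 t; rewrite expr2; nra.
have h1 := hq t (ltW t0).
have : (1 + t * q) * (1 - n%:R * t) <= 1.
  apply: le_trans hm; rewrite exprMn ler_pM// ?subr_ge0 ?(ltW nt1)//.
  by rewrite addr_ge0// mulr_ge0// ltW.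
have : n%:R * q * t < q - n%:R by nra.
nra.
Qed.

Section lowner.
Context {R : realType} {n : nat} (K : set 'rV[R]_n) (e : R).
Hypothesis n_gt0 : (0 < n)%N.
Hypothesis cK : compact K.
Hypothesis e_gt0 : 0 < e.
Hypothesis K0 : K 0.
Hypothesis Ke : forall i, K (e *: delta_mx ord0 i).

(** The first n slots hold the starting configuration; the n^2 + 2 others meet the strict bound of
    [caratheodory_step] for n by n matrices. *)
Let N := (n + (n * n).+2)%N.
Let T : topologicalType := ('rV['rV[R]_n]_N * 'rV[R]_N)%type.
Let F (w : T) : R := \det (frame_mx (fun i => w.1 ord0 i) (fun i => w.2 ord0 i)).
Let S : set T := [set v : 'rV['rV[R]_n]_N | forall i, K (v ord0 i)] `*`
  [set c : 'rV[R]_N | (forall i, 0 <= c ord0 i) /\ \sum_i c ord0 i = 1].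

Let continuous_F : continuous F.
Proof.
apply: continuous_det => i j.
rewrite (_ : (fun w => _) = (fun w : T => \sum_k w.2 ord0 k * (w.1 ord0 k ord0 i * w.1 ord0 k ord0 j))); last first.
  by apply/funext => w; rewrite summxE; apply: eq_bigr => k _; rewrite !mxE big_ord1 !mxE.
have c1 k l : continuous (fun w : T => w.1 ord0 k ord0 l).
  move=> w; apply: (@continuous_comp _ _ _ (fun w : T => w.1 ord0 k) (fun v : 'rV[R]_n => v ord0 l)).
    apply: (@continuous_comp _ _ _ (fun w : T => w.1) (fun v => v ord0 k)); first exact: cvg_fst.
    exact: continuous_mx_coord.
  exact: continuous_mx_coord.
apply: continuous_bigsum => k; apply: continuous_mul; last by apply: continuous_mul; exact: c1.
move=> w; apply: (@continuous_comp _ _ _ (fun w : T => w.2) (fun v => v ord0 k)); first exact: cvg_snd.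
exact: continuous_mx_coord.
Qed.

(** The points e e_k with weights 1/n give the matrix (e^2/n) I, whose positive determinant makes
    the maximiser invertible. The spare slots hold 0 with weight 0. *)
Let start : exists2 w, S w & 0 < F w.
Proof.
pose u0 : 'rV['rV[R]_n]_N := \row_i (if fintype.split i is inl k then e *: delta_mx ord0 k else 0).
pose c0 : 'rV[R]_N := \row_i (if fintype.split i is inl k then n%:R^-1 else 0).
have nR : 0 < n%:R :> R by rewrite ltr0n.
exists (u0, c0).
  split => /=.
    by move=> i; rewrite mxE; case: fintype.split.
  split; first by move=> i; rewrite mxE; case: fintype.split => // k; rewrite invr_ge0.
  rewrite big_split_ord/= [X in _ + X]big1 ?addr0; last first.
    by move=> i _; rewrite mxE -[rshift _ _]/(unsplit (inr i)) unsplitK.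
  rewrite (eq_bigr (fun=> n%:R^-1)); last first.
    by move=> i _; rewrite mxE -[lshift _ _]/(unsplit (inl i)) unsplitK.
  by rewrite sumr_const card_ord -[_ *+ n]mulr_natr mulVf// gt_eqF.
rewrite /F/= (_ : frame_mx _ _ = (e ^+ 2 / n%:R)%:M); last first.
  rewrite /frame_mx big_split_ord/= [X in _ + X]big1 ?addr0; last first.
    by move=> i _; rewrite [c0 _ _]mxE -[rshift _ _]/(unsplit (inr i)) unsplitK scale0r.
  rewrite (eq_bigr (fun i => (e ^+ 2 / n%:R) *: delta_mx i i)); last first.
    move=> i _; rewrite [c0 _ _]mxE [u0 _ _]mxE -[lshift _ _]/(unsplit (inl i)) unsplitK.
    rewrite [(e *: _)^T]linearZ/= -scalemxAl -scalemxAr !scalerA trmx_delta mul_delta_mx.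
    by congr (_ *: _); rewrite expr2; ring.
  by rewrite -scaler_sumr -mx1_sum_delta scale_scalar_mx mulr1.
by rewrite det_scalar exprn_gt0// divr_gt0// exprn_gt0.
Qed.

(* A maximiser of the determinant can be rewritten with one weight zero, which
   frees a slot for mixing in an arbitrary point [x] of [K]. *)
Lemma lowner : exists m (u : 'I_m -> 'rV[R]_n) (c : 'I_m -> R),
  [/\ forall i, K (u i), forall i, 0 <= c i, \sum_i c i = 1,
    0 < \det (frame_mx u c) &
    forall x, K x -> (x *m invmx (frame_mx u c) *m x^T) ord0 ord0 <= n%:R].
Proof.
have [w0 Sw0 Fw0] := start.
have cS : compact S.
  apply: compact_setX; last exact: compact_simplex.
  exact: (@rV_compact _ N (fun=> K)).
have [||w wS wmax] := @compact_EVT_max _ _ F S _ cS.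
- by exists w0.
- by apply: continuous_subspaceT; exact: continuous_F.
have [/= uK [c0 c1]] := set_mem wS.
pose u i : 'rV[R]_n := w.1 ord0 i; pose c i : R := w.2 ord0 i.
have FM : F w = \det (frame_mx u c) by [].
have M0 : 0 < \det (frame_mx u c).
  by rewrite -FM; apply: lt_le_trans Fw0 _; apply: wmax; rewrite inE.
exists N, u, c; split => // x Kx.
(* The competitor gives x the weight t/(1+t) and scales the others by 1/(1+t); maximality then reads
   1 + t q <= (1+t)^n with q = x M^-1 x^T. *)
apply: slope_le_of_pow => t t0.
have Mu : frame_mx u c \in unitmx by rewrite unitmxE unitfE gt_eqF.
have [|c' [c'0 c'1 c'M [j c'j]]] := @caratheodory_step R N n n (fun i => (u i)^T *m u i) c _ c0.
  exact: leq_addl.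
pose a := (1 + t)^-1.
have t10 : 0 < 1 + t by rewrite ltr_pwDl.
have a0 : 0 < a by rewrite invr_gt0.
pose w' : T := (\row_i (if i == j then x else u i), \row_i (if i == j then t * a else a * c' i)).
have Sw' : S w'.
  split => /=; first by move=> i; rewrite mxE; case: ifP => // _; exact: uK.
  split; first by move=> i; rewrite mxE; case: ifP => _; rewrite mulr_ge0// ltW.
  rewrite (bigD1 j)//= mxE eqxx (eq_bigr (fun i => a * c' i)); last first.
    by move=> i /negPf ij; rewrite mxE ij.
  have : \sum_i c' i = 1 by rewrite c'1.
  rewrite (bigD1 j)//= c'j add0r -mulr_sumr => ->; rewrite mulr1.
  by rewrite -[X in _ + X]mul1r -mulrDl addrC divff// gt_eqF.
have := wmax w'; rewrite inE => /(_ Sw').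
rewrite {1}/F (_ : frame_mx (fun i => w'.1 ord0 i) _ = a *: frame_mx u c + (t * a) *: (x^T *m x)); last first.
  rewrite /frame_mx (bigD1 j)//= !mxE eqxx addrC; congr (_ + _).
  rewrite -c'M [in RHS](bigD1 j)//= c'j scale0r add0r scaler_sumr; apply: eq_bigr => i /negPf ij.
  by rewrite !mxE ij scalerA.
rewrite det_rank1_update// ?gt_eqF// FM mulfK ?gt_eqF// => h.
have an0 : 0 < a ^+ n by rewrite exprn_gt0.
rewrite -(ler_pM2l an0) -(ler_pM2l M0) -[in leRHS]exprMn mulVf ?gt_eqF// expr1n mulr1.
by rewrite mulrA [_ * a ^+ n]mulrC.
Qed.

End lowner.

(** * Diameters, linear images and crosspolytopes *)

Section euclidean_diameter.
Context {R : realType} {n : nat}.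
Implicit Types (x y : 'rV[R]_n) (K : set 'rV[R]_n).

Lemma enorm_sqr x : enorm x ^+ 2 = dotp x x.
Proof. by rewrite sqr_sqrtr// dotp_ge0. Qed.

Lemma enorm_le x r : 0 <= r -> (enorm x <= r) = (dotp x x <= r ^+ 2).
Proof. by move=> r0; rewrite -enorm_sqr ler_sqr// nnegrE ?sqrtr_ge0. Qed.

Lemma dotp_parallelogram x y :
  dotp (x - y) (x - y) + dotp (x + y) (x + y) = (dotp x x + dotp y y) *+ 2.
Proof.
rewrite !dotpDl !(dotpC _ (_ + _)) !dotpDl !dotpNl !dotpNr (dotpC y x).
by rewrite -mulr_natl; ring.
Qed.

(** By the parallelogram law |x-y|^2 <= 2 (|x|^2 + |y|^2) <= 4 |x0|^2, with equality for x0 and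
    -x0. *)
Lemma diameter_symmetric K x0 : (forall x, K x -> K (- x)) -> K x0 ->
  (forall x, K x -> dotp x x <= dotp x0 x0) -> diameter K = 2 * enorm x0.
Proof.
move=> symK K0 maxK.
have r0 : 0 <= 2 * enorm x0 by rewrite mulr_ge0// sqrtr_ge0.
have ub : ubound [set enorm (x - y) | x in K & y in K] (2 * enorm x0).
  move=> _ [x Kx [y Ky <-]]; rewrite enorm_le// exprMn enorm_sqr.
  have := dotp_parallelogram x y; have := dotp_ge0 (x + y).
  by have := maxK _ Kx; have := maxK _ Ky; rewrite -mulr_natl; lra.
have mem : [set enorm (x - y) | x in K & y in K] (2 * enorm x0).
  exists x0 => //; exists (- x0); first exact: symK.
  rewrite opprK -mulr2n -scaler_nat /enorm dotpZl dotpZr mulrA -expr2 sqrtrM ?sqr_ge0//.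
  by rewrite sqrtr_sqr ger0_norm.
apply/eqP; rewrite eq_le; apply/andP; split.
  by apply: sup_le_ub => //; exists (2 * enorm x0).
by apply: ub_le_sup => //; exists (2 * enorm x0).
Qed.

Lemma compact_farthest K : compact K -> K !=set0 ->
  exists2 x0, K x0 & forall x, K x -> dotp x x <= dotp x0 x0.
Proof.
move=> cK K0; have cd : continuous (fun x => dotp x x).
  by apply: continuous_bigsum => i; apply: continuous_mul; exact: coord_continuous.
have [|x0 /set_mem Kx0 h] := @compact_EVT_max _ _ (fun x => dotp x x) K K0 cK.
  exact: continuous_subspaceT.
by exists x0 => // x Kx; apply: h; rewrite inE.
Qed.

End euclidean_diameter.

Lemma continuous_mx (R : realType) (T : topologicalType) m n (f : T -> 'M[R]_(m, n)) :
  (forall i j, continuous (fun x => f x i j)) -> continuous f.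
Proof.
move=> cf x s [P nP sP]; apply: (@filterS _ (nbhs x) _ (fun y => forall i j, P i j (f y i j))).
  by move=> y hy; apply: sP.
apply: filter_forall => i; apply: filter_forall => j.
by apply: cf; exact: nP.
Qed.

Section linear_images.
Context {R : realType} {n : nat}.
Implicit Types (A : 'M[R]_n) (K : set 'rV[R]_n).

Lemma compact_linear_image A K : compact K -> compact (linear_image A K).
Proof.
move=> cK; apply: continuous_compact => //; apply: continuous_subspaceT.
apply: continuous_mx => i j.
under eq_fun do rewrite mxE.
apply: continuous_bigsum => k; apply: continuous_mul; last exact: continuous_const.
exact: coord_continuous.
Qed.

Lemma linear_imageE A K : A \in unitmx -> linear_image A K = [set x | K (x *m invmx A)].
Proof.
move=> Au; apply/seteqP; split => x /=.
  by move=> [y Ky <-]; rewrite mulmxK.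
by move=> Kx; exists (x *m invmx A) => //; rewrite mulmxKV.
Qed.

Lemma lebn_linear_image A K : A \in unitmx -> measurable K ->
  lebn R n (linear_image A K) = (`|\det A|%:E * lebn R n K)%E.
Proof.
move=> Au mK; rewrite linear_imageE//.
have := @lebn_affine R n (invmx A) _ 0 K mK; rewrite unitmx_inv => /(_ Au).
rewrite det_inv normfV invrK => <-; congr (lebn _ _ _).
by apply/seteqP; split => x /=; rewrite addr0.
Qed.

Lemma scale_linear_image (r : R) K : [set r *: x | x in K] = linear_image r%:M K.
Proof. by apply/seteqP; split => _ [x Kx <-]; exists x => //; rewrite mul_mx_scalar. Qed.

End linear_images.

Section symmetric_convex.
Context {R : realType} {n : nat}.
Implicit Types K : set 'rV[R]_n.

Lemma convex_setP K : convex_set K <-> forall x y t, K x -> K y -> 0 <= t <= 1 -> K (t *: x + (1 - t) *: y).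
Proof.
split => [cK x y t Kx Ky /andP[t0 t1]|cK x y t /set_mem Kx /set_mem Ky].
  by have := cK x y (Itv01 t0 t1) (mem_set Kx) (mem_set Ky); rewrite inE.
by apply/mem_set; apply: cK => //; rewrite ge0 le1.
Qed.

Lemma convex_star K x t : convex_set K -> K 0 -> K x -> 0 <= t <= 1 -> K (t *: x).
Proof. by move=> /convex_setP cK K0 Kx ht; have := cK x 0 t Kx K0 ht; rewrite scaler0 addr0. Qed.

Lemma convex_comb K I (r : seq I) (v : I -> 'rV[R]_n) (a : I -> R) :
  convex_set K -> K 0 -> (forall i, K (v i)) -> (forall i, K (- v i)) ->
  \sum_(i <- r) `|a i| <= 1 -> K (\sum_(i <- r) a i *: v i).
Proof.
move=> cK K0 Kv Kv' a1.
(* This factored form puts no bound on the coefficients, so it passes through the induction; the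
   bound enters once, at the end. *)
have [k Kk ->] : exists2 k, K k & \sum_(i <- r) a i *: v i = (\sum_(i <- r) `|a i|) *: k.
  elim: r {a1} => [|i r [k Kk IH]]; first by exists 0 => //; rewrite !big_nil scaler0.
  rewrite !big_cons IH; set S := \sum_(j <- r) _.
  have S0 : 0 <= S by exact: sumr_ge0.
  have [w Kw ->] : exists2 w, K w & a i *: v i = `|a i| *: w.
    case: (leP 0 (a i)) => h; first by exists (v i) => //; rewrite ger0_norm.
    by exists (- v i) => //; rewrite ltr0_norm// scalerN scaleNr opprK.
  have [|D0] := eqVneq (`|a i| + S) 0.
    move=> /eqP; rewrite paddr_eq0// => /andP[/eqP-> /eqP->].
    by exists 0 => //; rewrite !scale0r !addr0 scaler0.
  exists ((`|a i| / (`|a i| + S)) *: w + (1 - `|a i| / (`|a i| + S)) *: k).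
    have D1 : 0 < `|a i| + S by rewrite lt0r D0 addr_ge0.
    apply: (convex_setP K).1 => //; rewrite divr_ge0 ?(ltW D1)//=.
    by rewrite ler_pdivrMr// mul1r lerDl.
  rewrite scalerDr !scalerA mulrBr mulr1 mulrCA divff// mulr1.
  by rewrite addrAC subrr add0r.
by apply: convex_star => //; rewrite a1 sumr_ge0.
Qed.

Lemma o_symmetricN K x : o_symmetric K -> K x -> K (- x).
Proof. by move=> hK Kx; rewrite hK; exists x. Qed.

(** Any y is the midpoint of x0 + 2 y and -x0, so a ball about an interior point x0 yields one of
    half the radius about 0. *)
Lemma convex_body_ball K : convex_set K -> o_symmetric K -> K° !=set0 ->
  exists2 e : R, 0 < e & forall y : 'rV[R]_n, (forall i, `|y ord0 i| < e) -> K y.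
Proof.
move=> /convex_setP cK sK [x0 /nbhs_ballP[d/= d0 hd]].
exists (d / 2); first by rewrite divr_gt0.
move=> y hy.
have h1 : K (x0 + 2 *: y).
  apply: hd; apply: ball_rVP => // i.
  rewrite !mxE opprD addrA subrr sub0r normrN normrM ger0_norm// mulrC -ltr_pdivlMr//.
have h0 : K (- x0) by apply: o_symmetricN => //; apply: hd; exact: ballxx.
have := cK _ _ 2^-1 h1 h0; rewrite invr_ge0 ler0n invf_le1// ler1n => /(_ isT).
rewrite (_ : 1 - 2^-1 = 2^-1); last by field.
by rewrite scalerDr scalerA mulVf// scale1r scalerN addrAC subrr add0r.
Qed.

End symmetric_convex.

Section crosspolytope.
Context {R : realType} {n : nat} (u : 'I_n -> 'rV[R]_n).
Hypothesis u_on : forall i j, dotp (u i) (u j) = (i == j)%:R.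

(** As an l1 ball in the coordinates <x, u i> its closedness and volume are visible;
    [conv_hull_crosspolytope] returns to the hull of the vertices. *)
Definition crosspolytope : set 'rV[R]_n := [set x | \sum_i `|dotp x (u i)| <= 1].

Let U : 'M[R]_n := \matrix_i u i.

Let mulUt (x : 'rV[R]_n) i : (x *m U^T) ord0 i = dotp x (u i).
Proof. by rewrite mxE; apply: eq_bigr => k _; rewrite !mxE. Qed.

Let UUt : U *m U^T = 1%:M.
Proof. by apply/row_matrixP => i; rewrite row_mul rowK; apply/rowP => j; rewrite mulUt u_on !mxE. Qed.

Let UtU : U^T *m U = 1%:M.
Proof. exact: mulmx1C. Qed.

Lemma orthonormal_expansion x : x = \sum_i dotp x (u i) *: u i.
Proof.
rewrite -[LHS]mulmx1 -UtU mulmxA mulmx_sum_row; apply: eq_bigr => i _.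
by rewrite mulUt rowK.
Qed.

Lemma orthonormal_parseval x : dotp x x = \sum_i dotp x (u i) ^+ 2.
Proof.
rewrite [X in dotp X _ = _](orthonormal_expansion x) dotp_suml; apply: eq_bigr => i _.
by rewrite dotpZl dotpC expr2.
Qed.

Lemma orthonormal_basis_of : basis_of {: 'rV[R]_n} [tuple u i | i < n].
Proof.
rewrite basisEfree subvf dimvf dim_matrix size_tuple mul1r leqnn !andbT.
apply/freeP => k hk i.
have E (j : 'I_n) : [tuple u i | i < n]`_j = u j by rewrite -tnth_nth tnth_mktuple.
have := congr1 (fun x => dotp x (u i)) hk.
rewrite dotp_suml (bigD1 i)// big1 => [|j ji]; last by rewrite E dotpZl u_on (negPf ji) mulr0.
by rewrite [LHS]addr0 E dotpZl u_on eqxx mulr1 => ->; rewrite /dotp big1// => j _; rewrite mxE mul0r.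
Qed.

Lemma lebn_crosspolytope : lebn R n crosspolytope = (2 ^+ n / n`!%:R)%:E.
Proof.
have -> : crosspolytope = [set x | l1_ball (x *m U^T + 0)].
  have E x : \sum_i `|(x *m U^T + 0) ord0 i| = \sum_i `|dotp x (u i)|.
    by apply: eq_bigr => i _; rewrite addr0 mulUt.
  by apply/seteqP; split => x; rewrite /crosspolytope /l1_ball /mkset E.
rewrite lebn_affine ?unitmx_tr; last first.
- exact: measurable_l1_ball.
- by have [] := mulmx1_unit UUt.
rewrite lebn_l1_ball det_tr.
have : `|\det U| ^+ 2 = 1.
  by rewrite -normrX expr2 -{2}det_tr -det_mulmx UUt det1 normr1.
by move=> /eqP; rewrite sqrf_eq1 => /orP[/eqP->|/eqP h]; [rewrite invr1 mul1e|have := normr_ge0 (\det U); rewrite h ler0N1].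
Qed.

Lemma convex_crosspolytope : convex_set crosspolytope.
Proof.
apply/convex_setP => x y t hx hy /andP[t0 t1]; rewrite /crosspolytope/=.
apply: (@le_trans _ _ (\sum_i (t * `|dotp x (u i)| + (1 - t) * `|dotp y (u i)|))).
  apply: ler_sum => i _; rewrite dotpDl !dotpZl (le_trans (ler_normD _ _))//.
  by rewrite !normrM (ger0_norm t0) [`|1 - t|]ger0_norm ?subr_ge0.
rewrite big_split/= -!mulr_sumr; rewrite /crosspolytope/= in hx hy; nra.
Qed.

Lemma crosspolytopeN x : crosspolytope x -> crosspolytope (- x).
Proof. by rewrite /crosspolytope/=; under [in X in _ -> X]eq_bigr do rewrite dotpNl normrN. Qed.

Lemma crosspolytope_vertex i : crosspolytope (u i).
Proof.
rewrite /crosspolytope/= (bigD1 i)//= u_on eqxx big1 ?addr0 ?normr1// => j ji.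
by rewrite u_on eq_sym (negPf ji) normr0.
Qed.

Lemma conv_hull_crosspolytope : (0 < n)%N ->
  conv_hull (range u `|` range (fun i => - u i)) = crosspolytope.
Proof.
move=> n0; apply/seteqP; split.
  apply: smallest_sub; first exact: convex_crosspolytope.
  by move=> _ [[i _ <-]|[i _ <-]]; [|apply: crosspolytopeN]; exact: crosspolytope_vertex.
move=> x hx C [cC sC]; rewrite (orthonormal_expansion x).
have Cu i : C (u i) by apply: sC; left; exists i.
have CNu i : C (- u i) by apply: sC; right; exists i.
apply: convex_comb => //.
(* 0 is the midpoint of two opposite vertices, which exist as n > 0; for n = 0 the hull is empty. *)
have := (convex_setP C).1 cC _ _ 2^-1 (Cu (Ordinal n0)) (CNu (Ordinal n0)).
rewrite invr_ge0 ler0n invf_le1// ler1n => /(_ isT).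
by rewrite (_ : 1 - 2^-1 = 2^-1) ?scalerN ?subrr//; field.
Qed.

Lemma crosspolytope_dotp_le1 x : crosspolytope x -> dotp x x <= 1.
Proof.
rewrite /crosspolytope/= orthonormal_parseval => hx.
have h i : `|dotp x (u i)| <= 1.
  by apply: le_trans hx; rewrite (bigD1 i)//= lerDl sumr_ge0.
apply: le_trans hx; apply: ler_sum => i _.
by rewrite -real_normK ?num_real// expr2 ler_piMl.
Qed.

Lemma closed_crosspolytope : closed crosspolytope.
Proof.
have -> : crosspolytope = (fun x => \sum_i `|dotp x (u i)|) @^-1` [set y | y <= 1] by [].
apply: preimage_closed; last exact: closed_le.
move=> x _; apply: continuous_bigsum => i; apply: continuous_after; first exact: norm_continuous.
exact: continuous_dotp.
Qed.

End crosspolytope.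

(** * Bodies in Behrend position *)

Lemma trace_frame_mx (R : realType) m n (u : 'I_m -> 'rV[R]_n) (c : 'I_m -> R) :
  \tr (frame_mx u c) = \sum_i c i * dotp (u i) (u i).
Proof.
rewrite /frame_mx linear_sum/=; apply: eq_bigr => i _.
by rewrite linearZ/= mxtrace_mulC dotpE /mxtrace big_ord1.
Qed.

(** If the form vanishes at x, every term c_i <x,u_i>^2 is 0, hence x M = 0, and invertibility gives
    x = 0. *)
Lemma posdef_frame_mx (R : realType) m n (u : 'I_m -> 'rV[R]_n) (c : 'I_m -> R) :
  (forall i, 0 <= c i) -> frame_mx u c \in unitmx -> posdef (frame_mx u c).
Proof.
move=> c0 Mu; have quad x : (x *m frame_mx u c *m x^T) ord0 ord0 = \sum_i c i * dotp x (u i) ^+ 2.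
  rewrite -dotpE mul_frame_mx dotp_suml; apply: eq_bigr => i _.
  by rewrite dotpZl dotpC expr2 mulrA [dotp (u i) x]dotpC.
split.
  rewrite /frame_mx linear_sum/=; apply: eq_bigr => i _.
  by rewrite linearZ/= trmx_mul trmxK.
move=> x x0; rewrite quad lt0r sumr_ge0 ?andbT; last by move=> i _; rewrite mulr_ge0// sqr_ge0.
rewrite psumr_eq0; last by move=> i _; rewrite mulr_ge0// sqr_ge0.
apply: contraNN x0 => /allP h; rewrite -[x](mulmxK Mu) mul_frame_mx big1 ?mul0mx// => i _.
have := h i (mem_index_enum i); rewrite /= mulf_eq0 sqrf_eq0 => /orP[]/eqP ->.
  by rewrite mul0r scale0r.
by rewrite mulr0 scale0r.
Qed.

(* A point of [K] outside [C], contracted slightly, is interior to [K] and still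
   outside [C], so it brings positive measure. *)
Lemma sub_closed_full_measure (R : realType) n (K C : set 'rV[R]_n) (e : R) :
  convex_set K -> 0 < e -> (forall y : 'rV[R]_n, (forall i, `|y ord0 i| < e) -> K y) ->
  measurable K -> closed C -> C `<=` K -> (lebn R n K < +oo)%E ->
  lebn R n K = lebn R n C -> K `<=` C.
Proof.
move=> /convex_setP cK e0 Ke mK clC CK Kfin KC x Kx; apply: contrapT => nCx.
have oC : open (~` C) by exact: closed_openC.
have /nbhs_ballP[d/= d0 hd] : nbhs x (~` C) by exact: open_nbhs_nbhs.
pose D := d + 1 + \sum_i `|x ord0 i|.
have S0 : 0 <= \sum_i `|x ord0 i| by exact: sumr_ge0.
have D0 : 0 < D by rewrite /D; lra.
pose t := d / D.
have t0 : 0 < t by rewrite divr_gt0.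
have t1 : t <= 1 by rewrite ler_pdivrMr// mul1r /D; lra.
have Uy : (K° `&` ~` C) ((1 - t) *: x).
  split.
    apply/nbhs_ballP; exists (t * e); first by rewrite /= mulr_gt0.
    move=> z [_ hz]; have -> : z = t *: (t^-1 *: (z - (1 - t) *: x)) + (1 - t) *: x.
      by rewrite scalerA divff ?gt_eqF// scale1r subrK.
    apply: cK => //; last by rewrite (ltW t0) t1.
    apply: Ke => i; have := hz ord0 i; rewrite !mxE /ball/= distrC => hi.
    by rewrite normrM gtr0_norm ?invr_gt0// mulrC ltr_pdivrMr// [e * t]mulrC.
  apply: hd; apply: ball_rVP => // i.
  rewrite !mxE mulrBl mul1r opprB addrCA subrr addr0 normrM gtr0_norm// /t mulrAC ltr_pdivrMr//.
  rewrite ltr_pM2l//; apply: (@le_lt_trans _ _ (\sum_i `|x ord0 i|)); last by rewrite /D; lra.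
  by rewrite (bigD1 i)//= lerDl sumr_ge0.
have oU : open (K° `&` ~` C) by apply: openI => //; exact: open_interior.
have := lebn_open_gt0 oU; move=> /(_ (ex_intro _ _ Uy)); rewrite ltNge => /negP; apply.
have mC : measurable C by exact: closed_measurable_rV.
apply: (@le_trans _ _ (lebn R n (K `\` C))).
  apply: le_measure; rewrite ?inE; [exact: open_measurable_rV|exact: measurableD|].
  by move=> z [/interior_subset Kz Cz].
rewrite measureD// (_ : K `&` C = C); last by apply/seteqP; split => [z []|z Cz]//; split => //; exact: CK.
suff: (lebn R n K - lebn R n C <= 0)%E by [].
by rewrite KC subee// -KC ge0_fin_numE.
Qed.

Lemma scalar_unitmx (F : fieldType) n (r : F) : r != 0 -> (r%:M : 'M[F]_n) \in unitmx.
Proof. by move=> r0; rewrite unitmxE det_scalar unitrX// unitfE. Qed.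

Lemma idq_regular_crosspolytope (R : realType) n (K : set 'rV[R]_n) : (0 < n)%N ->
  regular_crosspolytope K -> idq K = 1 / n`!%:R.
Proof.
move=> n0 [rho [u [rho0 [_ u_on] ->]]].
rewrite conv_hull_crosspolytope// /idq volumeE scale_linear_image.
have ru : (rho%:M : 'M[R]_n) \in unitmx by rewrite scalar_unitmx// gt_eqF.
rewrite lebn_linear_image//; last by apply: closed_measurable_rV; exact: closed_crosspolytope.
rewrite lebn_crosspolytope// det_scalar ger0_norm ?exprn_ge0 ?(ltW rho0)// -EFinM/=.
rewrite -scale_linear_image (@diameter_symmetric _ _ _ (rho *: u (Ordinal n0))); first last.
- move=> _ [x Cx <-]; rewrite !dotpZl !dotpZr u_on eqxx mulr1 mulrA.
  by rewrite ler_piMr ?mulr_ge0 ?(ltW rho0)// (crosspolytope_dotp_le1 u_on Cx).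
- by exists (u (Ordinal n0)) => //; exact: crosspolytope_vertex.
- by move=> _ [x Cx <-]; exists (- x); rewrite ?scalerN//; exact: crosspolytopeN.
rewrite /enorm dotpZl dotpZr u_on eqxx mulr1 -expr2 sqrtr_sqr ger0_norm ?(ltW rho0)//.
have f0 : n`!%:R != 0 :> R by rewrite pnatr_eq0 -lt0n fact_gt0.
have r0 : rho ^+ n != 0 by rewrite expf_neq0// gt_eqF.
have p0 : (2 : R) ^+ n != 0 by rewrite expf_neq0.
rewrite exprMn; move: (2 ^+ n) (rho ^+ n) (n`!%:R) f0 r0 p0 => p r f f0 r0 p0.
by field; rewrite f0 r0 p0.
Qed.

Section behrend.
Context {R : realType} {n : nat} (K : set 'rV[R]_n).
Hypothesis n_gt0 : (0 < n)%N.
Hypothesis K_body : convex_body K.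
Hypothesis K_sym : o_symmetric K.

Let cK : compact K. Proof. by case: K_body. Qed.
Let vK : convex_set K. Proof. by case: K_body. Qed.
Let iK : K° !=set0. Proof. by case: K_body. Qed.
Let mK : measurable K := compact_measurable_rV cK.
Let Kfin : (lebn R n K < +oo)%E := lebn_compact_lty cK.
Let NK x : K x -> K (- x) := @o_symmetricN R n K x K_sym.

Let V := fine (lebn R n K).

Let lebnKE : lebn R n K = V%:E.
Proof. by rewrite fineK// ge0_fin_numE. Qed.

Let V_gt0 : 0 < V.
Proof.
rewrite -lte_fin -lebnKE; apply: (@lt_le_trans _ _ (lebn R n K°)).
  by apply: lebn_open_gt0 => //; exact: open_interior.
by apply: le_measure; rewrite ?inE//; [apply: open_measurable_rV; exact: open_interior|exact: interior_subset].
Qed.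

Variable x0 : 'rV[R]_n.
Hypothesis Kx0 : K x0.
Hypothesis x0_max : forall x, K x -> dotp x x <= dotp x0 x0.
Let rho := enorm x0.

Let K0 : K 0.
Proof. by have [e e0 h] := convex_body_ball vK K_sym iK; apply: h => i; rewrite mxE normr0. Qed.

Let axes : exists2 e : R, 0 < e & forall i, K (e *: delta_mx ord0 i).
Proof.
have [e e0 h] := convex_body_ball vK K_sym iK.
exists (e / 2) => [|i]; first by rewrite divr_gt0.
apply: h => j; rewrite !mxE eqxx/=; case: eqP => _ /=; rewrite ?mulr0 ?normr0// mulr1.
by rewrite ger0_norm ?divr_ge0 ?(ltW e0)// ltr_pdivrMr// ltr_pMr// ltr1n.
Qed.

Let rho_gt0 : 0 < rho.
Proof.
have [e e0 Ke] := axes.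
rewrite sqrtr_gt0; apply: lt_le_trans (x0_max (Ke (Ordinal n_gt0))).
rewrite lt0r dotp_ge0 andbT dotp_eq0; apply/eqP => /rowP/(_ (Ordinal n_gt0)).
by rewrite !mxE !eqxx/= mulr1 => /eqP; rewrite gt_eqF.
Qed.

Let idqE : idq K = V / (2 * rho) ^+ n.
Proof. by rewrite /idq volumeE (diameter_symmetric _ Kx0). Qed.

(** The diameters of K and of its image are 2 rho and 2 |y0|, and the volumes differ by the factor
    |det A|; maximality of [idq K] simplifies to this inequality. *)
Lemma behrend_image A y0 : behrend_position K -> A \in unitmx ->
  linear_image A K y0 -> (forall y, linear_image A K y -> dotp y y <= dotp y0 y0) ->
  `|\det A| * rho ^+ n <= enorm y0 ^+ n.
Proof.
move=> [_ bK] Au Ay0 y0_max.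
(* y0 = 0 would give x0 A = 0, hence rho = 0. *)
have [y00|y0_neq0] := eqVneq (enorm y0) 0.
  have [x Kx xA] := Ay0.
  have : x0 *m A = 0.
    apply/eqP; rewrite -dotp_eq0 eq_le dotp_ge0 andbT.
    have := y0_max (x0 *m A); rewrite -[dotp y0 y0]enorm_sqr y00 expr0n/=; apply.
    by exists x0.
  move=> /(congr1 (mulmx^~ (invmx A))); rewrite mulmxK// mul0mx => x00.
  by have := rho_gt0; rewrite /rho /enorm x00 (_ : dotp 0 0 = 0) ?sqrtr0 ?ltxx//; apply/eqP; rewrite dotp_eq0.
have y0_gt0 : 0 < enorm y0 by rewrite lt0r y0_neq0 sqrtr_ge0.
have : idq (linear_image A K) <= idq K by apply: bK; exists A.
rewrite idqE.
rewrite /idq volumeE lebn_linear_image// lebnKE -EFinM/= (diameter_symmetric _ Ay0)//; last first.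
  by move=> _ [x Kx <-]; exists (- x); rewrite ?mulNmx//; exact: NK.
rewrite !exprMn ler_pdivrMr ?mulr_gt0 ?exprn_gt0// mulrAC ler_pdivlMr ?mulr_gt0 ?exprn_gt0//.
have P : 0 < (2 : R) ^+ n by rewrite exprn_gt0.
have := V_gt0; move: (V) (2 ^+ n) P (`|_|) => v p p0 a v0 h.
rewrite -(ler_pM2l p0) -(ler_pM2l v0).
by apply: le_trans (le_trans _ h) _; rewrite le_eqVlt; apply/orP; left; apply/eqP; ring.
Qed.

Lemma behrend_contact : behrend_position K ->
  exists m (v : 'I_m -> 'rV[R]_n) (d : 'I_m -> R),
  [/\ forall i, K (rho *: v i), forall i, dotp (v i) (v i) = 1,
    forall i, 0 <= d i & frame_mx v d = 1%:M].
Proof.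
move=> bK; have [e e0 Ke] := axes.
have [m [u [c [Ku c0 c1 M0 Mle]]]] := lowner n_gt0 cK e0 K0 Ke.
set M := frame_mx u c in M0 Mle.
have Mu : M \in unitmx by rewrite unitmxE unitfE gt_eqF.
have [L trigL ML] := cholesky (posdef_frame_mx c0 Mu).
have detM : \det M = \det L ^+ 2 by rewrite /M ML det_mulmx det_tr expr2.
have Lu : L \in unitmx.
  by rewrite unitmxE unitfE; apply: contraTneq M0 => L0; rewrite detM L0 expr0n ltxx.
have LTu : L^T \in unitmx by rewrite unitmx_tr.
(* Vectors are rows, hence the transpose: |x A|^2 = x (L L^T)^-1 x^T = x M^-1 x^T. *)
pose A : 'M[R]_n := invmx L^T.
have Au : A \in unitmx by rewrite unitmx_inv.
have [y0 Ay0 y0_max] := compact_farthest (@compact_linear_image R n A K cK) (ex_intro _ _ (imageP (fun x => x *m A) K0)).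
have nR : 0 < n%:R :> R by rewrite ltr0n.
have y0n : dotp y0 y0 <= n%:R.
  have [x Kx <-] := Ay0; apply: le_trans (Mle _ Kx).
  rewrite dotpE trmx_mul /A -trmx_inv trmxK trmx_inv mulmxA -(mulmxA x).
  have -> : invmx L^T *m invmx L = invmx M; last by [].
  apply: (can_inj (mulKmx Mu)); rewrite mulmxV// /M ML mulmxA -(mulmxA L) mulmxV//.
  by rewrite mulmx1 mulmxV.
have rho2 : rho ^+ 2 = dotp x0 x0 by exact: enorm_sqr.
(* The square of [behrend_image], with |det A|^2 = 1/det M and |y0|^2 <= n. *)
have h1 : (rho ^+ 2) ^+ n <= \det M * n%:R ^+ n.
  have := behrend_image bK Au Ay0 y0_max; rewrite det_inv det_tr normfV.
  rewrite mulrC ler_pdivrMr ?normr_gt0; last by rewrite -unitfE -unitmxE.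
  move=> h; rewrite exprAC (le_trans (lerXn2r 2 _ _ h))// ?nnegrE ?mulr_ge0 ?exprn_ge0 ?sqrtr_ge0//.
  rewrite exprMn real_normK ?num_real// -detM mulrC ler_pM2l// exprAC enorm_sqr.
  by apply: lerXn2r => //; rewrite nnegrE ?dotp_ge0// ltW.
have trM : \tr M = \sum_i c i * dotp (u i) (u i) by exact: trace_frame_mx.
have trMle : \tr M <= rho ^+ 2.
  rewrite trM rho2 -[leRHS]mul1r -c1 mulr_suml; apply: ler_sum => i _.
  by rewrite ler_wpM2l// x0_max.
have trM0 : 0 <= \tr M by rewrite trM sumr_ge0// => i _; rewrite mulr_ge0// dotp_ge0.
have h2 : \det M <= (\tr M / n%:R) ^+ n by rewrite detM /M ML; exact: det_le_mxtrace.
(* In (rho^2/n)^n <= det M <= (tr M/n)^n <= (rho^2/n)^n equality holds throughout. *)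
have trME : \tr M = rho ^+ 2.
  apply/eqP; rewrite eq_le trMle/= -(@ler_pXn2r _ n)// ?nnegrE ?sqr_ge0//.
  apply: (le_trans h1); rewrite -ler_pdivlMr ?exprn_gt0// -exprVn -exprMn.
  exact: h2.
have ME : M = (rho ^+ 2 / n%:R)%:M.
  have := det_eq_mxtrace trigL n_gt0; rewrite -ML -/M trME; apply.
  rewrite -detM; apply/eqP; rewrite eq_le -{1}trME h2/=.
  by rewrite exprMn exprVn ler_pdivrMr ?exprn_gt0.
(* The weighted mean of the |u_i|^2 is tr M = rho^2, their largest possible value, so every atom of
   nonzero weight attains it. *)
have contact i : c i != 0 -> dotp (u i) (u i) = rho ^+ 2.
  move=> ci; have : \sum_i c i * (rho ^+ 2 - dotp (u i) (u i)) == 0.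
    under eq_bigr do rewrite mulrBr.
    by rewrite sumrB -trM trME -mulr_suml c1 mul1r subrr.
  rewrite psumr_eq0; last by move=> k _; rewrite mulr_ge0// subr_ge0 rho2 x0_max.
  move=> /allP/(_ i (mem_index_enum i))/=; rewrite mulf_eq0 (negPf ci)/= subr_eq0.
  by move=> /eqP.
have rho20 : rho ^+ 2 != 0 by rewrite gt_eqF// exprn_gt0.
(* Atoms of weight zero need not be contact points and are replaced by [x0]. *)
pose w i := if c i == 0 then x0 else u i.
have wrho i : dotp (w i) (w i) = rho ^+ 2.
  by rewrite /w; case: ifPn => [_|/contact//]; rewrite rho2.
exists m, (fun i => rho^-1 *: w i), (fun i => n%:R * c i); split.
- move=> i; rewrite scalerA divff ?gt_eqF// scale1r /w; case: ifP => _ //; exact: Ku.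
- by move=> i; rewrite dotpZl dotpZr wrho mulrA -expr2 exprVn mulVf.
- by move=> i; rewrite mulr_ge0// ltW.
rewrite /frame_mx (eq_bigr (fun i => (n%:R / rho ^+ 2) *: (c i *: ((u i)^T *m u i)))); last first.
  move=> i _; rewrite [(_ *: w i)^T]linearZ/= -scalemxAl -scalemxAr !scalerA /w.
  case: eqP => [->|_]; first by rewrite !(mulr0, mul0r) !scale0r.
  by congr (_ *: _); rewrite -exprVn expr2; ring.
rewrite -scaler_sumr -/(frame_mx u c) -/M ME scale_scalar_mx.
by rewrite mulrA divfK// divff// gt_eqF.
Qed.

Let K' : set 'rV[R]_n := [set x | K (rho *: x)].

Let K'E : K' = linear_image (rho^-1)%:M K.
Proof.
rewrite -scale_linear_image; apply/seteqP; split => x /=.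
  by move=> Kx; exists (rho *: x) => //; rewrite scalerA mulVf ?gt_eqF// scale1r.
by move=> [y Ky <-]; rewrite /K'/= scalerA divff ?gt_eqF// scale1r.
Qed.

Let lebnK' : lebn R n K' = (V / rho ^+ n)%:E.
Proof.
rewrite K'E lebn_linear_image//; last by rewrite scalar_unitmx// invr_eq0 gt_eqF.
rewrite det_scalar ger0_norm ?exprn_ge0 ?invr_ge0 ?(ltW rho_gt0)// lebnKE -EFinM exprVn.
by rewrite mulrC.
Qed.

Let mK' : measurable K'.
Proof. by rewrite K'E; apply: compact_measurable_rV; exact: compact_linear_image. Qed.

Let starK' x t : K' x -> 0 <= t <= 1 -> K' (t *: x).
Proof. by rewrite /K'/= => hx ht; rewrite scalerA mulrC -scalerA; exact: convex_star. Qed.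

Let hullK' m (v : 'I_m -> 'rV[R]_n) : (forall i, K (rho *: v i)) ->
  forall a : 'I_m -> R, \sum_i `|a i| <= 1 -> K' (\sum_i a i *: v i).
Proof.
move=> Kv a a1; rewrite /K'/= scaler_sumr (eq_bigr (fun i => a i *: (rho *: v i))); last first.
  by move=> i _; rewrite !scalerA mulrC.
by apply: convex_comb => // i; exact: NK.
Qed.

Let K'fin : (lebn R n K' < +oo)%E.
Proof. by rewrite lebnK' ltry. Qed.

Let fact_neq0 : n`!%:R != 0 :> R.
Proof. by rewrite pnatr_eq0 -lt0n fact_gt0. Qed.

(** The 2^n comes from the diameter 2 rho and cancels against the 2^n of [lebn_frame_ge]. *)
Let idq_scaled : n`!%:R * (V / rho ^+ n) = 2 ^+ n * (n`!%:R * idq K).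
Proof.
have := rho_gt0; rewrite idqE exprMn => r0.
by field; rewrite !expf_neq0// gt_eqF.
Qed.

Lemma behrend_idq_ge : behrend_position K -> 1 / n`!%:R <= idq K.
Proof.
move=> /behrend_contact[m [v [d [Kv v1 d0 F]]]].
have := lebn_frame_ge d0 v1 F mK' starK' (hullK' Kv) K'fin.
rewrite lebnK' -EFinM lee_fin idq_scaled -[leLHS]mulr1 ler_pM2l ?exprn_gt0// => h.
by rewrite ler_pdivrMr ?ltr0n ?fact_gt0// mulrC.
Qed.

Lemma behrend_idq_eq : behrend_position K -> idq K = 1 / n`!%:R -> regular_crosspolytope K.
Proof.
move=> /behrend_contact[m [v [d [Kv v1 d0 F]]]] hidq.
have eqK' : (n`!%:R%:E * lebn R n K' = (2 ^+ n)%:E)%E.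
  by rewrite lebnK' -EFinM idq_scaled hidq mulrC -[n`!%:R * _]mulrC divfK ?mul1r.
have [f fon] := lebn_frame_eq d0 v1 F mK' starK' (hullK' Kv) K'fin eqK'.
pose w j := v (f j).
have CK' : crosspolytope w `<=` K'.
  move=> x hx; rewrite (orthonormal_expansion fon x).
  by apply: hullK' => // i; exact: Kv.
have vK' : convex_set K'.
  apply/convex_setP => x y t Kx Ky ht; rewrite /K'/= scalerDr !scalerA !(mulrC rho) -!scalerA.
  exact: (convex_setP K).1.
have [e e0 he] := convex_body_ball vK K_sym iK.
have K'C : K' `<=` crosspolytope w.
  apply: (@sub_closed_full_measure _ _ _ _ (e / rho)) => //.
  - by rewrite divr_gt0.
  - move=> y hy; apply: he => i; rewrite mxE normrM gtr0_norm// mulrC -ltr_pdivlMr//.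
  - exact: closed_crosspolytope.
  - rewrite lebn_crosspolytope//; move: eqK'; rewrite lebnK' -EFinM => -[<-].
    by congr (_%:E); rewrite mulrAC divff// mul1r.
exists rho, w; split => //.
  split; first exact: orthonormal_basis_of.
  exact: fon.
rewrite conv_hull_crosspolytope//; apply/seteqP; split => x.
  move=> Kx; exists (rho^-1 *: x); last by rewrite scalerA divff ?gt_eqF// scale1r.
  by apply: K'C; rewrite /K'/= scalerA divff ?gt_eqF// scale1r.
by move=> [y Cy <-]; exact: CK'.
Qed.

End behrend.

Theorem proposition1p3 (R : realType) (n : nat) (n_gt0 : (0 < n)%N)
    (K : set 'rV[R]_n) (K_body : convex_body K) (K_sym : o_symmetric K)
    (K_behrend : behrend_position K) :
  1 / (n`!)%:R <= idq K /\
  (idq K = 1 / (n`!)%:R <-> regular_crosspolytope K).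
Proof.
have [cK _ [z /interior_subset Kz]] := K_body.
have [x0 Kx0 x0_max] := compact_farthest cK (ex_intro _ _ Kz).
split; first exact: (behrend_idq_ge n_gt0 K_body K_sym Kx0 x0_max).
split; first exact: (behrend_idq_eq n_gt0 K_body K_sym Kx0 x0_max).
exact: idq_regular_crosspolytope.
Qed.
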